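(* Suppose $f$ is a bounded measurable function on $\mathbb{B}$ with uniform radial limit $f_*$ on $\mathbb{S}$. Then $T_f$ is compact if and only if $f_*(\zeta)=0$ for $\sigma$-almost every $\zeta\in\mathbb{S}$.
   Context: Fix an integer $n\ge 2$. $\mathbb{B}$ is the open unit ball and $\mathbb{S}$ the unit sphere in $\mathbb{R}^n$; $|x|$ is the Euclidean norm. $\sigma$ is the unique $O(n)$-invariant regular Borel probability measure on $\mathbb{S}$, where $O(n)$ is the orthogonal group. $\nu$ is a regular Borel probability measure on $\mathbb{B}$ that is invariant under $O(n)$ and satisfies $\nu(\{x\in\mathbb{B}:|x|\ge r\})>0$ for all $0<r<1$. $L^2_\nu=L^2(\mathbb{B},\nu)$ (complex-valued functions), and $b^2_\nu$ is the closed subspace of $L^2_\nu$ consisting of the harmonic functions on $\mathbb{B}$ that belong to $L^2_\nu$. $Q:L^2_\nu\to b^2_\nu$ is the orthogonal projection. For a bounded measurable function $f$ on $\mathbb{B}$, the Toeplitz operator $T_f:b^2_\nu\to b^2_\nu$ is $T_fu=Q(fu)$. A bounded function $f$ on $\mathbb{B}$ has uniform radial limit $f_*$, where $f_*$ is a function on $\mathbb{S}$, if $\lim_{r\uparrow 1}\big(\sup\{|f(r\zeta)-f_*(\zeta)|:\zeta\in\mathbb{S}\}\big)=0$. *)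

(* Defs.v *)
From HB Require Import structures.
From mathcomp Require Import all_boot all_order all_algebra.
From mathcomp Require Import all_classical all_reals all_analysis.
From mathcomp Require Import complex.

Set Implicit Arguments.
Unset Strict Implicit.
Unset Printing Implicit Defensive.

Import Order.TTheory GRing.Theory Num.Theory.
Import numFieldNormedType.Exports.

Local Open Scope classical_set_scope.
Local Open Scope ring_scope.

Notation borel_space R n := (g_sigma_algebraType (@open 'rV[R]_n)).

Section Euclidean.
Context {R : realType} {n : nat}.
Implicit Types x : 'rV[R]_n.

(* The norm [`|x|] that the library puts on row vectors is the sup norm. *)
Definition enorm x : R := Num.sqrt (\sum_i (x 0 i) ^+ 2).

Definition unit_ball : set 'rV[R]_n := [set x | enorm x < 1].

Definition unit_sphere : set 'rV[R]_n := [set x | enorm x = 1].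

End Euclidean.

Section Measures.
Context {R : realType} {n : nat}.
Variable mu : probability (borel_space R n) R.

Definition orthogonal_invariant : Prop :=
  forall A : 'M[R]_n, A *m A^T = 1%:M ->
  forall E : set (borel_space R n), measurable E ->
    mu [set x | E ((x : 'rV[R]_n) *m A)] = mu E.

Definition regular_measure : Prop :=
  forall E : set (borel_space R n), measurable E ->
    mu E = ereal_inf
      [set mu U | U in [set U : set 'rV[R]_n | open U /\ E `<=` U]] /\
    mu E = ereal_sup
      [set mu K | K in [set K : set 'rV[R]_n | compact K /\ K `<=` E]].

(* An O(n)-invariant regular Borel probability measure on the Borel set X is
   represented by its extension by zero to R^n. *)
Definition invariant_probability_on (X : set 'rV[R]_n) : Prop :=
  [/\ mu X = 1%:E, regular_measure & orthogonal_invariant].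

End Measures.

Section Harmonic.
Context {R : realType} {n : nat}.
Implicit Types (U : set 'rV[R]_n) (g : 'rV[R]_n -> R).

Definition partial (i : 'I_n) g : 'rV[R]_n -> R :=
  fun x => 'D_(delta_mx 0 i : 'rV[R]_n) g x.

(* Meant for U open: derivatives and continuity at a point of U then depend on
   the values on U only. *)
Definition continuously_differentiable2 U g : Prop :=
  forall x, U x ->
    [/\ {for x, continuous g},
        forall i, derivable g x (delta_mx 0 i) /\
                  {for x, continuous (partial i g)} &
        forall i j, derivable (partial i g) x (delta_mx 0 j) /\
                    {for x, continuous (partial j (partial i g))}].

Definition laplacian g : 'rV[R]_n -> R :=
  fun x => \sum_i partial i (partial i g) x.

Definition real_harmonic_on U g : Prop :=
  continuously_differentiable2 U g /\ forall x, U x -> laplacian g x = 0.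

Definition harmonic_on U (u : 'rV[R]_n -> R[i]) : Prop :=
  real_harmonic_on U (fun x => complex.Re (u x)) /\
  real_harmonic_on U (fun x => complex.Im (u x)).

Definition cmeasurable (D : set 'rV[R]_n) (h : 'rV[R]_n -> R[i]) : Prop :=
  measurable_fun (D : set (borel_space R n))
    (fun x : borel_space R n => complex.Re (h x)) /\
  measurable_fun (D : set (borel_space R n))
    (fun x : borel_space R n => complex.Im (h x)).

End Harmonic.

(* Functions on the ball (or the sphere) are represented by functions on R^n;
   nothing below depends on their values elsewhere.  Elements of L^2 are
   represented by square-integrable functions rather than by classes. *)
Section HarmonicBergman.
Context {R : realType} {n : nat}.
Variable nu : probability (borel_space R n) R.

Local Notation B := (@unit_ball R n : set (borel_space R n)).
Local Notation fct := ('rV[R]_n -> R[i]).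

Definition L2 : set fct :=
  [set h | cmeasurable unit_ball h /\
           (\int[nu]_(x in B) ((Normc.normc (h x)) ^+ 2)%:E < +oo)%E].

Definition L2norm (h : fct) : R :=
  Num.sqrt (\int[nu]_(x in B) (Normc.normc (h x)) ^+ 2).

Definition L2inner (g h : fct) : R[i] :=
  Complex (\int[nu]_(x in B) complex.Re (g x * conjc (h x)))
          (\int[nu]_(x in B) complex.Im (g x * conjc (h x))).

Definition harmonic_bergman : set fct :=
  [set u | L2 u /\ harmonic_on unit_ball u].

Definition is_orthogonal_projection (h q : fct) : Prop :=
  harmonic_bergman q /\
  forall v, harmonic_bergman v -> L2inner (fun x => h x - q x) v = 0.

Definition bergman_projection (h : fct) : fct :=
  xget (fun=> 0) [set q | is_orthogonal_projection h q].

Definition toeplitz (f u : fct) : fct :=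
  bergman_projection (fun x => f x * u x).

(* Every norm-bounded sequence has a subsequence whose image converges in the
   norm of the harmonic Bergman space. *)
Definition compact_operator (T : fct -> fct) : Prop :=
  forall u : nat -> fct,
    (forall k, harmonic_bergman (u k)) ->
    (exists M : R, forall k, L2norm (u k) <= M) ->
    exists phi : nat -> nat, {homo phi : i j / (i < j)%N} /\
    exists2 g : fct, harmonic_bergman g &
      L2norm (fun x => T (u (phi k)) x - g x) @[k --> \oo] --> (0 : R).

End HarmonicBergman.

Definition bounded_on {R : realType} {n : nat} (D : set 'rV[R]_n)
    (f : 'rV[R]_n -> R[i]) : Prop :=
  exists M : R, forall x, D x -> Normc.normc (f x) <= M.

Definition uniform_radial_limit {R : realType} {n : nat}
    (f fs : 'rV[R]_n -> R[i]) : Prop :=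
  ereal_sup [set (Normc.normc (f (r *: z) - fs z))%:E | z in unit_sphere]
    @[r --> (1 : R)^'-] --> 0%E.

(* Main.v *)
(* By invariance, [nu] disintegrates in polar coordinates, so that near the
   boundary integrals against [nu] become integrals over spheres.

   If [fs] vanishes almost everywhere, then for every [e > 0] the function [f] is
   at most [e] in modulus at [nu]-almost every point close enough to the sphere.
   The Poisson integral gives point evaluation bounds and Montel's theorem, so a
   bounded sequence of the harmonic Bergman space has a subsequence [u_k]
   converging locally uniformly to some [u] of the space, and
   [|T_f u_k - T_f u| <= |f (u_k - u)|] tends to [0].

   Conversely, let [p] and [q] be orthogonal vectors of the same norm and let
   [z_x = x.p + i x.q], so that polynomials in [z_x] are harmonic in [x].  If [T_f]
   is compact then [<T_f u, u> = \int f |u|^2 dnu] is negligible with respect to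
   [\int |z_x|^(2m) dnu] for [u x = z_x^m (z_x + z_y)^N], [y] on the sphere and [m]
   large, uniformly in [p], [q] and [y].  As [m] grows only the boundary matters,
   hence the same holds for the integral of [fs |u|^2] over the sphere.  Averaging
   over [p] and [q] gives a zonal kernel which for large [N] concentrates at [y];
   so [fs] is orthogonal to all Lipschitz functions, and it vanishes almost
   everywhere because [sigma] is regular. *)
Require Import Defs.
From HB Require Import structures.
From mathcomp Require Import all_boot all_order all_algebra.
From mathcomp Require Import all_classical all_reals all_analysis.
From mathcomp Require Import complex measurable_realfun.
From mathcomp Require Import ring lra.

Set Implicit Arguments.
Unset Strict Implicit.
Unset Printing Implicit Defensive.

Import Order.TTheory GRing.Theory Num.Theory.
Import numFieldNormedType.Exports.

Local Open Scope classical_set_scope.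
Local Open Scope ring_scope.

(** * Euclidean geometry *)

(** The disintegration compares [nu] with the law of [|x| y], where [x] and [y] are independent with
    laws [nu] and [sigma]. A rotation invariant kernel of small width smears one into the other, so
    the two laws agree up to thickening of sets, hence on closed sets. In the converse the obstacle
    is uniformity. The smallness is integrated over [p], [q] and [y], so one threshold for [m] must
    serve them all, including pairs close to 0, which Gram-Schmidt makes from nearly parallel
    vectors. Every estimate is therefore relative to the mean of [|z_x|^(2m)], never absolute. The
    exponents have different tasks. A large [m] pushes the mass to the boundary and, in the average
    over unit vectors, selects the nearly orthonormal pairs whose plane nearly contains [x]. For
    these, [|z_x + z_y|^2] is almost 4 at [y = x], while on the sphere it never exceeds
    [|x + y|^2 = 4 - |x - y|^2]; the power [N] turns this gap into concentration. [N] is fixed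
    before [m], whose threshold depends on it. Invariance makes the total mass of the averaged
    kernel the same at all points, so that it can be divided out. *)

Section InnerProduct.
Context {R : realType} {n : nat}.
Implicit Types x y z : 'rV[R]_n.

Definition dotp x y : R := \sum_i x 0 i * y 0 i.

Lemma dotpC x y : dotp x y = dotp y x.
Proof. by apply: eq_bigr => i _; rewrite mulrC. Qed.

Lemma dotpDl x y z : dotp (x + y) z = dotp x z + dotp y z.
Proof. by rewrite -big_split; apply: eq_bigr => i _; rewrite mxE mulrDl. Qed.

Lemma dotpZl (c : R) x y : dotp (c *: x) y = c * dotp x y.
Proof. by rewrite mulr_sumr; apply: eq_bigr => i _; rewrite mxE mulrA. Qed.

Lemma dotpNl x y : dotp (- x) y = - dotp x y.
Proof. by rewrite -scaleN1r dotpZl mulN1r. Qed.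

Lemma dotpBl x y z : dotp (x - y) z = dotp x z - dotp y z.
Proof. by rewrite dotpDl dotpNl. Qed.

Lemma dotpDr x y z : dotp z (x + y) = dotp z x + dotp z y.
Proof. by rewrite dotpC dotpDl !(dotpC z). Qed.

Lemma dotpZr (c : R) x y : dotp y (c *: x) = c * dotp y x.
Proof. by rewrite dotpC dotpZl dotpC. Qed.

Lemma dotpNr x y : dotp y (- x) = - dotp y x.
Proof. by rewrite dotpC dotpNl dotpC. Qed.

Lemma dotpBr x y z : dotp z (x - y) = dotp z x - dotp z y.
Proof. by rewrite dotpDr dotpNr. Qed.

Lemma dotp0l x : dotp 0 x = 0.
Proof. by rewrite -(scale0r x) dotpZl mul0r. Qed.

Lemma dotp_ge0 x : 0 <= dotp x x.
Proof. by apply: sumr_ge0 => i _; rewrite -expr2 sqr_ge0. Qed.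

Lemma enorm_ge0 x : 0 <= enorm x.
Proof. exact: sqrtr_ge0. Qed.

Lemma sqr_enorm x : enorm x ^+ 2 = dotp x x.
Proof.
rewrite /enorm sqr_sqrtr; first by apply: eq_bigr => i _; rewrite expr2.
by apply: sumr_ge0 => i _; rewrite sqr_ge0.
Qed.

Lemma enormE x : enorm x = Num.sqrt (dotp x x).
Proof. by rewrite -sqr_enorm sqrtr_sqr ger0_norm// enorm_ge0. Qed.

Lemma dotp_eq0 x : dotp x x = 0 -> x = 0.
Proof.
move=> /eqP; rewrite psumr_eq0 => [/allP h|i _]; last by rewrite -expr2 sqr_ge0.
apply/rowP => i; rewrite mxE; have := h i; rewrite mem_index_enum => /(_ isT).
by rewrite -expr2 sqrf_eq0 => /eqP.
Qed.

Lemma enorm_eq0 x : enorm x = 0 -> x = 0.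
Proof. by move=> h; apply: dotp_eq0; rewrite -sqr_enorm h expr0n. Qed.

Lemma enorm0 : enorm (0 : 'rV[R]_n) = 0.
Proof. by rewrite enormE dotp0l sqrtr0. Qed.

Lemma enorm_gt0 x : x != 0 -> 0 < enorm x.
Proof.
move=> x0; rewrite lt_neqAle enorm_ge0 andbT eq_sym.
by apply: contra_neq x0 => /enorm_eq0.
Qed.

Lemma enormZ (c : R) x : enorm (c *: x) = `|c| * enorm x.
Proof.
by rewrite !enormE dotpZl dotpZr mulrA -expr2 sqrtrM ?sqr_ge0// sqrtr_sqr.
Qed.

Lemma enormN x : enorm (- x) = enorm x.
Proof. by rewrite -scaleN1r enormZ normrN1 mul1r. Qed.

Lemma enormB x y : enorm (x - y) = enorm (y - x).
Proof. by rewrite -enormN opprB. Qed.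

Lemma sqr_dotp_le x y : dotp x y ^+ 2 <= dotp x x * dotp y y.
Proof.
have [/dotp_eq0 ->|y0] := eqVneq (dotp y y) 0.
  by rewrite (dotpC x) !dotp0l expr0n mulr0.
have yp : 0 < dotp y y by rewrite lt_neqAle eq_sym y0 dotp_ge0.
have := dotp_ge0 (dotp y y *: x - dotp x y *: y).
rewrite !(dotpBl, dotpBr, dotpZl, dotpZr) (dotpC y x) => h.
have : 0 <= dotp y y * (dotp x x * dotp y y - dotp x y ^+ 2) by lra.
by rewrite pmulr_rge0// subr_ge0.
Qed.

Lemma dotp_le x y : `|dotp x y| <= enorm x * enorm y.
Proof.
rewrite -(@ler_pXn2r _ 2)// ?nnegrE ?mulr_ge0 ?enorm_ge0//.
by rewrite exprMn !sqr_enorm -normrX ger0_norm ?sqr_ge0// sqr_dotp_le.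
Qed.

Lemma enormD x y : enorm (x + y) <= enorm x + enorm y.
Proof.
rewrite -(@ler_pXn2r _ 2)// ?nnegrE ?addr_ge0 ?enorm_ge0//.
rewrite sqrrD !sqr_enorm dotpDl !dotpDr (dotpC y x).
by have := dotp_le x y; have := ler_norm (dotp x y); lra.
Qed.

Lemma enormB_ge x y : enorm x - enorm y <= enorm (x - y).
Proof. by rewrite lerBlDr; apply: le_trans (enormD _ _); rewrite subrK. Qed.

Lemma sqr_enormB x y :
  enorm (x - y) ^+ 2 = enorm x ^+ 2 - 2 * dotp x y + enorm y ^+ 2.
Proof. by rewrite !sqr_enorm !(dotpBl, dotpBr) (dotpC y x); lra. Qed.

Lemma coord_le_enorm x i : `|x 0 i| <= enorm x.
Proof.
rewrite -(@ler_pXn2r _ 2)// ?nnegrE ?enorm_ge0// sqr_enorm /dotp.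
rewrite (bigD1 i)//= -normrX ger0_norm ?sqr_ge0// -expr2 lerDl.
by apply: sumr_ge0 => j _; rewrite -expr2 sqr_ge0.
Qed.

Lemma norm_le_enorm x : `|x| <= enorm x.
Proof.
rewrite {1}/Num.Def.normr/= mx_normrE; apply/bigmax_leP; split; first exact: enorm_ge0.
by move=> [i j] _ /=; rewrite ord1; exact: coord_le_enorm.
Qed.

Lemma dotp_delta x i : dotp x (delta_mx 0 i) = x 0 i.
Proof.
rewrite /dotp (bigD1 i)//= mxE !eqxx mulr1 big1 ?addr0// => j ji.
by rewrite mxE (negbTE ji) andbF mulr0.
Qed.

Lemma enorm_delta i : enorm (delta_mx 0 i : 'rV[R]_n) = 1.
Proof. by rewrite enormE dotp_delta mxE !eqxx sqrtr1. Qed.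

Lemma dotpE x y : dotp x y = (x *m y^T) 0 0.
Proof. by rewrite mxE; apply: eq_bigr => i _; rewrite mxE. Qed.

Lemma dotp_orth (A : 'M[R]_n) x y : A *m A^T = 1%:M ->
  dotp (x *m A) (y *m A) = dotp x y.
Proof.
by move=> hA; rewrite !dotpE trmx_mul mulmxA -(mulmxA x) hA mulmx1.
Qed.

Lemma enorm_orth (A : 'M[R]_n) x : A *m A^T = 1%:M -> enorm (x *m A) = enorm x.
Proof. by move=> hA; rewrite !enormE dotp_orth. Qed.

(** One reflection does it, in the hyperplane orthogonal to [v = x - y]. Equality of the norms gives
    [|v|^2 = 2 x.v], which is exactly what makes the reflection send [x] to [y]. *)
Lemma orthogonal_transitive x y : enorm x = enorm y ->
  exists2 A : 'M[R]_n, A *m A^T = 1%:M & x *m A = y.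
Proof.
move=> xy; have [->|xNy] := eqVneq x y.
  by exists 1%:M; rewrite ?trmx1 ?mulmx1.
pose v := x - y; pose d := dotp v v.
have d0 : d != 0.
  by apply: contraNneq xNy => /dotp_eq0 /eqP; rewrite subr_eq0.
have hd : d = 2 * dotp x v.
  rewrite /d /v !(dotpBl, dotpBr) -!sqr_enorm xy (dotpC y x); lra.
have vv : v *m v^T = d%:M.
  by apply/matrixP => i j; rewrite !ord1 -dotpE mxE eqxx mulr1n.
pose P := v^T *m v; pose c := 2 / d.
have PP : P *m P = d *: P.
  by rewrite /P mulmxA -(mulmxA v^T) vv mul_mx_scalar -scalemxAl.
pose A : 'M[R]_n := 1%:M - c *: P.
have AT : A^T = A.
  by rewrite /A /P linearB/= trmx1 linearZ/= trmx_mul trmxK.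
exists A.
  rewrite AT /A mulmxBr mulmx1 mulmxBl mul1mx -scalemxAl -scalemxAr PP !scalerA.
  have -> : c * c * d = c + c by rewrite /c; field.
  rewrite scalerDl; set w := c *: P; by rewrite opprB addrK subrK.
rewrite /A /P /c mulmxBr mulmx1 -scalemxAr mulmxA.
have -> : x *m v^T = (dotp x v)%:M.
  by apply/matrixP => i j; rewrite !ord1 -dotpE mxE eqxx mulr1n.
rewrite mul_scalar_mx scalerA -mulrA [_^-1 * _]mulrC mulrA -hd divff// scale1r.
by rewrite opprB addrC subrK.
Qed.

End InnerProduct.

Lemma cvg_bigsum {R : realType} {T I : Type} (F : set_system T) {FF : Filter F}
    (r : seq I) (f : I -> T -> R) (l : I -> R) :
  (forall i, f i x @[x --> F] --> l i) ->
  (\sum_(i <- r) f i x) @[x --> F] --> \sum_(i <- r) l i.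
Proof.
move=> h; elim: r => [|i r IH].
  by under eq_fun do rewrite big_nil; rewrite big_nil; exact: cvg_cst.
by under eq_fun do rewrite big_cons; rewrite big_cons; exact: cvgD.
Qed.

Section EuclideanTopology.
Context {R : realType} {n : nat}.
Implicit Types x y : 'rV[R]_n.

Lemma dotp_continuous_pair :
  continuous (fun z : 'rV[R]_n * 'rV[R]_n => dotp z.1 z.2).
Proof.
move=> z; rewrite /dotp; apply: (@cvg_bigsum _ _ _ (nbhs _)) => i.
apply: cvgM.
  by apply: (@continuous_comp _ _ _ fst (fun x : 'rV[R]_n => x 0 i));
    [exact: cvg_fst|exact: coord_continuous].
by apply: (@continuous_comp _ _ _ snd (fun x : 'rV[R]_n => x 0 i));
  [exact: cvg_snd|exact: coord_continuous].
Qed.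

Lemma dotp_continuousl y : continuous (dotp^~ y).
Proof.
move=> x; rewrite /dotp; apply: (@cvg_bigsum _ _ _ (nbhs _)) => i.
by apply: (@cvgM _ _ (nbhs x)); [exact: coord_continuous|exact: cvg_cst].
Qed.

Lemma sqr_enorm_continuous : continuous (fun x : 'rV[R]_n => dotp x x).
Proof.
move=> x; rewrite /dotp; apply: (@cvg_bigsum _ _ _ (nbhs _)) => i.
by apply: (@cvgM _ _ (nbhs x)); exact: coord_continuous.
Qed.

Lemma enorm_continuous : continuous (@enorm R n).
Proof.
move=> x; rewrite (_ : @enorm R n = Num.sqrt \o (fun x => dotp x x)); last first.
  by apply/funext => y; rewrite /= enormE.
apply: continuous_comp; first exact: sqr_enorm_continuous.
exact: sqrt_continuous.
Qed.

Lemma open_eball r : open [set x : 'rV[R]_n | enorm x < r].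
Proof.
rewrite (_ : mkset _ = @enorm R n @^-1` [set y | y < r])//.
by apply: open_comp => [x _|]; [exact: enorm_continuous|exact: open_lt].
Qed.

Lemma closed_eball r : closed [set x : 'rV[R]_n | enorm x <= r].
Proof.
rewrite (_ : mkset _ = @enorm R n @^-1` [set y | y <= r])//.
by apply: preimage_closed => [x _|]; [exact: enorm_continuous|exact: closed_le].
Qed.

Lemma closed_esphere r : closed [set x : 'rV[R]_n | enorm x = r].
Proof.
rewrite (_ : mkset _ = @enorm R n @^-1` [set y | y = r])//.
by apply: preimage_closed => [x _|]; [exact: enorm_continuous|exact: closed_eq].
Qed.

Lemma compact_eball r : compact [set x : 'rV[R]_n | enorm x <= r].
Proof.
apply: bounded_closed_compact; last exact: closed_eball.
exists r; split => [|M rM x /= xr]; first exact: num_real.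
by rewrite (le_trans (norm_le_enorm x))// (le_trans xr)// ltW.
Qed.

Lemma compact_esphere r : compact [set x : 'rV[R]_n | enorm x = r].
Proof.
apply: (@subclosed_compact _ _ [set x : 'rV[R]_n | enorm x <= r]).
- exact: closed_esphere.
- exact: compact_eball.
- by move=> x /= ->.
Qed.

Lemma nbhs_enorm_lt x (e : R) : 0 < e -> \forall y \near x, enorm (y - x) < e.
Proof.
move=> e0.
have h : nbhs (x - x) [set y : 'rV[R]_n | enorm y < e].
  by apply: open_nbhs_nbhs; split; [exact: open_eball|rewrite /= subrr enorm0].
have c : {for x, continuous (fun y => y - x)}.
  by apply: (@cvgB _ _ _ (nbhs x)); [exact: cvg_id|exact: cvg_cst].
exact: c h.
Qed.

End EuclideanTopology.

(** * The Borel sigma-algebra of the Euclidean space *)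

Section BorelMeasurability.
Context {R : realType} {n : nat}.
Local Notation E := (borel_space R n).

Lemma open_measurable (U : set 'rV[R]_n) : open U -> measurable (U : set E).
Proof. exact: sub_sigma_algebra. Qed.

Lemma closed_measurable (U : set 'rV[R]_n) : closed U -> measurable (U : set E).
Proof.
move=> cU; rewrite -[U]setCK; apply: measurableC; apply: open_measurable.
exact: closed_openC.
Qed.

Lemma continuous_on_measurable (U : set 'rV[R]_n) (g : 'rV[R]_n -> R) :
  open U -> (forall x, U x -> {for x, continuous g}) ->
  measurable_fun (U : set E) (g : E -> R).
Proof.
move=> oU cg; apply: (measurability (@RGenOInfty.G R)).
  exact: RGenOInfty.measurableE.
move=> _ [_ [a ->] <-]; apply: open_measurable.
have -> : U `&` g @^-1` `]a, +oo[ = [set x | U x /\ a < g x].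
  by apply/seteqP; split => x /=; rewrite in_itv/= andbT.
rewrite openE => x [Ux ax]; rewrite /interior.
near=> y; split; first by near: y; exact: open_nbhs_nbhs.
by near: y; exact: (cvgr_gt _ (cg _ Ux)).
Unshelve. all: end_near. Qed.

Lemma continuous_measurable (g : 'rV[R]_n -> R) :
  continuous g -> measurable_fun setT (g : E -> R).
Proof. by move=> cg; apply: (@continuous_on_measurable setT g openT) => x _; exact: cg. Qed.

Lemma coord_measurable i : measurable_fun setT (fun x : E => (x : 'rV[R]_n) 0 i).
Proof. by apply: continuous_measurable => x; exact: coord_continuous. Qed.

Lemma enorm_measurable : measurable_fun setT (@enorm R n : E -> R).
Proof. exact: continuous_measurable enorm_continuous. Qed.

(** [borel_space] is generated by the open sets. Each open set is the union of the countably many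
    cubes with rational centre and radius [1 / (k + 1)] that it contains, and the preimage of a cube
    is described by the coordinates. *)
Lemma measurable_to_borel d (T : measurableType d) (D : set T) (h : T -> E) :
  (forall i, measurable_fun D (fun t => (h t : 'rV[R]_n) 0 i)) ->
  measurable_fun D h.
Proof.
move=> mh; move=> mD; apply: (@measurability _ _ _ _ D h (@open 'rV[R]_n)) => // _ [U oU <-].
pose box (q : 'rV[rat]_n) (k : nat) : set 'rV[R]_n :=
  [set x | forall i, `|x 0 i - ratr (q 0 i)| < k.+1%:R^-1].
pose I := [set qk : 'rV[rat]_n * nat | box qk.1 qk.2 `<=` U].
have mbox q k : measurable (D `&` h @^-1` box q k).
  rewrite (_ : _ `&` _ = D `&` \bigcap_(i in [set: 'I_n])
      (D `&` (fun t => `|(h t : 'rV[R]_n) 0 i - ratr (q 0 i)|) @^-1`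
         `]-oo, k.+1%:R^-1[)); last first.
    apply/seteqP; split=> t /= [Dt H]; split => // i; last by have [_] := H i Logic.I; rewrite /= in_itv.
    by move=> _; split => //=; rewrite in_itv; exact: H.
  apply: measurableI => //; rewrite -[X in measurable X]setCK setC_bigcap.
  apply: measurableC; apply: countable_bigcupT_measurable => [|i]; first exact: countableP.
  apply: measurableC; suff mF : measurable_fun D (fun t => `|(h t : 'rV[R]_n) 0 i - ratr (q 0 i)|).
    by apply: mF.
  apply: measurableT_comp => //; apply: measurable_funB => //; exact: mh.
rewrite (_ : D `&` h @^-1` U =
    \bigcup_qk (if qk \in I then D `&` h @^-1` box qk.1 qk.2 else set0)).
  apply: countable_bigcupT_measurable => [|qk]; last by case: ifP.
  exact: countableP.
apply/seteqP; split=> t /=; last first.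
  by move=> [qk _]; case: ifP => //; rewrite inE => qI [Dt /qI].
move=> [Dt Ut].
have /nbhs_ballP[e /= e0 eU] : nbhs (h t : 'rV[R]_n) U by exact: open_nbhs_nbhs.
have [k ke] : exists k : nat, k.+1%:R^-1 < e / 2.
  have : 0 < e / 2 by rewrite divr_gt0.
  by move=> hp; have [k _ /(_ _ (leqnn k))] := near_infty_natSinv_lt (PosNum hp); exists k.
(* A cube of radius [c] whose centre is within [c] of [h t] stays within [2 c < e] of [h t]. *)
have [c [c0 {}ke cE]] : exists c : R, [/\ 0 < c, c < e / 2 & k.+1%:R^-1 = c].
  by exists (k.+1%:R^-1).
have qex i : exists q : rat, `|(h t : 'rV[R]_n) 0 i - ratr q| < c.
  have : (h t : 'rV[R]_n) 0 i - c < (h t : 'rV[R]_n) 0 i + c by lra.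
  by move=> /rat_in_itvoo[q]; rewrite in_itv/= => h1; exists q; rewrite ltr_norml; lra.
pose q := \row_i projT1 (cid (qex i)).
have hq i : `|(h t : 'rV[R]_n) 0 i - ratr (q 0 i)| < c.
  by rewrite mxE; exact: projT2 (cid (qex i)).
exists (q, k) => //; rewrite mem_set /I /box /= cE//.
move=> x /= hx; apply: eU; split => // i j; rewrite ord1.
have := hx j; have := hq j; rewrite /ball/= => h1 h2.
rewrite (_ : _ - _ = ((h t : 'rV[R]_n) 0 j - ratr (q 0 j)) - (x 0 j - ratr (q 0 j))); last by lra.
by rewrite (le_lt_trans (ler_normB _ _))//; lra.
Qed.

Lemma row_continuous_comp_measurable (h : 'rV[R]_n -> 'rV[R]_n) :
  continuous h -> measurable_fun setT (h : E -> E).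
Proof.
move=> ch; apply: (@measurability _ _ _ _ setT (h : E -> E) (@open 'rV[R]_n)) => // _ [U oU <-]; rewrite setTI.
by apply: open_measurable; apply: open_comp => // x _; exact: ch.
Qed.

End BorelMeasurability.

(** * Bounded measurable functions *)

Section BoundedMeasurable.
Context d (T : measurableType d) (R : realType).
Implicit Types (D : set T) (g h : T -> R).

(** These functions are integrable for every probability and stable under products, sections and
    partial integration, so this one predicate carries the integrability conditions of all arguments
    outside [L2]. *)
Definition bmeas D g :=
  measurable_fun D g /\ exists M : R, forall x, D x -> `|g x| <= M.

Lemma bmeas_cst D (c : R) : bmeas D (fun=> c).
Proof. by split; [exact: measurable_cst|exists `|c|]. Qed.

Lemma bmeasD D g h : bmeas D g -> bmeas D h -> bmeas D (fun x => g x + h x).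
Proof.
move=> [mg [M gM]] [mh [N hN]]; split; first exact: measurable_funD.
by exists (M + N) => x Dx; rewrite (le_trans (ler_normD _ _))// lerD ?gM ?hN.
Qed.

Lemma bmeasM D g h : bmeas D g -> bmeas D h -> bmeas D (fun x => g x * h x).
Proof.
move=> [mg [M gM]] [mh [N hN]]; split; first exact: measurable_funM.
by exists (M * N) => x Dx; rewrite normrM ler_pM ?gM ?hN.
Qed.

Lemma bmeasZ D (c : R) g : bmeas D g -> bmeas D (fun x => c * g x).
Proof. exact: bmeasM (bmeas_cst D c). Qed.

Lemma bmeasN D g : bmeas D g -> bmeas D (fun x => - g x).
Proof. by move=> /(bmeasZ (-1)); under eq_fun do rewrite mulN1r. Qed.

Lemma bmeasB D g h : bmeas D g -> bmeas D h -> bmeas D (fun x => g x - h x).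
Proof. by move=> bg bh; apply: bmeasD => //; exact: bmeasN. Qed.

Lemma bmeasX D g k : bmeas D g -> bmeas D (fun x => g x ^+ k).
Proof.
move=> bg; elim: k => [|k IH]; first by under eq_fun do rewrite expr0; exact: bmeas_cst.
by under eq_fun do rewrite exprS; exact: bmeasM.
Qed.

Lemma bmeas_norm D g : bmeas D g -> bmeas D (fun x => `|g x|).
Proof.
move=> [mg [M gM]]; split; first exact: measurableT_comp.
by exists M => x Dx; rewrite normr_id gM.
Qed.

Lemma bmeas_eq D g h : {in D, g =1 h} -> bmeas D g -> bmeas D h.
Proof.
move=> gh [mg [M gM]]; split; first by apply: eq_measurable_fun mg => x Dx; exact: gh.
by exists M => x Dx; rewrite -gh ?inE//; exact: gM.
Qed.

Lemma bmeas_indic D A : measurable A -> bmeas D (\1_A : T -> R).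
Proof.
move=> mA; split; first by apply: measurable_funTS; exact: measurable_indic.
by exists 1 => x _; rewrite indicE; case: (_ \in _); rewrite ?normr1 ?normr0.
Qed.

Variable P : probability T R.

Lemma bmeas_integrable D g : measurable D -> bmeas D g ->
  P.-integrable D (EFin \o g).
Proof.
move=> mD [mg [M gM]]; apply: measurable_bounded_integrable => //.
  by rewrite -ge0_fin_numE ?fin_num_measure.
exists M; split => [|N MN x Dx]; first exact: num_real.
by apply: le_trans (gM _ Dx) (ltW MN).
Qed.

Lemma Rint_cst D (c : R) : measurable D -> P D = 1%E ->
  \int[P]_(_ in D) c = c.
Proof.
move=> mD PD; rewrite Rintegral_cst//; transitivity (c * fine (P D)) => //.
by rewrite PD mulr1.
Qed.

Lemma Rint_le D g h : measurable D -> bmeas D g -> bmeas D h ->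
  (forall x, D x -> g x <= h x) -> \int[P]_(x in D) g x <= \int[P]_(x in D) h x.
Proof. by move=> mD bg bh gh; apply: le_Rintegral => //; exact: bmeas_integrable. Qed.

Lemma Rint_le_cst D g (c : R) : measurable D -> P D = 1%E -> bmeas D g ->
  (forall x, D x -> g x <= c) -> \int[P]_(x in D) g x <= c.
Proof.
move=> mD PD bg gc; rewrite -[leRHS](Rint_cst c mD PD).
by apply: Rint_le => //; exact: bmeas_cst.
Qed.

Lemma Rint_norm D g : measurable D -> bmeas D g ->
  `|\int[P]_(x in D) g x| <= \int[P]_(x in D) `|g x|.
Proof. by move=> mD bg; apply: le_normr_Rintegral => //; exact: bmeas_integrable. Qed.

Lemma Rint_norm_le D g (c : R) : measurable D -> P D = 1%E -> bmeas D g ->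
  (forall x, D x -> `|g x| <= c) -> `|\int[P]_(x in D) g x| <= c.
Proof.
move=> mD PD bg gc; rewrite (le_trans (Rint_norm mD bg))//.
by apply: Rint_le_cst => //; exact: bmeas_norm.
Qed.

Lemma RintD D g h : measurable D -> bmeas D g -> bmeas D h ->
  \int[P]_(x in D) (g x + h x) = \int[P]_(x in D) g x + \int[P]_(x in D) h x.
Proof. by move=> mD bg bh; apply: RintegralD => //; exact: bmeas_integrable. Qed.

Lemma RintB D g h : measurable D -> bmeas D g -> bmeas D h ->
  \int[P]_(x in D) (g x - h x) = \int[P]_(x in D) g x - \int[P]_(x in D) h x.
Proof. by move=> mD bg bh; apply: RintegralB => //; exact: bmeas_integrable. Qed.

Lemma RintZ D g (c : R) : measurable D -> bmeas D g ->
  \int[P]_(x in D) (c * g x) = c * \int[P]_(x in D) g x.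
Proof. by move=> mD bg; apply: RintegralZl => //; exact: bmeas_integrable. Qed.

Lemma Rint_eq D g h : (forall x, D x -> g x = h x) ->
  \int[P]_(x in D) g x = \int[P]_(x in D) h x.
Proof. by move=> gh; apply: eq_Rintegral => x /set_mem; exact: gh. Qed.

Lemma EFin_Rint D g : measurable D -> bmeas D g ->
  (\int[P]_(x in D) g x)%:E = (\int[P]_(x in D) (g x)%:E)%E.
Proof. by move=> mD bg; rewrite /Rintegral fineK// integrable_fin_num//; exact: bmeas_integrable. Qed.

End BoundedMeasurable.

(** * Fubini's theorem for bounded functions on rectangles *)

Section BoundedSections.
Context d1 d2 (T1 : measurableType d1) (T2 : measurableType d2) (R : realType).
Variables (D1 : set T1) (D2 : set T2).
Hypotheses (mD1 : measurable D1) (mD2 : measurable D2).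

Lemma bmeas_section1 (g : T1 * T2 -> R) x : D1 x -> bmeas (D1 `*` D2) g ->
  bmeas D2 (fun y => g (x, y)).
Proof.
move=> D1x [mg [M gM]]; split; last by exists M => y D2y; exact: gM.
apply: (@measurable_comp _ _ _ _ _ _ (D1 `*` D2) g _ (pair x)) => //.
- exact: measurableX.
- by move=> _ [y D2y <-].
- by apply: measurable_funTS; exact: pair1_measurable.
Qed.

Lemma bmeas_section2 (g : T1 * T2 -> R) y : D2 y -> bmeas (D1 `*` D2) g ->
  bmeas D1 (fun x => g (x, y)).
Proof.
move=> D2y [mg [M gM]]; split; last by exists M => x D1x; exact: gM.
apply: (@measurable_comp _ _ _ _ _ _ (D1 `*` D2) g _ (pair^~ y)) => //.
- exact: measurableX.
- by move=> _ [x D1x <-].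
- by apply: measurable_funTS; exact: pair2_measurable.
Qed.

Lemma bmeas_fst (g : T1 -> R) : bmeas D1 g -> bmeas (D1 `*` D2) (fun z => g z.1).
Proof.
move=> [mg [M gM]]; split; last by exists M => z [/gM].
apply: (@measurable_comp _ _ _ _ _ _ D1 g _ fst) => //; last exact: measurable_funTS.
by move=> _ [z [? _] <-].
Qed.

Lemma bmeas_snd (g : T2 -> R) : bmeas D2 g -> bmeas (D1 `*` D2) (fun z => g z.2).
Proof.
move=> [mg [M gM]]; split; last by exists M => z [_ /gM].
apply: (@measurable_comp _ _ _ _ _ _ D2 g _ snd) => //; last exact: measurable_funTS.
by move=> _ [z [_ ?] <-].
Qed.

Lemma bmeas_swap (g : T1 * T2 -> R) : bmeas (D1 `*` D2) g ->
  bmeas (D2 `*` D1) (fun z => g (z.2, z.1)).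
Proof.
move=> [mg [M gM]]; split; last by exists M => z [? ?]; exact: gM.
apply: (@measurable_comp _ _ _ _ _ _ (D1 `*` D2) g _ (fun z => (z.2, z.1))) => //.
- exact: measurableX.
- by move=> _ [z [? ?] <-].
- by apply: measurable_funTS; exact: measurable_fun_pair.
Qed.

End BoundedSections.

Section BoundedFubini.
Context d1 d2 (T1 : measurableType d1) (T2 : measurableType d2) (R : realType).
Variables (P1 : probability T1 R) (P2 : probability T2 R).
Variables (D1 : set T1) (D2 : set T2) (g : T1 * T2 -> R).
Hypotheses (mD1 : measurable D1) (mD2 : measurable D2).
Hypothesis bg : bmeas (D1 `*` D2) g.

(** The extension by zero turns integrals over [D1] and [D2] into integrals over the whole spaces,
    where Fubini's theorem applies. *)
Let g' := g \_ (D1 `*` D2).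

Let mD : measurable (D1 `*` D2). Proof. exact: measurableX. Qed.

Let bg' : bmeas setT g'.
Proof.
case: bg => mg [M gM]; split; first by apply/(measurable_restrictT _ mD).
exists `|M| => x _; rewrite /g' patchE; case: ifPn; last by rewrite normr0.
by rewrite inE => /gM h; rewrite (le_trans h)// ler_norm.
Qed.

Let ig' : (P1 \x P2)%E.-integrable setT (EFin \o g').
Proof.
exact: (@bmeas_integrable _ _ _ (P1 \x P2)%E).
Qed.

Let bg'x x : bmeas setT (fun y => g' (x, y)).
Proof.
case: bg' => mg' [M gM]; split; last by exists M => y _; exact: gM.
exact: measurable_fun_pair2.
Qed.

Let bg'y y : bmeas setT (fun x => g' (x, y)).
Proof.
case: bg' => mg' [M gM]; split; last by exists M => x _; exact: gM.
exact: measurable_fun_pair1.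
Qed.

Let int1E x : D1 x -> \int[P2]_(y in D2) g (x, y) = \int[P2]_y g' (x, y).
Proof.
move=> D1x; rewrite Rintegral_mkcond; apply: Rint_eq => y _.
by rewrite /g' !patchE in_setX /= (mem_set D1x).
Qed.

Let int2E y : D2 y -> \int[P1]_(x in D1) g (x, y) = \int[P1]_x g' (x, y).
Proof.
move=> D2y; rewrite Rintegral_mkcond; apply: Rint_eq => x _.
by rewrite /g' !patchE in_setX /= (mem_set D2y) andbT.
Qed.

Lemma bmeas_Rint1 : bmeas D1 (fun x => \int[P2]_(y in D2) g (x, y)).
Proof.
apply: (@bmeas_eq _ _ _ D1 (fun x => \int[P2]_y g' (x, y))).
  by move=> x /set_mem D1x; rewrite int1E.
split; first by apply: measurable_funTS; apply: measurableT_comp (measurable_fubini_F ig').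
case: bg' => mg' [M gM]; exists M => x _.
by apply: Rint_norm_le => //; [exact: probability_setT|move=> y _; exact: gM].
Qed.

Lemma bmeas_Rint2 : bmeas D2 (fun y => \int[P1]_(x in D1) g (x, y)).
Proof.
apply: (@bmeas_eq _ _ _ D2 (fun y => \int[P1]_x g' (x, y))).
  by move=> y /set_mem D2y; rewrite int2E.
split; first by apply: measurable_funTS; apply: measurableT_comp (measurable_fubini_G ig').
case: bg' => mg' [M gM]; exists M => y _.
by apply: Rint_norm_le => //; [exact: probability_setT|move=> x _; exact: gM].
Qed.

Let iter1E :
  \int[P1]_(x in D1) \int[P2]_(y in D2) g (x, y) = \int[P1]_x \int[P2]_y g' (x, y).
Proof.
rewrite Rintegral_mkcond; apply: Rint_eq => x _; rewrite patchE.
case: ifPn => [/set_mem/int1E//|/negP xD1].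
rewrite -[LHS](Rint_cst (P := P2) 0 measurableT (probability_setT _)).
apply: Rint_eq => y _; rewrite /g' patchE in_setX.
by case: (x \in D1) xD1 => //= /(_ isT).
Qed.

Lemma Rint_prod : \int[(P1 \x P2)%E]_(z in D1 `*` D2) g z =
  \int[P1]_(x in D1) \int[P2]_(y in D2) g (x, y).
Proof.
rewrite iter1E Rintegral_mkcond -/g' /Rintegral; congr fine.
rewrite -(integral12_prod_meas1 ig'); apply: eq_integral => x _.
by rewrite /fubini_F -(EFin_Rint _ measurableT (bg'x x)).
Qed.

Lemma Rint_swap :
  \int[P1]_(x in D1) \int[P2]_(y in D2) g (x, y) =
  \int[P2]_(y in D2) \int[P1]_(x in D1) g (x, y).
Proof.
rewrite iter1E.
transitivity (\int[P2]_y \int[P1]_x g' (x, y)); last first.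
  rewrite [RHS]Rintegral_mkcond; apply: Rint_eq => y _; rewrite patchE.
  case: ifPn => [/set_mem/int2E//|/negP yD2].
  rewrite -[RHS](Rint_cst (P := P1) 0 measurableT (probability_setT _)).
  apply: Rint_eq => x _; rewrite /g' patchE in_setX andbC.
  by case: (y \in D2) yD2 => //= /(_ isT).
rewrite /Rintegral; congr fine.
have := Fubini ig'; rewrite /fubini_F /fubini_G /=.
under eq_integral => x _ do rewrite -(EFin_Rint _ measurableT (bg'x x)).
under [in RHS]eq_integral => y _ do rewrite -(EFin_Rint _ measurableT (bg'y y)).
by [].
Qed.

End BoundedFubini.

Section Domains.
Context {R : realType} {n : nat}.
Local Notation E := (borel_space R n).

Lemma open_unit_ball : open (@unit_ball R n).
Proof. exact: open_eball. Qed.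

Lemma measurable_ball : measurable (unit_ball : set E).
Proof. by apply: open_measurable; exact: open_eball. Qed.

Lemma measurable_sphere : measurable (unit_sphere : set E).
Proof. by apply: closed_measurable; exact: closed_esphere. Qed.

Lemma unit_vector_normalize (x : 'rV[R]_n) : x != 0 ->
  enorm ((enorm x)^-1 *: x) = 1.
Proof.
move=> /enorm_gt0 x0.
by rewrite enormZ ger0_norm ?invr_ge0 ?ltW// mulVf// gt_eqF.
Qed.

End Domains.

Lemma measurable_mulmx {R : realType} {n : nat} (A : 'M[R]_n) :
  measurable_fun setT (fun x : borel_space R n => ((x : 'rV[R]_n) *m A : borel_space R n)).
Proof.
apply: measurable_to_borel => i; apply: continuous_measurable.
rewrite (_ : (fun _ => _) = dotp^~ (\row_j A j i)); first exact: dotp_continuousl.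
by apply/funext => x; rewrite mxE; apply: eq_bigr => j _; rewrite mxE.
Qed.

(** * Rotation invariance and the measure of spherical caps *)

Section Invariance.
Context {R : realType} {n : nat}.
Local Notation E := (borel_space R n).
Variable mu : probability E R.
Hypothesis hmu : orthogonal_invariant mu.
Variables (A : 'M[R]_n) (D : set E).
Hypotheses (hA : A *m A^T = 1%:M) (mD : measurable D).
Hypothesis DA : forall x : 'rV[R]_n, D (x *m A) <-> D x.

Let phi (x : E) : E := (x : 'rV[R]_n) *m A.

Let mphi : measurable_fun setT phi. Proof. exact: measurable_mulmx. Qed.

Lemma invariant_integral (g : E -> \bar R) :
  measurable_fun D g -> (forall x, D x -> 0 <= g x)%E ->
  (\int[mu]_(x in D) g ((x : 'rV[R]_n) *m A) = \int[mu]_(x in D) g x)%E.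
Proof.
move=> mg g0; transitivity (\int[pushforward mu phi]_(x in D) g x)%E.
  rewrite ge0_integral_pushforward//; last by move=> x /set_mem; exact: g0.
  by congr integral; apply/seteqP; split => x /DA.
by apply: eq_measure_integral => C mC _; exact: hmu.
Qed.

Lemma invariant_Rint (g : E -> R) : bmeas D g ->
  \int[mu]_(x in D) g ((x : 'rV[R]_n) *m A) = \int[mu]_(x in D) g x.
Proof.
move=> bg; have [mg [M gM]] := bg.
have bgA : bmeas D (fun x => g ((x : 'rV[R]_n) *m A)).
  split; last by exists M => x /DA; exact: gM.
  apply: (@measurable_comp _ _ _ _ _ _ D g D phi) => //; last exact: measurable_funTS.
  by move=> _ [x Dx <-]; apply/DA.
(* Adding the bound [M] to [g] makes the integrand nonnegative, which reduces the claim to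
   [invariant_integral]. *)
apply: (@addIr _ (\int[mu]_(x in D) M)).
rewrite -!RintD//; try exact: bmeas_cst.
apply: EFin_inj; rewrite !EFin_Rint//; try (apply: bmeasD => //; exact: bmeas_cst).
apply: (invariant_integral (g := fun x => (g x + M)%:E)).
  by apply/measurable_EFinP; apply: measurable_funD => //; exact: measurable_cst.
by move=> x /gM; rewrite lee_fin ler_norml => /andP[]; lra.
Qed.

End Invariance.

Section Caps.
Context {R : realType} {n : nat}.
Local Notation E := (borel_space R n).
Variable sigma : probability E R.
Hypothesis hsigma : invariant_probability_on sigma unit_sphere.

Definition cap (a : 'rV[R]_n) (t : R) : set E := [set y | enorm (a - (y : 'rV[R]_n)) < t].

Lemma open_cap a t : open (cap a t : set 'rV[R]_n).
Proof.
rewrite (_ : cap a t = (fun y => y - a) @^-1` [set z : 'rV[R]_n | enorm z < t]).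
  apply: open_comp => [x _|]; last exact: open_eball.
  by apply: (@cvgB _ _ _ (nbhs x)); [exact: cvg_id|exact: cvg_cst].
by apply/seteqP; split => x; rewrite /cap/= enormB.
Qed.

Lemma measurable_cap a t : measurable (cap a t).
Proof. by apply: open_measurable; exact: open_cap. Qed.

Lemma sphere_cap_eq a b t : enorm a = enorm b -> sigma (cap a t) = sigma (cap b t).
Proof.
move=> ab; have [A hA aAb] := orthogonal_transitive ab.
have [_ _ hi] := hsigma.
rewrite -(hi A hA _ (measurable_cap b t)); congr (sigma _).
by apply/seteqP; split => x; rewrite /cap/= -aAb -mulmxBl enorm_orth.
Qed.

(** Finitely many caps of radius [t] cover the compact sphere, and by invariance they all have the
    same measure; if one were null, the sphere would be null. *)
Lemma cap_gt0 (a : 'rV[R]_n) (t : R) : unit_sphere a -> 0 < t -> (0 < sigma (cap a t))%E.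
Proof.
move=> Sa t0; rewrite lt0e measure_ge0 andbT; apply/negP => /eqP s0.
have [s1 _ _] := hsigma.
have := @compact_esphere R n 1; rewrite compact_cover => /(_ _ unit_sphere (cap^~ t)).
have h1 (b : 'rV[R]_n) : unit_sphere b -> open (cap b t : set 'rV[R]_n).
  by move=> _; exact: open_cap.
have h2 : [set x : 'rV[R]_n | enorm x = 1] `<=` cover unit_sphere (cap^~ t).
  by move=> x xS; exists x => //; rewrite /cap/= subrr enorm0.
move=> /(_ h1 h2)[D' sD' hD'].
pose C : set E := \big[setU/set0]_(b <- finmap.enum_fset D') cap b t.
have SC : (unit_sphere : set E) `<=` C by move=> x /hD'; rewrite coverE bigcup_fset.
have hC : sigma.-negligible C.
  rewrite /C big_seq; apply: (big_ind (fun C : set E => sigma.-negligible C)) => [|C1 C2|b bD'].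
  - exact: negligible_set0.
  - exact: negligibleU.
  - apply/(negligibleP _ (measurable_cap _ _)).
    rewrite -s0; apply: sphere_cap_eq; have := sD' _ bD'; rewrite inE => ->.
    by rewrite Sa.
have : sigma.-negligible (unit_sphere : set E).
  by apply: negligibleS hC; exact: SC.
move=> /(negligibleP _ measurable_sphere) h0.
by have := oner_neq0 R; rewrite -eqe -s1 h0 eqxx.
Qed.

End Caps.

(** * Polar decomposition of an invariant measure *)

Section Polar.
Context {R : realType} {n : nat}.
Local Notation E := (borel_space R n).
Variables sigma nu : probability E R.
Hypothesis hsigma : invariant_probability_on sigma unit_sphere.
Hypothesis hnu : invariant_probability_on nu unit_ball.
Local Notation S := (unit_sphere : set E).
Local Notation B := (unit_ball : set E).

Lemma measureI_full d (T : measurableType d) (P : probability T R) (D A : set T) :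
  measurable D -> measurable A -> P D = 1%E -> P (A `&` D) = P A.
Proof.
move=> mD mA PD; rewrite [RHS](measureDI P mA mD).
rewrite [X in (X + _)%E](_ : _ = 0%E) ?add0e//.
apply: (@subset_measure0 _ _ _ P _ (~` D)); [exact: measurableD|exact: measurableC|by move=> x []|].
have PC : P (~` D) = 0%E by rewrite probability_setC// PD subee.
exact: PC.
Qed.

Lemma Rint_indic d (T : measurableType d) (P : probability T R) (D A : set T) :
  measurable D -> measurable A -> \int[P]_(x in D) \1_A x = fine (P (A `&` D)).
Proof. by move=> mD mA; rewrite /Rintegral integral_indic. Qed.

Lemma sphere_neq0 : exists e : 'rV[R]_n, unit_sphere e.
Proof.
have [s1 _ _] := hsigma; apply: contrapT => h.
have S0 : unit_sphere = set0 :> set 'rV[R]_n.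
  by apply/seteqP; split => // x Sx; apply: h; exists x.
by have := oner_neq0 R; rewrite -eqe -s1 S0 measure0 eqxx.
Qed.

(** Only the norm of the first point is used. Taking it from a [nu]-random point carries the radial
    distribution of [nu] without a separate measure on the interval of radii. *)
Definition polar (z : E * E) : E := enorm (z.1 : 'rV[R]_n) *: (z.2 : 'rV[R]_n).

Lemma measurable_polar : measurable_fun setT polar.
Proof.
apply: measurable_to_borel => i.
rewrite (_ : (fun _ => _) = fun z : E * E =>
    enorm (z.1 : 'rV[R]_n) * (z.2 : 'rV[R]_n) 0 i); last first.
  by apply/funext => z; rewrite mxE.
apply: measurable_funM.
  by apply: (@measurableT_comp _ _ _ _ _ _ (@enorm R n : E -> R)) => //; exact: enorm_measurable.
by apply: (@measurableT_comp _ _ _ _ _ _ (fun y : E => (y : 'rV[R]_n) 0 i)) => //; exact: coord_measurable.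
Qed.

Lemma enorm_polar x y : S y -> enorm (polar (x, y) : 'rV[R]_n) = enorm (x : 'rV[R]_n).
Proof.
by move=> Sy; rewrite /polar enormZ/= Sy mulr1 ger0_norm// enorm_ge0.
Qed.

Lemma polar_ball x y : B x -> S y -> B (polar (x, y)).
Proof. by move=> Bx Sy; rewrite /unit_ball /= enorm_polar. Qed.

(** Divided by [K t], the measure of its section in [y], the indicator of this set becomes the
    kernel [closeK t], which has mass one in [y] and only charges pairs for which [polar] moves the
    first point by less than [t]. *)
Let close (t : R) : set (E * E) := [set z | enorm ((z.1 : 'rV[R]_n) - polar z) < t].

Let measurable_close t : measurable (close t).
Proof.
have mg : measurable_fun setT (fun z : E * E => (z.1 : 'rV[R]_n) - polar z : E).
  apply: measurable_to_borel => i.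
  rewrite (_ : (fun _ => _) = fun z : E * E =>
      (z.1 : 'rV[R]_n) 0 i - (polar z : 'rV[R]_n) 0 i); last first.
    by apply/funext => z; rewrite !mxE.
  apply: measurable_funB.
    by apply: (@measurableT_comp _ _ _ _ _ _ (fun y : E => (y : 'rV[R]_n) 0 i)) => //; exact: coord_measurable.
  apply: (@measurableT_comp _ _ _ _ _ _ (fun y : E => (y : 'rV[R]_n) 0 i)); first exact: coord_measurable.
  exact: measurable_polar.
have : measurable_fun setT (fun z : E * E => enorm ((z.1 : 'rV[R]_n) - polar z)).
  by apply: (@measurableT_comp _ _ _ _ _ _ (@enorm R n : E -> R)) => //; exact: enorm_measurable.
move=> /(_ measurableT).
move=> /(_ _ (measurable_itv `]-oo, t[)); rewrite setTI.
by congr measurable; apply/seteqP; split => z; rewrite /close/= in_itv.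
Qed.

Let K t (x : E) : R := \int[sigma]_(y in S) \1_(close t) (x, y).

Let bmeas_close t (D : set (E * E)) : bmeas D (\1_(close t) : E * E -> R).
Proof. exact: bmeas_indic. Qed.

Let bmeas_K t : bmeas B (K t).
Proof.
exact: (bmeas_Rint1 nu sigma measurable_ball measurable_sphere (bmeas_close t _)).
Qed.

Let K_orth t (A : 'M[R]_n) x : A *m A^T = 1%:M -> K t ((x : 'rV[R]_n) *m A) = K t x.
Proof.
move=> hA; rewrite /K; have [_ _ hs] := hsigma.
have bx : bmeas S (fun y : E => \1_(close t) (((x : 'rV[R]_n) *m A : E), y) : R).
  have [m [M hM]] := bmeas_close t setT; split; last by exists M => y _; exact: hM.
  by apply: measurable_funTS; exact: measurable_fun_pair2.
rewrite -(invariant_Rint hs hA measurable_sphere _ bx); last first.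
  by move=> y; rewrite /unit_sphere/= enorm_orth.
apply: Rint_eq => y _; rewrite !indicE; congr (_%:R); congr nat_of_bool.
apply/idP/idP; rewrite !inE /close /polar/= enorm_orth// scalemxAl -mulmxBl.
  by rewrite enorm_orth.
by rewrite enorm_orth.
Qed.

(** If [x = |x| a] with [a] a unit vector, then [|x - |x| y| = |x| |a - y| <= |a - y|], so the
    section contains the cap of radius [t] around [a]. All caps of radius [t] have the same positive
    measure; for [x = 0] the section is the whole sphere. *)
Let K_ge t : 0 < t -> exists2 c : R, 0 < c & forall x, B x -> c <= K t x.
Proof.
move=> t0; have [e Se] := sphere_neq0.
have mS := @measurable_sphere R n.
have mC := @measurable_cap R n.
have [s1 _ _] := hsigma.
have capS a : sigma (cap a t `&` S) = sigma (cap a t) by exact: measureI_full.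
exists (fine (sigma (cap e t))).
  by rewrite fine_gt0// (cap_gt0 hsigma Se t0)/= ltey_eq fin_num_measure.
move=> x Bx; rewrite /K.
have [->|x0] := eqVneq (x : 'rV[R]_n) 0.
  rewrite (_ : Rintegral _ _ _ = \int[sigma]_(y in S) 1).
    rewrite Rint_cst// -[leRHS]/(fine 1%E) fine_le ?fin_num_measure//.
    exact: probability_le1.
  apply: Rint_eq => y _; rewrite indicE mem_set//.
  by rewrite /close /polar/= enorm0 scale0r subrr enorm0.
pose a : 'rV[R]_n := (enorm (x : 'rV[R]_n))^-1 *: (x : 'rV[R]_n).
have Sa : enorm a = 1 by exact: unit_vector_normalize.
have xa : (x : 'rV[R]_n) = enorm (x : 'rV[R]_n) *: a.
  by rewrite /a scalerA divff ?scale1r// gt_eqF// enorm_gt0.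
have -> : sigma (cap e t) = sigma (cap a t) by apply: sphere_cap_eq => //; rewrite Sa Se.
rewrite -capS -(Rint_indic sigma mS (mC _ _)); apply: Rint_le => //.
- exact: bmeas_indic.
- have [m [M hM]] := bmeas_close t setT; split; last by exists M => y _; exact: hM.
  by apply: measurable_funTS; exact: measurable_fun_pair2.
move=> y Sy; rewrite !indicE ler_nat.
case: (boolP (y \in cap a t)) => // /set_mem ay; rewrite mem_set//.
rewrite /close /polar/= {1}xa -scalerBr enormZ ger0_norm ?enorm_ge0//.
rewrite (le_lt_trans _ ay)// ler_piMl ?enorm_ge0//; exact: ltW.
Qed.

Let invK t : 0 < t -> bmeas B (fun x => (K t x)^-1).
Proof.
move=> /K_ge[c c0 cK]; have [mK _] := bmeas_K t; split.
  apply: (@eq_measurable_fun _ _ _ _ _ (fun x => K t x `^ (-1))).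
    by move=> x /set_mem /cK h; rewrite powR_inv1// (le_trans _ h)// ltW.
  have := measurableT_comp (measurable_powR (-1)) mK.
  exact.
exists c^-1 => x /cK cx; have Kp := lt_le_trans c0 cx.
by have K0 := ltW Kp; rewrite ger0_norm ?invr_ge0// lef_pV2// posrE.
Qed.

Lemma bmeas_polar (g : E -> R) : bmeas B g -> bmeas (B `*` S) (g \o polar).
Proof.
move=> [mg [M gM]]; split; last first.
  by exists M => -[x y] [/= Bx Sy]; apply: gM; exact: polar_ball.
apply: (@measurable_comp _ _ _ _ _ _ B g _ polar) => //.
- exact: measurable_ball.
- by move=> _ [[x y] [/= Bx Sy] <-]; exact: polar_ball.
- by apply: measurable_funTS; exact: measurable_polar.
Qed.

Let closeK t : E * E -> R := fun z => \1_(close t) z * (K t z.1)^-1.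

Let bmeas_closeK t : 0 < t -> bmeas (B `*` S) (closeK t).
Proof.
move=> t0; have h := bmeas_fst S measurable_ball (invK t0).
exact: (bmeasM (bmeas_close t _) h).
Qed.

Let int_closeK t x : 0 < t -> B x -> \int[sigma]_(y in S) closeK t (x, y) = 1.
Proof.
move=> t0 Bx; have [c c0 /(_ x Bx) cK] := K_ge t0.
have Kp := lt_le_trans c0 cK.
transitivity ((K t x)^-1 * K t x); last by rewrite mulVf// gt_eqF.
rewrite -RintZ//; first by apply: Rint_eq => y _; rewrite mulrC.
  exact: measurable_sphere.
have [m [M hM]] := bmeas_close t setT; split; last by exists M => y _; exact: hM.
by apply: measurable_funTS; exact: measurable_fun_pair2.
Qed.

(* Averaging over the kernel [close t] does not change the spherical mean:
   rotating the outer variable moves the centre of the kernel freely. *)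
Let mean_close t (g : E -> R) : 0 < t -> bmeas B g ->
  \int[nu]_(x in B) \int[sigma]_(y in S) (g (polar (x, y)) * closeK t (x, y)) =
  \int[nu]_(x in B) \int[sigma]_(y in S) g (polar (x, y)).
Proof.
move=> t0 bg.
have mS := @measurable_sphere R n; have mB := @measurable_ball R n.
have [s1 _ hs] := hsigma; have [_ _ hn] := hnu.
have bG : bmeas (B `*` S) (fun z => g (polar z)) by exact: bmeas_polar.
have bC := bmeas_closeK t0.
rewrite (Rint_swap nu sigma mB mS (bmeasM bG bC)) (Rint_swap nu sigma mB mS bG).
apply: Rint_eq => y Sy.
pose H w := \int[nu]_(x in B) (g (polar (x, y)) * closeK t (x, w)).
have bg1 : bmeas B (fun x => g (polar (x, y))) by exact: (bmeas_section2 mB mS Sy bG).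
have bC1 w : S w -> bmeas B (fun x => closeK t (x, w)).
  by move=> Sw; exact: (bmeas_section2 mB mS Sw bC).
have HA w : S w -> H w = H y.
  move=> Sw; have [A hA yw] : exists2 A : 'M[R]_n, A *m A^T = 1%:M & (y : 'rV[R]_n) *m A = w.
    by apply: orthogonal_transitive; rewrite Sy Sw.
  rewrite /H -(invariant_Rint hn hA mB).
  - apply: Rint_eq => x _; rewrite -yw /closeK /= K_orth//.
    have -> : polar ((x : 'rV[R]_n) *m A : E, y) = polar (x, y).
      by rewrite /polar/= enorm_orth.
    congr (_ * (_ * _)); rewrite !indicE; congr (_%:R); congr nat_of_bool.
    apply/idP/idP; rewrite !inE /close /polar/= enorm_orth// scalemxAl -mulmxBl.
      by rewrite enorm_orth.
    by rewrite enorm_orth.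
  - by move=> x; rewrite /unit_ball/= enorm_orth.
  - exact: (bmeasM bg1 (bC1 _ Sw)).
transitivity (H y); first by [].
(* [H] is constant on the sphere, so [H y] equals the mean of [H]. After the integrals are
   exchanged, the variable [w] occurs only in [closeK], whose mass is one. *)
rewrite -[LHS](Rint_cst (P := sigma) _ mS s1) -(Rint_eq sigma HA).
have bgC : bmeas (S `*` B) (fun z => g (polar (z.2, y)) * closeK t (z.2, z.1)).
  apply: bmeasM; first exact: (bmeas_snd S mB bg1).
  exact: (bmeas_swap mB mS bC).
rewrite (Rint_swap sigma nu mS mB bgC).
apply: Rint_eq => x Bx /=.
by rewrite (RintZ _ _ mS (bmeas_section1 mB mS Bx bC)) (int_closeK t0 Bx) mulr1.
Qed.

Definition close_set (C : set E) t : set E := \bigcup_(c in C) cap c t.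

Lemma open_close_set C t : open (close_set C t : set 'rV[R]_n).
Proof. by apply: bigcup_open => c _; exact: open_cap. Qed.

Let mean (U : set E) := \int[nu]_(x in B) \int[sigma]_(y in S) \1_U (polar (x, y)).

Let bmeas_1 (U : set E) : measurable U -> bmeas B (\1_U : E -> R).
Proof. exact: bmeas_indic. Qed.

Let int_indic_closeK t (U : set E) : 0 < t -> measurable U ->
  \int[nu]_(x in B) \int[sigma]_(y in S) (\1_U x * closeK t (x, y)) = fine (nu U).
Proof.
move=> t0 mU; have [n1 _ _] := hnu.
rewrite -(measureI_full measurable_ball mU n1) -(Rint_indic _ measurable_ball)//.
apply: Rint_eq => x Bx.
rewrite (RintZ _ _ measurable_sphere
  (bmeas_section1 measurable_ball measurable_sphere Bx (bmeas_closeK t0))).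
by rewrite (int_closeK t0 Bx) mulr1.
Qed.

Let le_double_int (g h : E * E -> R) :
  bmeas (B `*` S) g -> bmeas (B `*` S) h ->
  (forall x y, B x -> S y -> g (x, y) <= h (x, y)) ->
  \int[nu]_(x in B) \int[sigma]_(y in S) g (x, y) <=
  \int[nu]_(x in B) \int[sigma]_(y in S) h (x, y).
Proof.
have mS := @measurable_sphere R n; have mB := @measurable_ball R n.
move=> bg bh gh.
apply: (Rint_le nu mB (bmeas_Rint1 nu sigma mB mS bg) (bmeas_Rint1 nu sigma mB mS bh)) => x Bx.
apply: (Rint_le sigma mS (bmeas_section1 mB mS Bx bg) (bmeas_section1 mB mS Bx bh)) => y.
exact: gh.
Qed.

Let indic_le (P Q : bool) : (P -> Q) -> P%:R <= Q%:R :> R.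
Proof. by case: P; case: Q => // /(_ isT). Qed.

(** Where the kernel charges [(x, y)], the point [polar (x, y)] is within [t] of [x], so [x] in [C]
    forces it into the thickened set. The kernel averages of the two indicators are [nu C] and the
    spherical mean. [mean_le_measure] exchanges the roles of the two points. *)
Lemma measure_le_mean t (C : set E) : 0 < t -> measurable C ->
  fine (nu C) <= mean (close_set C t).
Proof.
move=> t0 mC.
have mU : measurable (close_set C t) by apply: open_measurable; exact: open_close_set.
rewrite -(int_indic_closeK t0 mC) /mean -(mean_close t0 (bmeas_1 mU)).
have bg := (bmeasM (bmeas_fst S measurable_ball (bmeas_1 mC)) (bmeas_closeK t0)).
have bh := (bmeasM (bmeas_polar (bmeas_1 mU)) (bmeas_closeK t0)).
apply: (le_double_int bg bh) => x y Bx Sy /=; rewrite /closeK !mulrA ler_wpM2r//.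
  by have [c c0 /(_ _ Bx) cK] := K_ge t0; rewrite invr_ge0 (le_trans _ cK)// ltW.
rewrite !indicE -!natrM !mulnb; apply: indic_le => /andP[/set_mem Cx /set_mem xy].
by apply/andP; split; apply/mem_set => //; exists x.
Qed.

Lemma mean_le_measure t (C : set E) : 0 < t -> measurable C ->
  mean C <= fine (nu (close_set C t)).
Proof.
move=> t0 mC.
have mU : measurable (close_set C t) by apply: open_measurable; exact: open_close_set.
rewrite -(int_indic_closeK t0 mU) /mean -(mean_close t0 (bmeas_1 mC)).
have bg := (bmeasM (bmeas_polar (bmeas_1 mC)) (bmeas_closeK t0)).
have bh := (bmeasM (bmeas_fst S measurable_ball (bmeas_1 mU)) (bmeas_closeK t0)).
apply: (le_double_int bg bh) => x y Bx Sy /=; rewrite /closeK !mulrA ler_wpM2r//.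
  by have [c c0 /(_ _ Bx) cK] := K_ge t0; rewrite invr_ge0 (le_trans _ cK)// ltW.
rewrite !indicE -!natrM !mulnb; apply: indic_le => /andP[/set_mem Cx /set_mem xy].
apply/andP; split; apply/mem_set => //; exists (polar (x, y)) => //.
by rewrite /cap/= enormB.
Qed.

End Polar.

Section PolarDecomposition.
Context {R : realType} {n : nat}.
Local Notation E := (borel_space R n).
Variables sigma nu : probability E R.
Hypothesis hsigma : invariant_probability_on sigma unit_sphere.
Hypothesis hnu : invariant_probability_on nu unit_ball.
Local Notation S := (unit_sphere : set E).
Local Notation B := (unit_ball : set E).

Lemma integral_full d (T : measurableType d) (P : probability T R) (D : set T)
    (g : T -> \bar R) : measurable D -> P D = 1%E ->
  measurable_fun setT g -> (forall x, 0 <= g x)%E ->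
  (\int[P]_x g x = \int[P]_(x in D) g x)%E.
Proof.
move=> mD PD mg g0; have PC : P (~` D) = 0%E by rewrite probability_setC// PD subee.
rewrite (@ge0_negligible_integral _ _ _ P setT (~` D))//; last exact: measurableC.
by rewrite setDE setCK setTI.
Qed.

(** The law of [polar] under the product of [nu] and [sigma]; the decomposition amounts to
    [nu = m2]. *)
Let m2 : {measure set E -> \bar R} :=
  measure_function_pushforward__canonical__measure_function_Measure
    (nu \x sigma)%E (@measurable_polar R n).

Let int_m2 (g : E -> \bar R) : measurable_fun setT g -> (forall x, 0 <= g x)%E ->
  (\int[m2]_x g x =
   \int[nu]_(x in B) \int[sigma]_(y in S) g (polar (x, y)))%E.
Proof.
move=> mg g0; have [s1 _ _] := hsigma; have [n1 _ _] := hnu.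
have mgp : measurable_fun setT (g \o @polar R n).
  by apply: measurableT_comp => //; exact: measurable_polar.
have h0 z : (0 <= (g \o @polar R n) z)%E by exact: g0.
have mF : measurable_fun setT (fun x => \int[sigma]_y g (polar (x, y)))%E.
  exact: (measurable_fun_fubini_tonelli_F (m2 := sigma) _ mgp h0).
transitivity (\int[(nu \x sigma)%E]_z (g \o @polar R n) z)%E.
  exact: (ge0_integral_pushforward (@measurable_polar R n) _ measurableT mg (fun y _ => g0 y)).
rewrite (fubini_tonelli1 _ mgp h0).
rewrite -[LHS]/(\int[nu]_x (\int[sigma]_y g (polar (x, y))))%E.
rewrite (integral_full (@measurable_ball R n) n1 mF); last first.
  by move=> x; apply: integral_ge0 => y _; exact: g0.
apply: eq_integral => x _; apply: (integral_full (@measurable_sphere R n) s1) => //.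
exact: measurable_fun_pair2 mgp.
Qed.

Let spherical_mean (C : set E) :=
  \int[nu]_(x in B) \int[sigma]_(y in S) \1_C (polar (x, y)).

Let m2E (C : set E) : measurable C -> m2 C = (spherical_mean C)%:E.
Proof.
move=> mC; have mS := @measurable_sphere R n; have mB := @measurable_ball R n.
have bC : bmeas (B `*` S) (\1_C \o @polar R n : E * E -> R).
  by apply: bmeas_polar; exact: bmeas_indic.
transitivity (\int[m2]_x (\1_C x)%:E)%E; first by rewrite integral_indic// setIT.
rewrite int_m2; last 2 first.
- by apply/measurable_EFinP; exact: measurable_indic.
- by move=> x; rewrite lee_fin indicE.
rewrite EFin_Rint//; last exact: (bmeas_Rint1 nu sigma mB mS bC).
apply: eq_integral => x /set_mem Bx; rewrite EFin_Rint//.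
exact: (bmeas_section1 mB mS Bx bC).
Qed.

Let m2T : m2 setT = 1%E.
Proof.
have [s1 _ _] := hsigma; have [n1 _ _] := hnu.
rewrite m2E// /spherical_mean -[RHS]/((1:R)%:E); congr EFin.
rewrite -[RHS](Rint_cst (P := nu) _ (@measurable_ball R n) n1); apply: Rint_eq => x Bx.
rewrite -[RHS](Rint_cst (P := sigma) _ (@measurable_sphere R n) s1).
by apply: Rint_eq => y _; rewrite indicT.
Qed.

Let thick (C : set E) (k : nat) : set E := close_set C k.+1%:R^-1.

Let thick_noninc C : nonincreasing_seq (thick C).
Proof.
move=> i j ij; apply/subsetPset => x [c Cc cx]; exists c => //.
by rewrite /cap/= (lt_le_trans cx)// lef_pV2 ?posrE// ler_nat.
Qed.

Let bigcap_thick (C : set E) : closed (C : set 'rV[R]_n) -> \bigcap_k thick C k = C.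
Proof.
move=> cC; apply/seteqP; split => x /=; last first.
  by move=> Cx k _; exists x => //; rewrite /cap/= subrr enorm0.
move=> h; apply: cC => U /nbhs_ballP[e /= e0 eU].
have [k _ /(_ _ (leqnn k)) ke] := near_infty_natSinv_lt (PosNum e0).
have [c Cc cx] := h k Logic.I; exists c; split => //; apply: eU.
rewrite -ball_normE /ball_/= (le_lt_trans (norm_le_enorm _))// (lt_trans _ ke)//.
by rewrite enormB.
Qed.

Let measure_thick (mu : {measure set E -> \bar R}) (C : set E) : mu setT = 1%E ->
  closed (C : set 'rV[R]_n) -> mu (thick C k) @[k --> \oo] --> mu C.
Proof.
move=> mu1 cC; rewrite -{2}(bigcap_thick cC).
have mthick k : measurable (thick C k) by apply: open_measurable; exact: open_close_set.
apply: nonincreasing_cvg_mu => //.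
- by apply: (@le_lt_trans _ _ 1%E); rewrite ?ltry// -mu1 le_measure ?inE.
- by rewrite bigcap_thick//; exact: closed_measurable.
Qed.

(** The thickenings of a closed set decrease to the set, so the two comparisons with thickened sets
    become the two inequalities in the limit. *)
Let polar_closed (C : set E) : closed (C : set 'rV[R]_n) -> nu C = m2 C.
Proof.
move=> cC; have mC : measurable C by exact: closed_measurable.
have mthick k : measurable (thick C k) by apply: open_measurable; exact: open_close_set.
have fn (A : set E) : measurable A -> nu A = (fine (nu A))%:E.
  by move=> mA; rewrite fineK// fin_num_measure.
have k0 (k : nat) : 0 < k.+1%:R^-1 :> R by [].
apply/eqP; rewrite eq_le; apply/andP; split.
- apply: (cvge_to_ge (measure_thick m2T cC)); near=> k.
  have := measure_le_mean hsigma hnu (k0 k) mC; rewrite -lee_fin => h.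
  rewrite m2E//; apply: le_trans h.
  by rewrite le_eqVlt; apply/orP; left; apply/eqP; exact: fn.
- apply: (cvge_to_ge (measure_thick (probability_setT nu) cC)); near=> k.
  have := mean_le_measure hsigma hnu (k0 k) mC; rewrite -lee_fin => h.
  rewrite m2E//; apply: (le_trans h).
  by rewrite le_eqVlt; apply/orP; left; apply/eqP/esym/fn; exact: mthick.
Unshelve. all: end_near. Qed.

Let measure_compl (mu : {measure set E -> \bar R}) (U : set E) :
  mu setT = 1%E -> measurable U -> mu U = (1 - mu (~` U))%E.
Proof.
move=> mu1 mU; have mUC := measurableC mU.
have fin : (mu [set: E] < +oo)%E by rewrite mu1 ltry.
have := measureD measurableT mUC fin.
rewrite setTI setTD setCK => h.
by transitivity (mu setT - mu (~` U))%E; [exact: h|rewrite mu1].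
Qed.

(** Open sets generate the Borel sets and are stable under intersection; on them the two measures
    agree by passing to closed complements. *)
Let polar_measure (C : set E) : measurable C -> nu C = m2 C.
Proof.
apply: (measure_unique (@open 'rV[R]_n : set (set E)) (fun=> setT)) => //.
- exact: openI.
- by move=> _; exact: openT.
- by rewrite bigcup_const.
- move=> U oU; have mU : measurable U by exact: open_measurable.
  rewrite (measure_compl (probability_setT nu) mU) (measure_compl m2T mU).
  by congr (1 - _)%E; exact: polar_closed (open_closedC oU).
- move=> k; apply: (@le_lt_trans _ _ 1%E); last by rewrite ltry.
  by rewrite le_eqVlt; apply/orP; left; apply/eqP; exact: (probability_setT nu).
Qed.

Lemma polar_integral (g : E -> \bar R) : measurable_fun B g ->
  (forall x, B x -> 0 <= g x)%E ->
  (\int[nu]_(x in B) g x =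
   \int[nu]_(x in B) \int[sigma]_(y in S) g (polar (x, y)))%E.
Proof.
move=> mg g0; have mB := @measurable_ball R n.
rewrite integral_mkcond.
rewrite (_ : (\int[nu]_x (g \_ B) x = \int[m2]_x (g \_ B) x)%E); last first.
  by apply: eq_measure_integral => A mA _; exact: polar_measure.
rewrite int_m2; last 2 first.
- exact/(measurable_restrictT _ mB).
- by move=> x; rewrite patchE; case: ifPn => // /set_mem; exact: g0.
apply: eq_integral => x /set_mem Bx; apply: eq_integral => y /set_mem Sy.
by rewrite patchE mem_set//; exact: polar_ball.
Qed.

Lemma polar_measurable (g : E -> \bar R) : measurable_fun B g ->
  (forall x, B x -> 0 <= g x)%E ->
  measurable_fun B (fun x => \int[sigma]_(y in S) g (polar (x, y)))%E.
Proof.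
move=> mg g0; have mB := @measurable_ball R n; have mS := @measurable_sphere R n.
have [s1 _ _] := hsigma.
have mgB : measurable_fun setT (g \_ B) by exact/(measurable_restrictT _ mB).
have mgp : measurable_fun setT ((g \_ B) \o @polar R n).
  by apply: measurableT_comp => //; exact: measurable_polar.
have g1 x : (0 <= (g \_ B) x)%E by rewrite patchE; case: ifPn => // /set_mem; exact: g0.
apply: (@eq_measurable_fun _ _ _ _ B (fun x => \int[sigma]_y (g \_ B) (polar (x, y)))%E).
  move=> x /set_mem Bx; rewrite (integral_full mS s1) //.
    apply: eq_integral => y /set_mem Sy.
    by rewrite patchE mem_set//; exact: polar_ball.
  exact: measurable_fun_pair2 mgp.
apply: measurable_funTS.
exact: (measurable_fun_fubini_tonelli_F (m2 := sigma) _ mgp (fun z => g1 _)).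
Qed.

Lemma polar_Rint (g : E -> R) : bmeas B g ->
  \int[nu]_(x in B) g x =
  \int[nu]_(x in B) \int[sigma]_(y in S) g (polar (x, y)).
Proof.
move=> bg; have mS := @measurable_sphere R n; have mB := @measurable_ball R n.
have [s1 _ _] := hsigma; have [n1 _ _] := hnu.
have [mg [M gM]] := bg.
have bgM : bmeas B (fun x => g x + M) by apply: bmeasD => //; exact: bmeas_cst.
have bpg := bmeas_polar bg; have bpgM := bmeas_polar bgM.
(* As before, adding the bound [M] leads to a nonnegative integrand. *)
apply: (@addIr _ M); apply: EFin_inj.
transitivity (\int[nu]_(x in B) (g x + M)%:E)%E.
  rewrite -EFin_Rint// RintD//; last exact: bmeas_cst.
  by rewrite (Rint_cst (P := nu) M mB n1).
rewrite polar_integral; last 2 first.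
- by apply/measurable_EFinP; case: bgM.
- by move=> x /gM; rewrite lee_fin ler_norml => /andP[]; lra.
rewrite -[X in _ = (_ + X)%:E](Rint_cst (P := nu) M mB n1).
rewrite -RintD//; last 2 first.
- exact: (bmeas_Rint1 nu sigma mB mS bpg).
- exact: bmeas_cst.
rewrite EFin_Rint//; last first.
  apply: bmeasD; last exact: bmeas_cst.
  exact: (bmeas_Rint1 nu sigma mB mS bpg).
apply: eq_integral => x /set_mem Bx.
have b1 := bmeas_section1 mB mS Bx bpg.
rewrite -[X in _ = (_ + X)%:E](Rint_cst (P := sigma) M mS s1).
rewrite -RintD//; last exact: bmeas_cst.
by rewrite EFin_Rint//; apply: bmeasD => //; exact: bmeas_cst.
Qed.

End PolarDecomposition.

(** * Harmonic functions *)

Section DirectionalDerivatives.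
Context {R : realType} {V : normedModType R}.

Lemma is_derive_line (u : V -> R) (x v : V) (t d : R) :
  is_derive (t *: v + x) v u d <-> is_derive t (1:R) (fun s : R => u (s *: v + x)) d.
Proof.
have e : (fun h : R => h^-1 *: (u (h *: v + (t *: v + x)) - u (t *: v + x))) =
    (fun h : R => h^-1 *: (u ((h *: 1 + t) *: v + x) - u (t *: v + x))).
  by apply/funext => h; rewrite scalerDl [_ *: 1]mulr1 addrA.
split => -[h1 h2]; split.
- by rewrite /derivable /= -e.
- by rewrite -h2 /derive /= -e.
- by rewrite /derivable /= e.
- by rewrite -h2 /derive /= e.
Qed.

Lemma is_derive_line0 (u : V -> R) (x v : V) (d : R) :
  is_derive x v u d <-> is_derive (0:R) (1:R) (fun s : R => u (s *: v + x)) d.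
Proof. by have := is_derive_line u x v 0 d; rewrite scale0r add0r. Qed.

Lemma is_derive_comp1 (g : R -> R) (u : V -> R) (x v : V) (d e : R) :
  is_derive x v u d -> is_derive (u x) (1:R) g e -> is_derive x v (g \o u) (e * d).
Proof.
move=> /is_derive_line0 hu hg; apply/is_derive_line0.
have hg' : is_derive (u (0 *: v + x)) (1:R) g e by rewrite scale0r add0r.
exact: (is_derive1_comp (f := g) (g := fun s => u (s *: v + x)) (x := 0)).
Qed.

Lemma is_derive_add (f g : V -> R) (x v : V) (a b : R) :
  is_derive x v f a -> is_derive x v g b -> is_derive x v (fun y => f y + g y) (a + b).
Proof. by move=> hf hg; have := is_deriveD hf hg. Qed.

Lemma is_derive_mul (f g : V -> R) (x v : V) (a b : R) :
  is_derive x v f a -> is_derive x v g b ->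
  is_derive x v (fun y => f y * g y) (f x * b + g x * a).
Proof. by move=> hf hg; have := is_deriveM hf hg. Qed.

Lemma is_derive_scale (f : V -> R) (x v : V) (c a : R) :
  is_derive x v f a -> is_derive x v (fun y => c * f y) (c * a).
Proof. by move=> hf; have := is_deriveZ c hf. Qed.

Lemma is_derive_const (x v : V) (c : R) : is_derive x v (fun=> c) 0.
Proof. exact: is_derive_cst. Qed.

Lemma near_eq_continuous (T : topologicalType) (a b : T -> R) (x : T) :
  (\forall y \near x, a y = b y) -> {for x, continuous a} -> {for x, continuous b}.
Proof.
move=> nab ca; rewrite /prop_for /continuous_at -(nbhs_singleton nab).
by apply: cvg_trans ca; apply: (@near_eq_cvg _ _ (nbhs x)).
Qed.

End DirectionalDerivatives.

(** * The second derivative at a maximum, harmonicity, and the maximum principle *)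

Section SecondDerivativeTest.
Context {R : realType}.

(** At the maximum [g1] vanishes. If [L] were positive, [g1] would be positive just to the right of
    0, and the mean value theorem would give [g t > g 0] there. *)
Lemma second_derivative_le0 (g g1 : R -> R) (e L : R) : 0 < e ->
  (forall t, `|t| < e -> is_derive t (1:R) g (g1 t)) -> is_derive (0:R) (1:R) g1 L ->
  (forall t, `|t| < e -> g t <= g 0) -> L <= 0.
Proof.
move=> e0 dg dg1 gmax; rewrite leNgt; apply/negP => L0.
have itvE t : t \in `]-e, e[ -> `|t| < e.
  by rewrite in_itv/= ltr_norml.
have g10 : g1 0 = 0.
  have [_ <-] := dg 0 ltac:(by rewrite normr0).
  have := @derive1_at_max _ g (-e) e 0 _ _ _ _.
  case=> //; first by lra.
  - by move=> t /itvE /dg[].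
  - by rewrite in_itv/= oppr_lt0 e0.
  - by move=> t /itvE; exact: gmax.
have [h1 h2] := dg1.
have : (h^-1 *: (g1 (h *: 1 + 0) - g1 0)) @[h --> 0^'] --> L.
  by rewrite -h2; exact: h1.
move=> /(cvgr_gt _) /(_ _ L0) hpos.
have [d /= d0 hd] := (nbhs_ballP _ _).1 hpos.
pose t := Num.min (d / 2) (e / 2).
have t0 : 0 < t by rewrite lt_min; apply/andP; split; rewrite divr_gt0.
have te : t < e by rewrite gt_min; apply/orP; right; lra.
have td : t < d by rewrite gt_min; apply/orP; left; lra.
have [s] : exists2 s, s \in `]0, t[ & g t - g 0 = g1 s * (t - 0).
  apply: (MVT t0).
    move=> s; rewrite in_itv/= => /andP[s0 st]; apply: dg.
    by rewrite gtr0_norm// (lt_trans st).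
  apply: derivable_within_continuous => s; rewrite in_itv/= => /andP[s0 st].
  by have [] := dg s ltac:(by rewrite ger0_norm// (le_lt_trans st)).
rewrite in_itv/= subr0 => /andP[s0 st] E.
have : 0 < g1 s.
  have := hd s; rewrite /ball/= sub0r normrN gtr0_norm// => /(_ (lt_trans st td)).
  have sn0 : s != 0 by rewrite gt_eqF.
  move=> /(_ sn0); rewrite g10 subr0 addr0 [_ *: 1]mulr1 /=.
  by rewrite [_ *: _]/(_ * _) pmulr_rgt0// invr_gt0.
have := gmax t; rewrite gtr0_norm// => /(_ te) h3 g1s.
have := mulr_gt0 g1s t0; lra.
Qed.

End SecondDerivativeTest.

Section Harmonicity.
Context {R : realType} {n : nat}.
Implicit Types (U : set 'rV[R]_n) (g : 'rV[R]_n -> R).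
Local Notation e_ i := (delta_mx 0 i : 'rV[R]_n).

(** Harmonicity can thus be certified by explicit candidates for the derivatives, correct on [U]
    only. Openness of [U] is what allows them to replace [partial i g] under a further derivative or
    a limit. *)
Lemma real_harmonic_onP U g : open U ->
  real_harmonic_on U g <->
  exists (g1 : 'I_n -> 'rV[R]_n -> R) (g2 : 'I_n -> 'I_n -> 'rV[R]_n -> R),
    forall x, U x ->
    [/\ {for x, continuous g},
        forall i, is_derive x (e_ i) g (g1 i x) /\ {for x, continuous (g1 i)},
        forall i j, is_derive x (e_ j) (g1 i) (g2 i j x) /\
                    {for x, continuous (g2 i j)} &
        \sum_i g2 i i x = 0].
Proof.
move=> oU; split.
  move=> [h hl]; exists (fun i => partial i g), (fun i j => partial j (partial i g)).
  move=> x Ux; have [c0 c1 c2] := h x Ux; split.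
  - exact: c0.
  - by move=> i; have [d1 d2] := c1 i; split => //; exact: derivableP.
  - by move=> i j; have [d1 d2] := c2 i j; split => //; exact: derivableP.
  - exact: hl.
move=> [g1 [g2 h]].
have nearU (x : 'rV[R]_n) (P : 'rV[R]_n -> Prop) : U x -> (forall y, U y -> P y) ->
    \forall y \near x, P y.
  move=> Ux UP; apply: filterS (UP) _; exact: open_nbhs_nbhs.
have e1 i x : U x -> partial i g x = g1 i x.
  by move=> Ux; have [_ /(_ i)[[]]] := h x Ux.
have e1' i x : U x -> \forall y \near x, g1 i y = partial i g y.
  move=> Ux; apply: (nearU x (fun y => g1 i y = partial i g y) Ux) => y Uy.
  by rewrite e1.
have d2 i j x : U x -> is_derive x (e_ j) (partial i g) (g2 i j x).
  move=> Ux; apply: (near_eq_is_derive (e1' i x Ux)).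
  by have [_ _ /(_ i j)[]] := h x Ux.
have e2 i j x : U x -> partial j (partial i g) x = g2 i j x.
  by move=> Ux; have [] := d2 i j x Ux.
have cont (a b : 'rV[R]_n -> R) x : U x -> (forall y, U y -> a y = b y) ->
    {for x, continuous a} -> {for x, continuous b}.
  by move=> Ux ab; apply: near_eq_continuous; exact: (nearU x (fun y => a y = b y)).
split=> [x Ux|x Ux]; last first.
  by have [_ _ _ <-] := h x Ux; apply: eq_bigr => i _; exact: e2.
have [c0 c1 c2 _] := h x Ux; split => //.
- move=> i; have [[d _] c] := c1 i; split => //.
  by apply: cont c => // y Uy; rewrite e1.
- move=> i j; split; first by have [] := d2 i j x Ux.
  by have [_ c] := c2 i j; apply: cont c => // y Uy; rewrite e2.
Qed.

Lemma real_harmonic_on_sub U U' g : U' `<=` U ->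
  real_harmonic_on U g -> real_harmonic_on U' g.
Proof. by move=> UU [h1 h2]; split=> x /UU; [exact: h1|exact: h2]. Qed.

Lemma real_harmonic_on_eq U g h : open U -> (forall x, U x -> g x = h x) ->
  real_harmonic_on U g -> real_harmonic_on U h.
Proof.
move=> oU gh /(real_harmonic_onP _ oU)[g1 [g2 H]].
apply/(real_harmonic_onP _ oU); exists g1, g2 => x Ux; have [c0 c1 c2 c3] := H x Ux.
have nx : \forall y \near x, g y = h y.
  by apply: filterS (gh) _; exact: open_nbhs_nbhs.
split => //.
- exact: near_eq_continuous nx c0.
- by move=> i; have [d c] := c1 i; split => //; exact: near_eq_is_derive nx d.
Qed.

Lemma real_harmonic_on_local U g :
  (forall x, U x -> exists2 V, V x & open V /\ real_harmonic_on V g) ->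
  real_harmonic_on U g.
Proof.
by move=> h; split=> x /h[V Vx [oV [h1 h2]]]; [exact: h1|exact: h2].
Qed.

Lemma real_harmonicD U g h : open U ->
  real_harmonic_on U g -> real_harmonic_on U h ->
  real_harmonic_on U (fun x => g x + h x).
Proof.
move=> oU /(real_harmonic_onP _ oU)[g1 [g2 G]] /(real_harmonic_onP _ oU)[h1 [h2 H]].
apply/(real_harmonic_onP _ oU).
exists (fun i x => g1 i x + h1 i x), (fun i j x => g2 i j x + h2 i j x) => x Ux.
have [a0 a1 a2 a3] := G x Ux; have [b0 b1 b2 b3] := H x Ux; split.
- exact: (@cvgD _ _ _ (nbhs x)).
- move=> i; have [? ?] := a1 i; have [? ?] := b1 i; split.
    exact: is_derive_add.
  exact: (@cvgD _ _ _ (nbhs x)).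
- move=> i j; have [? ?] := a2 i j; have [? ?] := b2 i j; split.
    exact: is_derive_add.
  exact: (@cvgD _ _ _ (nbhs x)).
- by rewrite big_split/= a3 b3 addr0.
Qed.

Lemma real_harmonicZ U g (c : R) : open U ->
  real_harmonic_on U g -> real_harmonic_on U (fun x => c * g x).
Proof.
move=> oU /(real_harmonic_onP _ oU)[g1 [g2 G]]; apply/(real_harmonic_onP _ oU).
exists (fun i x => c * g1 i x), (fun i j x => c * g2 i j x) => x Ux.
have [a0 a1 a2 a3] := G x Ux; split.
- exact: (@cvgM _ _ (nbhs x) _ _ _ _ _ (cvg_cst c)).
- move=> i; have [? ?] := a1 i; split.
    exact: is_derive_scale.
  exact: (@cvgM _ _ (nbhs x) _ _ _ _ _ (cvg_cst c)).
- move=> i j; have [? ?] := a2 i j; split.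
    exact: is_derive_scale.
  exact: (@cvgM _ _ (nbhs x) _ _ _ _ _ (cvg_cst c)).
- by rewrite -mulr_sumr a3 mulr0.
Qed.

Lemma real_harmonic_cst U (c : R) : open U -> real_harmonic_on U (fun=> c).
Proof.
move=> oU; apply/(real_harmonic_onP _ oU).
exists (fun _ _ => 0), (fun _ _ _ => 0) => x Ux; split.
- exact: cst_continuous.
- by move=> i; split; [exact: is_derive_const|exact: cst_continuous].
- by move=> i j; split; [exact: is_derive_const|exact: cst_continuous].
- by rewrite big1.
Qed.

Lemma real_harmonicB U g h : open U ->
  real_harmonic_on U g -> real_harmonic_on U h ->
  real_harmonic_on U (fun x => g x - h x).
Proof.
move=> oU hg /(real_harmonicZ (-1) oU) hh.
by apply: real_harmonic_on_eq (real_harmonicD oU hg hh) => // x _; rewrite mulN1r.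
Qed.

Lemma real_harmonic_continuous U g x : real_harmonic_on U g -> U x ->
  {for x, continuous g}.
Proof. by move=> [h _] /h[]. Qed.

Lemma is_derive_sqr_enorm x i :
  is_derive x (e_ i) (fun y : 'rV[R]_n => dotp y y) (2 * x 0 i).
Proof.
apply/is_derive_line0.
have -> : (fun s : R => dotp (s *: e_ i + x) (s *: e_ i + x)) =
   (fun s : R => s * s + (2 * x 0 i) * s + dotp x x).
  apply/funext => s; rewrite !(dotpDl, dotpDr, dotpZl, dotpZr) dotp_delta.
  by rewrite (dotpC _ x) !dotp_delta mxE !eqxx /=; ring.
have did : is_derive (0:R) (1:R) (fun s : R => s) 1 by exact: is_derive_id.
have h := is_derive_add (is_derive_add (is_derive_mul did did)
  (is_derive_scale (2 * x 0 i) did)) (is_derive_const (0:R) (1:R) (dotp x x)).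
apply: (is_derive_eq h).
by ring.
Qed.

(** If the bound failed at [x0], then for small [a > 0] the function [h = u + a |x|^2] would reach
    its maximum over the closed ball at an interior point; but the Laplacian of [h] there is
    [2 n a > 0]. *)
Theorem maximum_principle (u : 'rV[R]_n -> R) (r c : R) : (0 < n)%N ->
  real_harmonic_on [set x | enorm x < r] u ->
  (forall x, enorm x <= r -> {for x, continuous u}) ->
  (forall x, enorm x = r -> u x <= c) ->
  forall x, enorm x <= r -> u x <= c.
Proof.
move=> n0 hu cu ub x0 x0r; rewrite leNgt; apply/negP => cx0.
have oU : open [set x : 'rV[R]_n | enorm x < r] by exact: open_eball.
(* Small enough that [a r^2 < u x0 - c], so [h] on the bounding sphere stays below [u x0] and the
   maximum is interior. The [+ 1] keeps the denominator positive. *)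
pose a := (u x0 - c) / (2 * (r ^+ 2 + 1)).
have r20 : 0 < r ^+ 2 + 1 by rewrite ltr_wpDl// sqr_ge0.
have a0 : 0 < a by rewrite divr_gt0 ?subr_gt0// mulr_gt0.
have ar : a * r ^+ 2 < u x0 - c.
  have : a * (2 * (r ^+ 2 + 1)) = u x0 - c by rewrite /a mulfVK// mulf_neq0// gt_eqF.
  by have := sqr_ge0 r; nra.
pose h x := u x + a * dotp x x.
have [x1] : exists2 x1, x1 \in [set x : 'rV[R]_n | enorm x <= r] &
    forall y, y \in [set x : 'rV[R]_n | enorm x <= r] -> h y <= h x1.
  apply: compact_EVT_max; [by exists x0|exact: compact_eball|].
  apply: continuous_in_subspaceT => x /set_mem /cu c1.
  apply: (@cvgD _ _ _ (nbhs x)) => //; apply: (@cvgM _ _ (nbhs x)); first exact: cvg_cst.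
  exact: sqr_enorm_continuous.
rewrite inE/= => x1r hmax.
have h01 : u x0 <= h x1.
  by apply: le_trans (hmax x0 (mem_set x0r)); rewrite lerDl mulr_ge0 ?dotp_ge0// ltW.
have x1r' : enorm x1 < r.
  rewrite lt_neqAle x1r andbT; apply/eqP => e; have := ub _ e.
  by move: h01; rewrite /h -sqr_enorm e; lra.
have [g1 [g2 G]] := (real_harmonic_onP _ oU).1 hu.
have [_ _ c2 c3] := G x1 x1r'.
(* Each pure second derivative of [h] is nonpositive at the maximum; summing, with the Laplacian of
   [u] equal to 0, leaves [2 n a <= 0]. *)
suff H i : g2 i i x1 + 2 * a <= 0.
  have : \sum_i (g2 i i x1 + 2 * a) <= 0 by apply: sumr_le0 => i _.
  rewrite big_split/= c3 add0r sumr_const card_ord -mulr_natr.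
  have : 0 < n%:R :> R by rewrite ltr0n.
  by move: a0; nra.
have e0 : 0 < r - enorm x1 by rewrite subr_gt0.
have inU t : `|t| < r - enorm x1 -> enorm (t *: e_ i + x1) < r.
  by move=> h1; rewrite (le_lt_trans (enormD _ _))// enormZ enorm_delta mulr1; lra.
apply: (@second_derivative_le0 _ (fun t : R => h (t *: e_ i + x1))
  (fun t : R => g1 i (t *: e_ i + x1) + a * (2 * (t *: e_ i + x1) 0 i)) _ _ e0).
- move=> t /inU tU; have [_ /(_ i)[d _] _ _] := G _ tU.
  have D := is_derive_add d (is_derive_scale a (is_derive_sqr_enorm (t *: e_ i + x1) i)).
  exact: (iffLR (is_derive_line h x1 (e_ i) t _) D).
- have D1 := iffLR (is_derive_line0 (g1 i) x1 (e_ i) _) (c2 i i).1.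
  have did : is_derive (0:R) (1:R) (fun s : R => s) 1 by exact: is_derive_id.
  have D2 := is_derive_add did (is_derive_const (0:R) (1:R) (x1 0 i)).
  have D3 := is_derive_scale a (is_derive_scale 2 D2).
  have e3 : (fun t : R => a * (2 * (t *: e_ i + x1) 0 i)) = (fun t : R => a * (2 * (t + x1 0 i))).
    by apply/funext => t; rewrite !mxE !eqxx mulr1.
  rewrite -e3 in D3; have := is_derive_add D1 D3.
  by rewrite (_ : a * (2 * (1 + 0)) = 2 * a) //; ring.
- move=> t /inU tU; rewrite scale0r add0r; apply: hmax.
  by rewrite inE; exact: ltW.
Qed.

End Harmonicity.

Section EnormNeighbourhoods.
Context {R : realType} {n : nat}.
Implicit Types x y : 'rV[R]_n.

Lemma nbhs_enorm x (P : set 'rV[R]_n) : nbhs x P ->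
  exists2 e : R, 0 < e & forall y, enorm (y - x) < e -> P y.
Proof.
move=> /nbhs_ballP[e /= e0 eP]; exists e => // y yx; apply: eP.
by rewrite -ball_normE /ball_/= (le_lt_trans (norm_le_enorm _))// enormB.
Qed.

(** Uniform continuity on a compact set, in a form where only [x] is confined to [K] and [y] may
    leave it. Around each point of [K] the radius is halved, so that one radius serves all nearby
    [x]. *)
Lemma uniformly_continuous_near (K : set 'rV[R]_n) (u : 'rV[R]_n -> R) (e : R) :
  compact K -> (forall x, K x -> {for x, continuous u}) -> 0 < e ->
  exists2 t : R, 0 < t &
    forall x y, K x -> enorm (y - x) < t -> `|u y - u x| <= e.
Proof.
move=> /compact_near_coveringP cK cu e0.
have := cK R (0^'+) (fun t x => forall y, enorm (y - x) < t -> `|u y - u x| <= e) _.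
case.
- move=> x Kx; have e2 : 0 < e / 2 by rewrite divr_gt0.
  have /cvgrPdist_le/(_ _ e2)/nbhs_enorm[d d0 dP] := cu x Kx.
  have d2 : 0 < d / 2 by rewrite divr_gt0.
  have dd : d / 2 < d by rewrite ltr_pdivrMr// ltr_pMr// ltr1n.
  exists ([set x' | enorm (x' - x) < d / 2], [set t : R | t < d / 2]) => /=.
    by split; [exact: nbhs_enorm_lt|exact: nbhs_right_lt].
  move=> [x' t] /= [x'x td] y yx'.
  have h1 := dP x' (lt_trans x'x dd).
  have h2 : `|u x - u y| <= e / 2.
    apply: dP; rewrite (_ : y - x = (y - x') + (x' - x)); last by rewrite addrA subrK.
    by rewrite (le_lt_trans (enormD _ _))//; lra.
  rewrite (_ : u y - u x' = (u x - u x') - (u x - u y)); last by lra.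
  by rewrite (le_trans (ler_normB _ _))//; lra.
- move=> t /= t0 tP; exists (t / 2); first by rewrite divr_gt0.
  have : ball_ Num.norm 0 t (t / 2).
    by rewrite /ball_/= sub0r normrN gtr0_norm ?divr_gt0//; lra.
  move=> /tP h x y Kx yx; apply: h => //.
  by rewrite divr_gt0.
Qed.

End EnormNeighbourhoods.

Lemma continuous_pair (T U V : topologicalType) (f : T -> U) (g : T -> V) x :
  {for x, continuous f} -> {for x, continuous g} ->
  {for x, continuous (fun y => (f y, g y))}.
Proof. by move=> cf cg; apply: cvg_pair. Qed.

(** * Integrals over the sphere against a kernel: continuity and differentiation under the
    integral *)

Section KernelIntegrals.
Context {R : realType} {n : nat}.
Local Notation E := (borel_space R n).
Variable sigma : probability E R.
Hypothesis hsigma : invariant_probability_on sigma unit_sphere.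
Local Notation S := (unit_sphere : set E).
Variables (r : R) (r0 : 0 < r).

(** The kernels below are singular on the diagonal, but a point of norm less than [r] never meets
    the sphere of radius [r], so joint continuity elsewhere is enough. *)
Definition offdiag_continuous (K : 'rV[R]_n -> 'rV[R]_n -> R) : Prop :=
  forall x w : 'rV[R]_n, x != w ->
    {for (x, w), continuous (fun p : 'rV[R]_n * 'rV[R]_n => K p.1 p.2)}.

Definition kernel_integral (K : 'rV[R]_n -> 'rV[R]_n -> R) (g : E -> R) :=
  fun x : 'rV[R]_n => \int[sigma]_(z in S) (K x (r *: (z : 'rV[R]_n)) * g z).

Implicit Types (K : 'rV[R]_n -> 'rV[R]_n -> R) (g : E -> R).

Let mS := @measurable_sphere R n.

Let sphere_neq (x z : 'rV[R]_n) : enorm x < r -> unit_sphere z -> x != r *: z.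
Proof.
move=> xr Sz; apply: contraTneq xr => ->.
by rewrite enormZ Sz mulr1 gtr0_norm// ltxx.
Qed.

(** Compactness of the sphere makes the continuity in [x] uniform in the boundary point. This one
    estimate gives continuity and differentiability of the integrals and, later, equicontinuity in
    Montel's theorem. *)
Lemma kernel_near K (x0 : 'rV[R]_n) (e : R) : offdiag_continuous K ->
  enorm x0 < r -> 0 < e ->
  \forall x \near x0, forall z : 'rV[R]_n, unit_sphere z ->
    `|K x (r *: z) - K x0 (r *: z)| <= e.
Proof.
move=> cK x0r e0.
have := @compact_esphere R n 1 => /compact_near_coveringP.
move=> /(_ _ (nbhs x0) (fun x z => `|K x (r *: z) - K x0 (r *: z)| <= e) _).
apply => z Sz; have e2 : 0 < e / 2 by rewrite divr_gt0.
have /cvgrPdist_le/(_ _ e2) := cK _ _ (sphere_neq x0r Sz).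
move=> [[/= P Q] [/= Px0 Qz] PQ].
have cz : {for z, continuous (fun z' : 'rV[R]_n => r *: z')}.
  exact: scaler_continuous.
exists ((fun z' => r *: z') @^-1` Q, P) => /=; first by split => //; exact: cz.
move=> [z' x] /= [Qz' Px].
have h1 := PQ (x, r *: z') (conj Px Qz').
have h2 := PQ (x0, r *: z') (conj (nbhs_singleton Px0) Qz').
rewrite (_ : _ - _ = (K x0 (r *: z) - K x0 (r *: z')) - (K x0 (r *: z) - K x (r *: z'))); last by lra.
by rewrite (le_trans (ler_normB _ _))//= [leRHS](splitr e); apply: lerD.
Qed.

Lemma bmeas_kernel K (x : 'rV[R]_n) : offdiag_continuous K -> enorm x < r ->
  bmeas S (fun z : E => K x (r *: (z : 'rV[R]_n))).
Proof.
move=> cK xr.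
have ck (z : 'rV[R]_n) : x != r *: z -> {for z, continuous (fun z' : 'rV[R]_n => K x (r *: z'))}.
  move=> xz; have c1 := cK _ _ xz.
  apply: (@continuous_comp _ _ _ (fun z' : 'rV[R]_n => (x, r *: z'))
    (fun p : 'rV[R]_n * 'rV[R]_n => K p.1 p.2)); last exact: c1.
  apply: (@continuous_pair _ _ _ (fun=> x)); first exact: cst_continuous.
  exact: scaler_continuous.
have oU : open [set z : 'rV[R]_n | x != r *: z].
  rewrite (_ : mkset _ = (fun z : 'rV[R]_n => enorm (x - r *: z)) @^-1` [set t | 0 < t]).
    apply: open_comp; last exact: open_gt.
    move=> z _; apply: (@continuous_comp _ _ _ (fun z : 'rV[R]_n => x - r *: z) (@enorm R n)).
      apply: (@cvgB _ _ _ (nbhs z)); [exact: cvg_cst|exact: scaler_continuous].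
    exact: enorm_continuous.
  apply/seteqP; split => z /=; first by rewrite -subr_eq0 => /enorm_gt0.
  by apply: contraTneq => ->; rewrite subrr enorm0 ltxx.
split.
  apply: (@measurable_funS _ _ _ _ ([set z | x != r *: (z : 'rV[R]_n)] : set E)).
  - exact: open_measurable.
  - by move=> z /= Sz; exact: sphere_neq.
  - exact: (continuous_on_measurable oU).
have [M [_ hM]] : bounded_set [set K x (r *: z) | z in [set z : 'rV[R]_n | enorm z = 1]].
  apply: compact_bounded; apply: continuous_compact; last exact: compact_esphere.
  by apply: continuous_in_subspaceT => z /set_mem Sz; apply: ck; exact: sphere_neq.
exists (M + 1) => z Sz; apply: hM; first by rewrite ltrDl.
by exists z.
Qed.

Lemma kernel_integral_continuous K g x0 : offdiag_continuous K -> bmeas S g ->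
  enorm x0 < r -> {for x0, continuous (kernel_integral K g)}.
Proof.
move=> cK bg x0r; have [mg [M gM]] := bg; have [s1 _ _] := hsigma.
apply/(@cvgrPdist_le _ _ _ (nbhs x0)) => e e0.
have M0 : 0 < `|M| + 1 by rewrite ltr_wpDl.
have d0 : 0 < e / (`|M| + 1) by rewrite divr_gt0.
have nr : \forall x \near x0, enorm x < r.
  by apply: open_nbhs_nbhs; split => //; exact: open_eball.
apply: filterS2 nr (kernel_near cK x0r d0) => x xr h.
have b0 := bmeasM (bmeas_kernel cK x0r) bg; have b1 := bmeasM (bmeas_kernel cK xr) bg.
rewrite /kernel_integral -(RintB _ mS b0 b1).
apply: (Rint_norm_le mS s1 (bmeasB b0 b1)) => z Sz.
rewrite -mulrBl normrM; have := h z Sz; rewrite distrC => h1.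
apply: (@le_trans _ _ (e / (`|M| + 1) * (`|M| + 1))); last by rewrite divfK// gt_eqF.
rewrite ler_pM// (le_trans (gM _ Sz))// (le_trans (ler_norm _))// lerDl.
exact: ler01.
Qed.

(** By the mean value theorem the difference quotient of [K] is a value of [K'] between [x0] and
    [h v + x0], hence close to [K'] at [x0] uniformly over the sphere. *)
Lemma kernel_integral_derive K K' g x0 v : offdiag_continuous K ->
  offdiag_continuous K' -> bmeas S g ->
  (forall x w, x != w -> is_derive x v (K^~ w) (K' x w)) ->
  enorm x0 < r ->
  is_derive x0 v (kernel_integral K g) (kernel_integral K' g x0).
Proof.
move=> cK cK' bg dK x0r; have [mg [M gM]] := bg; have [s1 _ _] := hsigma.
suff C : (fun h : R => h^-1 *: (kernel_integral K g (h *: v + x0) - kernel_integral K g x0))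
    @ 0^' --> kernel_integral K' g x0.
  by split; [exact: cvgP C|exact: cvg_lim C].
apply/cvgrPdist_le => e e0.
have M0 : 0 < `|M| + 1 by rewrite ltr_wpDl.
have d0 : 0 < e / (`|M| + 1) by rewrite divr_gt0.
have nr : \forall x \near x0, enorm x < r.
  by apply: open_nbhs_nbhs; split => //; exact: open_eball.
have [t t0 tP] := nbhs_enorm (filterI nr (kernel_near cK' x0r d0)).
have near0 : \forall h \near (0:R)^', `|h| * (enorm v + 1) < t.
  have tv : 0 < t / (enorm v + 1) by rewrite divr_gt0// ltr_wpDl// enorm_ge0.
  apply/(nbhs_ballP (0:R)); exists (t / (enorm v + 1)) => //= h.
  rewrite /ball/= sub0r normrN => hh _.
  by rewrite -ltr_pdivlMr// ltr_wpDl// enorm_ge0.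
have nz : \forall h \near (0:R)^', h != 0 by exact: nbhs_dnbhs_neq.
apply: filterS2 near0 nz => h ht h0.
have inb (s : R) : `|s| <= `|h| -> enorm ((s *: v + x0) - x0) < t.
  move=> sh; rewrite addrK enormZ (le_lt_trans _ ht)//.
  by rewrite ler_pM ?enorm_ge0// lerDl.
have xr := (tP _ (inb h (lexx _))).1.
have b0 := bmeasM (bmeas_kernel cK x0r) bg; have b1 := bmeasM (bmeas_kernel cK xr) bg.
have b' := bmeasM (bmeas_kernel cK' x0r) bg.
have /= e1 := RintB sigma mS b1 b0.
have /= e2 := RintZ sigma h^-1 mS (bmeasB b1 b0).
have /= e3 := RintB sigma mS b' (bmeasZ h^-1 (bmeasB b1 b0)).
rewrite -[X in `|_ - X|]/(h^-1 * (_ - _)) /kernel_integral -e1 -e2 -e3.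
apply: (Rint_norm_le mS s1 (bmeasB b' (bmeasZ _ (bmeasB b1 b0)))) => z Sz.
rewrite -mulrBl mulrA -mulrBl normrM.
suff h1 : `|K' x0 (r *: z) - h^-1 * (K (h *: v + x0) (r *: z) - K x0 (r *: z))| <= e / (`|M| + 1).
  apply: (@le_trans _ _ (e / (`|M| + 1) * (`|M| + 1))); last by rewrite divfK// gt_eqF.
  rewrite ler_pM// (le_trans (gM _ Sz))// (le_trans (ler_norm _))// lerDl.
  exact: ler01.
set w := r *: (z : 'rV[R]_n).
have dline (s : R) : `|s| <= `|h| ->
    is_derive s (1:R) (fun q : R => K (q *: v + x0) w) (K' (s *: v + x0) w).
  move=> sh; apply: (iffLR (is_derive_line (K^~ w) x0 v s _)); apply: dK.
  exact: sphere_neq (tP _ (inb s sh)).1 Sz.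
(* The mean value theorem is applied on the interval between 0 and [h], whose order depends on the
   sign of [h]. *)
have [c ch E1] : exists2 c : R, `|c| <= `|h| &
    K (h *: v + x0) w - K x0 w = K' (c *: v + x0) w * h.
  have cont (a b : R) : (forall s, s \in `[a, b] -> `|s| <= `|h|) ->
      {within `[a, b], continuous (fun q : R => K (q *: v + x0) w)}.
    move=> ab; apply: derivable_within_continuous => s sab.
    by have [] := dline s (ab s sab).
  have K0 : K x0 w = K (0 *: v + x0) w by rewrite scale0r add0r.
  have [hpos|hneg] := ltP 0 h.
    have ab s : s \in `[0, h] -> `|s| <= `|h|.
      by rewrite in_itv/= => /andP[s0 sh]; rewrite !ger0_norm// ltW.
    have [c] := @MVT _ _ (fun s : R => K' (s *: v + x0) w) _ _ hpos
      (fun s sI => dline s (ab s (subset_itv_oo_cc sI))) (cont 0 h ab).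
    move=> cI; rewrite subr0 -K0 => E2; exists c => //.
    exact: ab (subset_itv_oo_cc cI).
  have {}hneg : h < 0 by rewrite lt_neqAle h0.
  have ab s : s \in `[h, 0] -> `|s| <= `|h|.
    by rewrite in_itv/= => /andP[s0 sh]; rewrite !ler0_norm ?lerN2// ltW.
  have [c] := @MVT _ _ (fun s : R => K' (s *: v + x0) w) _ _ hneg
    (fun s sI => dline s (ab s (subset_itv_oo_cc sI))) (cont h 0 ab).
  move=> cI; rewrite sub0r -K0 => E2; exists c; last by lra.
  exact: ab (subset_itv_oo_cc cI).
rewrite E1 mulrC mulfK// distrC.
exact: (tP _ (inb c ch)).2 z Sz.
Qed.

End KernelIntegrals.

(** * The Poisson kernel *)

Section PoissonKernel.
Context {R : realType} {n : nat}.
Implicit Types (x w : 'rV[R]_n) (a b r : R).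
Local Notation e_ i := (delta_mx 0 i : 'rV[R]_n).

Definition sqdist x w := dotp (x - w) (x - w).

(** This is [|x - w|^(2 b)], with a real exponent because [n / 2] need not be an integer. *)
Definition distpow b x w := sqdist x w `^ b.

Lemma sqdist_gt0 x w : x != w -> 0 < sqdist x w.
Proof.
move=> xw; rewrite lt_neqAle dotp_ge0 andbT eq_sym.
by apply: contra_neq xw => /dotp_eq0 /eqP; rewrite subr_eq0 => /eqP.
Qed.

Lemma distpowM a b x w : x != w ->
  distpow (a + b) x w = distpow a x w * distpow b x w.
Proof.
by move=> /sqdist_gt0 s0; rewrite /distpow powRD//; apply/implyP => _; rewrite gt_eqF.
Qed.

Lemma is_derive_sqdist x w i :
  is_derive x (e_ i) (sqdist^~ w) (2 * (x 0 i - w 0 i)).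
Proof.
have /is_derive_line0 h := is_derive_sqr_enorm (x - w) i.
apply/is_derive_line0; rewrite !mxE in h.
by under eq_fun do rewrite /sqdist -addrA.
Qed.

Lemma is_derive_distpow b x w i : x != w ->
  is_derive x (e_ i) (distpow b ^~ w) (2 * b * (x 0 i - w 0 i) * distpow (b - 1) x w).
Proof.
move=> xw; have s0 := sqdist_gt0 xw.
have h := is_derive_comp1 (is_derive_sqdist x w i) (is_derive1_powR b s0).
by apply: (is_derive_eq h); rewrite -/(distpow (b - 1) x w); ring.
Qed.

Lemma is_derive_coord x i j :
  is_derive x (e_ j) (fun y : 'rV[R]_n => y 0 i) (i == j)%:R.
Proof.
apply/is_derive_line0.
have did : is_derive (0:R) (1:R) (fun s : R => s) 1 by exact: is_derive_id.
have h := is_derive_add (is_derive_scale (i == j)%:R did) (is_derive_const (0:R) (1:R) (x 0 i)).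
rewrite (_ : (fun s : R => _) = (fun s : R => (i == j)%:R * s + x 0 i)).
  by apply: (is_derive_eq h); ring.
by apply/funext => s; rewrite !mxE eqxx/= mulrC.
Qed.

Lemma offdiag_cst c : offdiag_continuous (fun x w : 'rV[R]_n => c : R).
Proof. by move=> x w _; exact: cst_continuous. Qed.

Lemma offdiagD (K L : 'rV[R]_n -> 'rV[R]_n -> R) :
  offdiag_continuous K -> offdiag_continuous L ->
  offdiag_continuous (fun x w => K x w + L x w).
Proof. by move=> cK cL x w xw; exact: (@cvgD _ _ _ (nbhs (x, w)) _ _ _ _ _ (cK _ _ xw) (cL _ _ xw)). Qed.

Lemma offdiagM (K L : 'rV[R]_n -> 'rV[R]_n -> R) :
  offdiag_continuous K -> offdiag_continuous L ->
  offdiag_continuous (fun x w => K x w * L x w).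
Proof. by move=> cK cL x w xw; exact: (@cvgM _ _ (nbhs (x, w)) _ _ _ _ _ (cK _ _ xw) (cL _ _ xw)). Qed.

Lemma offdiag_fst (f : 'rV[R]_n -> R) : continuous f ->
  offdiag_continuous (fun x w => f x).
Proof.
move=> cf x w _; apply: (@continuous_comp _ _ _ fst f); last exact: cf.
exact: cvg_fst.
Qed.

Lemma offdiag_snd (f : 'rV[R]_n -> R) : continuous f ->
  offdiag_continuous (fun x w => f w).
Proof.
move=> cf x w _; apply: (@continuous_comp _ _ _ snd f); last exact: cf.
exact: cvg_snd.
Qed.

Lemma offdiag_diff i : offdiag_continuous (fun x w => x 0 i - w 0 i).
Proof.
have h := offdiagD (offdiag_fst (@coord_continuous R 1 n 0 i))
  (offdiagM (@offdiag_cst (-1)) (offdiag_snd (@coord_continuous R 1 n 0 i))).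
move=> x w xw; rewrite (_ : (fun p => _) =
    (fun p : 'rV[R]_n * 'rV[R]_n => p.1 0 i + -1 * p.2 0 i)); first exact: h.
by apply/funext => p; rewrite mulN1r.
Qed.

Lemma offdiag_distpow b : offdiag_continuous (distpow b).
Proof.
move=> x w xw; apply: (@continuous_comp _ _ _
    (fun p : 'rV[R]_n * 'rV[R]_n => sqdist p.1 p.2) (@powR R ^~ b)).
  rewrite (_ : (fun p => _) = fun p : 'rV[R]_n * 'rV[R]_n =>
      dotp p.1 p.1 + (-2) * dotp p.1 p.2 + dotp p.2 p.2); last first.
    by apply/funext => p; rewrite /sqdist !(dotpBl, dotpBr) (dotpC p.2 p.1); ring.
  have c1 := offdiag_fst (@sqr_enorm_continuous R n) xw.
  have c2 := offdiag_snd (@sqr_enorm_continuous R n) xw.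
  have c3 := @dotp_continuous_pair R n (x, w).
  apply: (@cvgD _ _ _ (nbhs (x, w))) c2; apply: (@cvgD _ _ _ (nbhs (x, w))) => //.
  by apply: (@cvgM _ _ (nbhs (x, w))) c3; exact: cvg_cst.
have [d _] := is_derive1_powR b (sqdist_gt0 xw).
by apply: differentiable_continuous; exact/derivable1_diffP.
Qed.

Variable r : R.
Let a : R := - (n%:R / 2).

(** The classical kernel [(r^2 - |x|^2) / |x - w|^n], without normalising constant; representation
    formulas therefore divide by its mass. *)
Definition poisson x w := (r ^+ 2 - dotp x x) * distpow a x w.

Let poisson1 i x w := (r ^+ 2 - dotp x x) * (2 * a * (x 0 i - w 0 i) * distpow (a - 1) x w)
  + distpow a x w * (-2 * x 0 i).

Let poisson2 i j x w :=
  (r ^+ 2 - dotp x x) * (2 * a * ((x 0 i - w 0 i) * (2 * (a - 1) * (x 0 j - w 0 j) * distpow (a - 1 - 1) x w)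
    + distpow (a - 1) x w * (i == j)%:R))
  + (2 * a * (x 0 i - w 0 i) * distpow (a - 1) x w) * (-2 * x 0 j)
  + (distpow a x w * (-2 * (i == j)%:R) + (-2 * x 0 i) * (2 * a * (x 0 j - w 0 j) * distpow (a - 1) x w)).

Let is_derive_Q x i : is_derive x (e_ i) (fun x => r ^+ 2 - dotp x x) (-2 * x 0 i).
Proof.
have h := is_derive_add (is_derive_const x (e_ i) (r ^+ 2)) (is_derive_scale (-1) (is_derive_sqr_enorm x i)).
rewrite (_ : (fun x => _) = (fun x : 'rV[R]_n => r ^+ 2 + -1 * dotp x x)).
  by apply: (is_derive_eq h); ring.
by apply/funext => y; rewrite mulN1r.
Qed.

Let is_derive_poisson x w i : x != w ->
  is_derive x (e_ i) (poisson^~ w) (poisson1 i x w).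
Proof.
move=> xw; exact: (is_derive_mul (is_derive_Q x i) (is_derive_distpow a i xw)).
Qed.

Let is_derive_poisson1 x w i j : x != w ->
  is_derive x (e_ j) (poisson1 i ^~ w) (poisson2 i j x w).
Proof.
move=> xw.
have dd : is_derive x (e_ j) (fun x : 'rV[R]_n => x 0 i - w 0 i) (i == j)%:R.
  have h := is_derive_add (is_derive_coord x i j) (is_derive_const x (e_ j) (- w 0 i)).
  by apply: (is_derive_eq h); rewrite addr0.
have h1 := is_derive_mul (is_derive_scale (2 * a) dd) (is_derive_distpow (a - 1) j xw).
have h2 := is_derive_mul (is_derive_Q x j) h1.
have h3 := is_derive_mul (is_derive_distpow a j xw) (is_derive_scale (-2) (is_derive_coord x i j)).
apply: (is_derive_eq (is_derive_add h2 h3)); rewrite /poisson2; ring.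
Qed.

Let oc_Q : offdiag_continuous (fun x w : 'rV[R]_n => r ^+ 2 - dotp x x).
Proof.
apply: offdiag_fst => x; apply: (@cvgB _ _ _ (nbhs x)); first exact: cvg_cst.
exact: sqr_enorm_continuous.
Qed.

Lemma offdiag_poisson : offdiag_continuous poisson.
Proof. exact: (offdiagM oc_Q (@offdiag_distpow a)). Qed.

Let oc_x i : offdiag_continuous (fun x w : 'rV[R]_n => x 0 i).
Proof. exact: offdiag_fst (@coord_continuous R 1 n 0 i). Qed.

Let offdiag_poisson1 i : offdiag_continuous (poisson1 i).
Proof.
have t1 := offdiagM (offdiagM (@offdiag_cst (2 * a)) (@offdiag_diff i)) (@offdiag_distpow (a - 1)).
have t2 := offdiagM (@offdiag_cst (-2)) (@oc_x i).
exact: (offdiagD (offdiagM oc_Q t1) (offdiagM (@offdiag_distpow a) t2)).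
Qed.

Let offdiag_poisson2 i j : offdiag_continuous (poisson2 i j).
Proof.
have t2 k := offdiagM (offdiagM (@offdiag_cst (2 * a)) (@offdiag_diff k)) (@offdiag_distpow (a - 1)).
have t3 k := offdiagM (@offdiag_cst (-2)) (@oc_x k).
have d := @offdiag_cst (i == j)%:R.
have t4 := offdiagM (offdiagM (@offdiag_cst (2 * (a - 1))) (@offdiag_diff j)) (@offdiag_distpow (a - 1 - 1)).
have t5 := offdiagD (offdiagM (@offdiag_diff i) t4) (offdiagM (@offdiag_distpow (a - 1)) d).
have t6 := offdiagM oc_Q (offdiagM (@offdiag_cst (2 * a)) t5).
have t7 := offdiagM (@offdiag_distpow a) (offdiagM (@offdiag_cst (-2)) d).
exact: (offdiagD (offdiagD t6 (offdiagM (t2 i) (t3 j))) (offdiagD t7 (offdiagM (t3 i) (t2 j)))).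
Qed.

(** Both [|w| = r] and the choice of the exponent, as [n = -2 a], enter here. Once every power of
    the distance is expressed through [A1] and [sqdist], the sum of the second derivatives cancels
    as a polynomial identity. *)
Let laplacian_poisson x w : x != w -> dotp w w = r ^+ 2 ->
  \sum_i poisson2 i i x w = 0.
Proof.
move=> xw wr.
set A1 := distpow (a - 1) x w; set Q := r ^+ 2 - dotp x x.
have eA1 : A1 = distpow (a - 1 - 1) x w * sqdist x w.
  rewrite -[sqdist x w](powRr1 (ltW (sqdist_gt0 xw))) -/(distpow 1 x w).
  by rewrite -distpowM// subrK.
have eA : distpow a x w = A1 * sqdist x w.
  rewrite -[sqdist x w](powRr1 (ltW (sqdist_gt0 xw))) -/(distpow 1 x w).
  by rewrite -distpowM// subrK.
have [c cE] : exists c, c = 2 * a * Q * A1 - 2 * distpow a x w by eexists.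
have E i : poisson2 i i x w =
    (-8 * a * A1) * (x 0 i * (x - w) 0 i) +
    (4 * a * (a - 1) * Q * distpow (a - 1 - 1) x w) * ((x - w) 0 i * (x - w) 0 i) +
    c.
  by rewrite cE /poisson2 -/A1 -/Q eqxx [nat_of_bool _]/= !mxE; ring.
under eq_bigr do rewrite E.
rewrite !big_split/= -!mulr_sumr -/(dotp x (x - w)) -/(dotp (x - w) (x - w)) -/(sqdist x w).
rewrite sumr_const card_ord -[c *+ n]mulr_natr cE.
have an : n%:R = -2 * a by rewrite /a; field.
have -> : 4 * a * (a - 1) * Q * distpow (a - 1 - 1) x w * sqdist x w = 4 * a * (a - 1) * Q * A1.
  by rewrite eA1; ring.
rewrite eA an /sqdist /Q -wr !(dotpBl, dotpBr) (dotpC w x); ring.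
Qed.

Lemma poisson_derivatives :
  exists (K1 : 'I_n -> 'rV[R]_n -> 'rV[R]_n -> R) (K2 : 'I_n -> 'I_n -> 'rV[R]_n -> 'rV[R]_n -> R),
  [/\ forall i, offdiag_continuous (K1 i), forall i j, offdiag_continuous (K2 i j),
      forall i x w, x != w -> is_derive x (e_ i) (poisson^~ w) (K1 i x w),
      forall i j x w, x != w -> is_derive x (e_ j) (K1 i ^~ w) (K2 i j x w) &
      forall x w, x != w -> dotp w w = r ^+ 2 -> \sum_i K2 i i x w = 0].
Proof.
exists poisson1, poisson2; split.
- exact: offdiag_poisson1.
- exact: offdiag_poisson2.
- by move=> i x w; exact: is_derive_poisson.
- by move=> i j x w; exact: is_derive_poisson1.
- exact: laplacian_poisson.
Qed.

End PoissonKernel.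

(** * The Poisson representation of harmonic functions *)

Section PoissonIntegral.
Context {R : realType} {n : nat}.
Local Notation E := (borel_space R n).
Variable sigma : probability E R.
Hypothesis hsigma : invariant_probability_on sigma unit_sphere.
Local Notation S := (unit_sphere : set E).
Local Notation ball r := [set x : 'rV[R]_n | enorm x < r].

Let mS := @measurable_sphere R n.

Lemma Rint_sum d (T : measurableType d) (P : probability T R) (D : set T)
    (I : Type) (s : seq I) (g : I -> T -> R) : measurable D ->
  (forall i, bmeas D (g i)) ->
  \int[P]_(x in D) (\sum_(i <- s) g i x) = \sum_(i <- s) \int[P]_(x in D) g i x.
Proof.
move=> mD bg; have bs t : bmeas D (fun x => \sum_(i <- t) g i x).
  elim: t => [|i t IH].
    by under eq_fun do rewrite big_nil; exact: bmeas_cst.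
  by under eq_fun do rewrite big_cons; exact: (bmeasD (bg i) IH).
elim: s => [|i s IH].
  under eq_Rintegral => x _ do rewrite big_nil.
  by rewrite big_nil Rintegral_cst// mul0r.
under eq_Rintegral => x _ do rewrite big_cons.
by rewrite big_cons -IH; exact: (RintD P mD (bg i) (bs s)).
Qed.

Definition poisson_integral (r : R) (g : E -> R) : 'rV[R]_n -> R :=
  kernel_integral sigma r (poisson r) g.

Lemma poisson_integral_harmonic r g : 0 < r -> bmeas S g ->
  real_harmonic_on (ball r) (poisson_integral r g).
Proof.
move=> r0 bg; have [K1 [K2 [c1 c2 d1 d2 L]]] := @poisson_derivatives R n r.
have c0 := @offdiag_poisson R n r.
apply/(real_harmonic_onP _ (@open_eball R n r)).
exists (fun i => kernel_integral sigma r (K1 i) g),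
       (fun i j => kernel_integral sigma r (K2 i j) g) => x xr; split.
- exact: (kernel_integral_continuous hsigma r0 c0 bg xr).
- move=> i; split.
    exact: (kernel_integral_derive hsigma r0 c0 (c1 i) bg (d1 i) xr).
  exact: (kernel_integral_continuous hsigma r0 (c1 i) bg xr).
- move=> i j; split.
    exact: (kernel_integral_derive hsigma r0 (c1 i) (c2 i j) bg (d2 i j) xr).
  exact: (kernel_integral_continuous hsigma r0 (c2 i j) bg xr).
- have bK i := bmeasM (bmeas_kernel r0 (c2 i i) xr) bg.
  have /= <- := Rint_sum sigma (index_enum 'I_n) mS bK.
  have [s1 _ _] := hsigma.
  rewrite -[RHS](Rint_cst (P := sigma) 0 mS s1); apply: Rint_eq => z Sz.
  rewrite -mulr_suml L ?mul0r//.
    by apply: contraTneq xr => ->; rewrite /= enormZ Sz mulr1 gtr0_norm// ltxx.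
  by rewrite dotpZl dotpZr -sqr_enorm Sz expr1n mulr1 expr2.
Qed.

Hypothesis n0 : (0 < n)%N.

Let poisson_orth r (A : 'M[R]_n) (x w : 'rV[R]_n) : A *m A^T = 1%:M ->
  poisson r (x *m A) (w *m A) = poisson r x w.
Proof.
by move=> hA; rewrite /poisson /distpow /sqdist -mulmxBl !dotp_orth.
Qed.

Let mass r (x : 'rV[R]_n) := \int[sigma]_(z in S) poisson r x (r *: (z : 'rV[R]_n)).

Let massE r x : mass r x = poisson_integral r (fun=> 1) x.
Proof. by apply: Rint_eq => z _; rewrite mulr1. Qed.

Let mass_orth r (A : 'M[R]_n) x : 0 < r -> A *m A^T = 1%:M -> enorm x < r ->
  mass r (x *m A) = mass r x.
Proof.
move=> r0 hA xr; have [_ _ hs] := hsigma.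
have xAr : enorm (x *m A) < r by rewrite enorm_orth.
rewrite /mass -(invariant_Rint hs hA mS _ (bmeas_kernel r0 (@offdiag_poisson R n r) xAr)).
  by apply: Rint_eq => z _; rewrite scalemxAl poisson_orth.
by move=> z; rewrite /unit_sphere/= enorm_orth.
Qed.

(** By invariance the mass is constant on the sphere through [x] about 0. It is also harmonic, so
    the maximum principle for the mass and for its negative compares the value at the centre with
    that constant from both sides. *)
Lemma poisson_mass r x : 0 < r -> enorm x < r -> mass r x = mass r 0.
Proof.
move=> r0 xr.
have hm : real_harmonic_on (ball r) (mass r).
  rewrite (_ : mass r = poisson_integral r (fun=> 1)); last by apply/funext => y; exact: massE.
  by apply: poisson_integral_harmonic => //; exact: bmeas_cst.
have hm' : real_harmonic_on (ball (enorm x)) (mass r).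
  by apply: real_harmonic_on_sub hm => y /= yx; exact: lt_trans xr.
have cm y : enorm y <= enorm x -> {for y, continuous (mass r)}.
  by move=> yx; apply: (real_harmonic_continuous hm); rewrite /= (le_lt_trans yx).
have em y : enorm y = enorm x -> mass r y = mass r x.
  move=> yx; have [A hA <-] := orthogonal_transitive yx.
  by rewrite mass_orth// yx.
apply/eqP; rewrite eq_le; apply/andP; split.
  rewrite -lerN2.
  apply: (@maximum_principle _ _ (fun y => - mass r y) (enorm x) _ n0).
  - have := real_harmonicZ (-1) (@open_eball R n (enorm x)) hm'.
    by apply: real_harmonic_on_eq; [exact: open_eball|move=> y _; rewrite mulN1r].
  - by move=> y /cm c; exact: (@cvgN _ _ _ (nbhs y)).
  - by move=> y /em ->.
  - by rewrite enorm0 enorm_ge0.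
apply: (@maximum_principle _ _ (mass r) (enorm x) _ n0 hm' cm).
  by move=> y /em ->.
by rewrite enorm0 enorm_ge0.
Qed.

Lemma poisson_ge0 r (x w : 'rV[R]_n) : enorm x <= r -> 0 <= poisson r x w.
Proof.
move=> xr; rewrite mulr_ge0 ?powR_ge0// subr_ge0 -sqr_enorm.
by rewrite ler_pXn2r ?nnegrE ?enorm_ge0// (le_trans _ xr)// enorm_ge0.
Qed.

Lemma poisson_mass0 r : mass r 0 = r ^+ 2 * (r ^+ 2) `^ (- (n%:R / 2)).
Proof.
have [s1 _ _] := hsigma.
rewrite -[RHS](Rint_cst (P := sigma) _ mS s1); apply: Rint_eq => z Sz.
rewrite /poisson /distpow /sqdist dotp0l subr0 sub0r dotpNl dotpNr opprK.
by rewrite dotpZl dotpZr -sqr_enorm Sz expr1n mulr1 -expr2.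
Qed.

Lemma poisson_mass_gt0 r : 0 < r -> 0 < mass r 0.
Proof. by move=> r0; rewrite poisson_mass0 mulr_gt0 ?powR_gt0 ?exprn_gt0. Qed.

Lemma bmeas_dilate (u : 'rV[R]_n -> R) r : 0 < r -> r < 1 ->
  (forall x, unit_ball x -> {for x, continuous u}) ->
  bmeas S (fun z : E => u (r *: (z : 'rV[R]_n))).
Proof.
move=> r0 r1 cu.
have oU : open [set z : 'rV[R]_n | enorm z < r^-1] by exact: open_eball.
have cur (z : 'rV[R]_n) : enorm z < r^-1 -> {for z, continuous (fun z : 'rV[R]_n => u (r *: z))}.
  move=> zr; apply: (@continuous_comp _ _ _ (fun z : 'rV[R]_n => r *: z) u).
    exact: scaler_continuous.
  apply: cu; rewrite /unit_ball/= enormZ gtr0_norm//.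
  by rewrite -ltr_pdivlMl// mulr1.
have Sr (z : 'rV[R]_n) : unit_sphere z -> enorm z < r^-1.
  by move=> ->; rewrite invf_gt1.
split.
  apply: (@measurable_funS _ _ _ _ ([set z : 'rV[R]_n | enorm z < r^-1] : set E)).
  - exact: open_measurable.
  - by move=> z /Sr.
  - exact: (continuous_on_measurable oU).
have [M [_ hM]] : bounded_set [set u (r *: z) | z in [set z : 'rV[R]_n | enorm z = 1]].
  apply: compact_bounded; apply: continuous_compact; last exact: compact_esphere.
  by apply: continuous_in_subspaceT => z /set_mem Sz; apply: cur; exact: Sr.
exists (M + 1) => z Sz; apply: hM; first by rewrite ltrDl.
by exists z.
Qed.

(** The normalised Poisson integral [v] of the values of [u] is harmonic, and [v - u] is uniformly
    small near the sphere of radius [r]; the maximum principle carries the smallness inside. *)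
Lemma poisson_representation (u : 'rV[R]_n -> R) r : 0 < r -> r < 1 ->
  real_harmonic_on unit_ball u -> forall x, enorm x < r ->
  u x = (mass r 0)^-1 * poisson_integral r (fun z => u (r *: (z : 'rV[R]_n))) x.
Proof.
move=> r0 r1 hu; have [s1 _ _] := hsigma.
have cu y : unit_ball y -> {for y, continuous u} := real_harmonic_continuous hu.
have bg := bmeas_dilate r0 r1 cu; have m0 := poisson_mass_gt0 r0.
pose v y := (mass r 0)^-1 * poisson_integral r (fun z => u (r *: (z : 'rV[R]_n))) y.
have oB : open (ball r) by exact: open_eball.
have hv : real_harmonic_on (ball r) v.
  by apply: real_harmonicZ => //; exact: poisson_integral_harmonic.
have hur : real_harmonic_on (ball r) u.
  by apply: real_harmonic_on_sub hu => y /= yr; exact: lt_trans r1.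
(* Boundary points [w] near [y] are controlled by uniform continuity of [u], the others by the
   factor [r^2 - |y|^2] of the kernel. *)
have boundary e : 0 < e -> exists2 t : R, t < r &
    forall y, t <= enorm y -> enorm y < r -> `|v y - u y| <= e.
  move=> e0; have e2 : 0 < e / 2 by rewrite divr_gt0.
  have crB y : enorm y <= r -> {for y, continuous u}.
    by move=> yr; apply: cu; exact: (le_lt_trans yr r1).
  have [d d0 dP] := uniformly_continuous_near (@compact_eball R n r) crB e2.
  have [M [_ hM]] : bounded_set [set u y | y in [set y : 'rV[R]_n | enorm y <= r]].
    apply: compact_bounded; apply: continuous_compact; last exact: compact_eball.
    by apply: continuous_in_subspaceT => y /set_mem yr; apply: crB.
  pose N := `|M| + 1.
  have N0 : 0 < N by rewrite ltr_wpDl.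
  have uN y : enorm y <= r -> `|u y| <= N.
    move=> yr; apply: (hM N); last by exists y.
    by rewrite /N (le_lt_trans (ler_norm M))// ltrDl.
  (* For [|w - y| >= d] the kernel is at most [c (r^2 - |y|^2)], and [|u w - u y| <= 2 N]; [L]
     collects these constants and the normalisation. *)
  pose c := (d ^+ 2) `^ (- (n%:R / 2)).
  have c0 : 0 < c by rewrite powR_gt0// exprn_gt0.
  pose L := 2 * N * c / mass r 0.
  have L0 : 0 < L by rewrite !mulr_gt0// invr_gt0.
  (* With [t = r - q] one has [r^2 - t^2 <= 2 r q], so [q <= e / (4 L r)] suffices. *)
  have lim0 : exists2 t : R, t < r & 0 <= t /\ L * (r ^+ 2 - t ^+ 2) <= e / 2.
    have k0 : 0 < 2 * L * r by rewrite (mulr_gt0 _ r0)// (mulr_gt0 _ L0).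
    pose q := Num.min (r / 2) (e / 2 / (2 * L * r)).
    have q0 : 0 < q by rewrite lt_min !divr_gt0.
    have qr : q <= r / 2 by rewrite ge_min lexx.
    have qe : q * (2 * L * r) <= e / 2 by rewrite -ler_pdivlMr// ge_min lexx orbT.
    exists (r - q); first by rewrite ltrBlDr ltrDl.
    split; first by lra.
    have : L * q ^+ 2 >= 0 by rewrite mulr_ge0 ?sqr_ge0// ltW.
    by nra.
  have [t tr [t0 tL]] := lim0; exists t => // y ty yr.
  have bk := bmeas_kernel r0 (@offdiag_poisson R n r) yr.
  have bkg := bmeasM bk bg.
  have vuE : v y - u y = (mass r 0)^-1 *
      \int[sigma]_(z in S) (poisson r y (r *: (z : 'rV[R]_n)) * u (r *: (z : 'rV[R]_n))
         - u y * poisson r y (r *: (z : 'rV[R]_n))).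
    have /= -> := RintB sigma mS bkg (bmeasZ (u y) bk).
    have /= -> := RintZ sigma (u y) mS bk.
    rewrite -/(mass r y) poisson_mass// mulrBr; congr (_ - _).
    by rewrite mulrCA mulVf ?mulr1// gt_eqF.
  have bd : bmeas S (fun z : E => e / 2 * poisson r y (r *: (z : 'rV[R]_n)) + 2 * N * c * (r ^+ 2 - dotp y y)).
    by apply: bmeasD; [exact: (bmeasZ _ bk)|exact: bmeas_cst].
  have ubE : \int[sigma]_(z in S) (e / 2 * poisson r y (r *: (z : 'rV[R]_n)) + 2 * N * c * (r ^+ 2 - dotp y y)) =
      e / 2 * mass r 0 + 2 * N * c * (r ^+ 2 - dotp y y).
    have /= -> := RintD sigma mS (bmeasZ (e / 2) bk) (bmeas_cst S (2 * N * c * (r ^+ 2 - dotp y y))).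
    have /= -> := RintZ sigma (e / 2) mS bk.
    by rewrite -/(mass r y) poisson_mass// (Rint_cst (P := sigma) _ mS s1).
  have key : `|\int[sigma]_(z in S) (poisson r y (r *: (z : 'rV[R]_n)) * u (r *: (z : 'rV[R]_n))
         - u y * poisson r y (r *: (z : 'rV[R]_n)))| <= e / 2 * mass r 0 + 2 * N * c * (r ^+ 2 - dotp y y).
    rewrite -ubE; have bb := bmeasB bkg (bmeasZ (u y) bk).
    apply: le_trans (Rint_norm sigma mS bb) _.
    apply: (Rint_le sigma mS (bmeas_norm bb) bd) => z Sz.
    set w := r *: (z : 'rV[R]_n).
    have wr : enorm w <= r by rewrite /w enormZ Sz mulr1 gtr0_norm.
    have P0 : 0 <= poisson r y w by apply: poisson_ge0; exact: ltW.
    have Qy : 0 <= r ^+ 2 - dotp y y.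
      by rewrite subr_ge0 -sqr_enorm ler_pXn2r ?nnegrE ?enorm_ge0// ltW.
    rewrite [u y * _]mulrC -mulrBr normrM ger0_norm//.
    have [near|far] := ltP (enorm (w - y)) d.
      have h := dP y w (ltW yr) near.
      apply: (@le_trans _ _ (e / 2 * poisson r y w)).
        by rewrite mulrC ler_wpM2r.
      by rewrite lerDl mulr_ge0// mulr_ge0 ?mulr_ge0// ltW.
    have h : poisson r y w <= (r ^+ 2 - dotp y y) * c.
      rewrite ler_wpM2l// /distpow /c powRN powRN.
      rewrite lef_pV2 ?posrE ?powR_gt0 ?exprn_gt0//; last first.
        rewrite /sqdist -sqr_enorm enormB exprn_gt0//.
        exact: lt_le_trans far.
      rewrite ge0_ler_powR ?nnegrE ?divr_ge0 ?sqr_ge0 ?dotp_ge0//.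
      rewrite /sqdist -sqr_enorm enormB ler_pXn2r ?nnegrE ?enorm_ge0//.
      exact: ltW.
    have h2 : `|u w - u y| <= 2 * N.
      rewrite (le_trans (ler_normB _ _))// mulr_natl mulr2n lerD// uN//.
      exact: ltW.
    apply: (@le_trans _ _ ((r ^+ 2 - dotp y y) * c * (2 * N))).
      by rewrite ler_pM.
    rewrite (_ : _ * (2 * N) = 2 * N * c * (r ^+ 2 - dotp y y)); last by ring.
    by rewrite lerDr mulr_ge0// ltW.
  rewrite vuE normrM gtr0_norm ?invr_gt0// mulrC ler_pdivrMr//.
  apply: (le_trans key).
  have : L * (r ^+ 2 - dotp y y) <= e / 2.
    apply: le_trans tL; rewrite ler_wpM2l ?(ltW L0)// lerD2l lerN2 -sqr_enorm.
    by rewrite ler_pXn2r ?nnegrE ?enorm_ge0.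
  rewrite /L => h3.
  have : 2 * N * c * (r ^+ 2 - dotp y y) <= e / 2 * mass r 0.
    rewrite -ler_pdivrMr//; apply: le_trans h3.
    by rewrite le_eqVlt; apply/orP; left; apply/eqP; field; rewrite gt_eqF.
  lra.
move=> x xr; rewrite -/(v x).
have close e : 0 < e -> `|v x - u x| <= e.
  move=> e0; have [t tr tP] := boundary e e0.
  (* [v] is known to be continuous only inside the ball of radius [r]. The maximum principle is
     applied on a smaller ball, with [p] strictly between [max (t, |x|)] and [r]. *)
  pose q := Num.max t (enorm x); pose p := (q + r) / 2.
  have qr : q < r by rewrite gt_max tr.
  have pr : p < r by rewrite /p; lra.
  have tp : t <= p.
    have tq : t <= q by rewrite le_max lexx.
    by rewrite /p; lra.
  have xp : enorm x <= p.
    have xq : enorm x <= q by rewrite le_max lexx orbT.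
    by rewrite /p; lra.
  have sub : ball p `<=` ball r by move=> y /= yp; exact: lt_trans pr.
  have oP : open (ball p) by exact: open_eball.
  have hd := real_harmonicB oB hv hur.
  have hd' := real_harmonicB oB hur hv.
  have yr y : enorm y <= p -> enorm y < r by move=> yp; exact: le_lt_trans pr.
  rewrite ler_norml; apply/andP; split.
    rewrite -lerN2 opprK opprB.
    apply: (@maximum_principle _ _ (fun y => u y - v y) p e n0 (real_harmonic_on_sub sub hd')) => //.
      by move=> y /yr; exact: (real_harmonic_continuous hd').
    move=> y yp; rewrite (le_trans (ler_norm _))// distrC tP ?yp//.
  apply: (@maximum_principle _ _ (fun y => v y - u y) p e n0 (real_harmonic_on_sub sub hd)) => //.
    by move=> y /yr; exact: (real_harmonic_continuous hd).
  by move=> y yp; rewrite (le_trans (ler_norm _))// tP ?yp.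
apply/eqP; rewrite eq_sym -subr_eq0 -normr_eq0 eq_le normr_ge0 andbT.
by apply/ler_addgt0Pl => e e0; rewrite addr0; exact: close.
Qed.

End PoissonIntegral.

(** * Montel's theorem *)

Lemma extract_subsequence (P : nat -> nat -> Prop) :
  (forall j m, exists2 k, (m < k)%N & P j k) ->
  exists phi : nat -> nat, {homo phi : i j / (i < j)%N} /\ forall j, P j (phi j).
Proof.
move=> h; have [g hg] : exists g : nat -> nat -> nat, forall j m, (m < g j m)%N /\ P j (g j m).
  have h' (p : nat * nat) : exists k, (p.2 < k)%N /\ P p.1 k.
    by have [k] := h p.1 p.2; exists k.
  by have [g hg] := choice h'; exists (fun j m => g (j, m)) => j m; exact: hg (j, m).
pose phi := fix phi j := if j is j'.+1 then g j'.+1 (phi j') else g 0%N 0%N.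
exists phi; split; last first.
  by case=> [|j]; [have [] := hg 0%N 0%N|have [] := hg j.+1 (phi j)].
apply: homo_ltn; first exact: ltn_trans.
by move=> j; have [] := hg j.+1 (phi j).
Qed.

Section UltraLimits.
Context {R : realType}.

Lemma ultra_fmap (I T : Type) (f : I -> T) (U : set_system I) :
  UltraFilter U -> UltraFilter (f @ U).
Proof.
move=> UU; split; first exact: fmap_proper_filter.
move=> G GG UG; apply/seteqP; split => [A GA|]; last exact: UG.
have [//|h] := in_ultra_setVsetC (f @^-1` A) UU.
have GAC : G (~` A) by apply: UG.
have GI : G (A `&` ~` A) by exact: filterI.
by have [x []] := @filter_ex _ G GG _ GI.
Qed.

Lemma ultra_bounded_cvg (I : Type) (U : set_system I) (f : I -> R) (C : R) :
  UltraFilter U -> (forall i, `|f i| <= C) -> exists l : R, f @ U --> l.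
Proof.
move=> UU fC; have UF := ultra_fmap f UU.
have := @segment_compact R (- C) C; rewrite compact_ultra.
move=> /(_ (f @ U) UF)[|l [_ fl]]; last by exists l.
by apply: nearW => i /=; rewrite in_itv/= -ler_norml.
Qed.

End UltraLimits.

Section Montel.
Context {R : realType} {n : nat}.
Local Notation E := (borel_space R n).
Variable sigma : probability E R.
Hypothesis hsigma : invariant_probability_on sigma unit_sphere.
Hypothesis n0 : (0 < n)%N.
Local Notation S := (unit_sphere : set E).

Let mS := @measurable_sphere R n.

Definition locally_uniformly_bounded (u : nat -> 'rV[R]_n -> R) :=
  forall t : R, t < 1 -> exists C : R, forall k x, enorm x <= t -> `|u k x| <= C.

Definition cvg_locally_uniformly (u : nat -> 'rV[R]_n -> R) (v : 'rV[R]_n -> R) :=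
  forall t e : R, t < 1 -> 0 < e ->
    exists K : nat, forall k x, (K <= k)%N -> enorm x <= t -> `|u k x - v x| <= e.

(** All [u k] are Poisson integrals over one sphere, of radius halfway between [|x0|] and 1, with
    data bounded by a common [C]; the variation in [x] is carried by the kernel alone. *)
Lemma equicontinuous_harmonic (u : nat -> 'rV[R]_n -> R) (x0 : 'rV[R]_n) (e : R) :
  (forall k, real_harmonic_on unit_ball (u k)) -> locally_uniformly_bounded u ->
  unit_ball x0 -> 0 < e ->
  \forall x \near x0, forall k, `|u k x - u k x0| <= e.
Proof.
move=> hu bu Bx0 e0; pose r := (1 + enorm x0) / 2.
have r1 : r < 1 by rewrite /r; move: Bx0; rewrite /unit_ball/=; lra.
have x0r : enorm x0 < r by rewrite /r; move: Bx0; rewrite /unit_ball/=; lra.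
have r0 : 0 < r by rewrite (le_lt_trans (enorm_ge0 x0)).
have [C hC] := bu r r1; have [s1 _ _] := hsigma.
set m := \int[sigma]_(z in S) poisson r 0 (r *: (z : 'rV[R]_n)).
have m0 : 0 < m by exact: (poisson_mass_gt0 hsigma).
have C0 : 0 < `|C| + 1 by rewrite ltr_wpDl.
have d0 : 0 < e * m / (`|C| + 1) by rewrite divr_gt0// mulr_gt0.
have nr : \forall x \near x0, enorm x < r.
  by apply: open_nbhs_nbhs; split => //; exact: open_eball.
apply: filterS2 nr (kernel_near r0 (@offdiag_poisson R n r) x0r d0) => x xr h k.
have cu y : unit_ball y -> {for y, continuous (u k)} := real_harmonic_continuous (hu k).
have bg := bmeas_dilate r0 r1 cu.
have b0 := bmeasM (bmeas_kernel r0 (@offdiag_poisson R n r) x0r) bg.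
have b1 := bmeasM (bmeas_kernel r0 (@offdiag_poisson R n r) xr) bg.
rewrite (poisson_representation hsigma n0 r0 r1 (hu k) xr).
rewrite (poisson_representation hsigma n0 r0 r1 (hu k) x0r) -/m -mulrBr.
have /= <- := RintB sigma mS b1 b0.
rewrite normrM gtr0_norm ?invr_gt0// ler_pdivrMl// mulrC.
apply: (Rint_norm_le mS s1 (bmeasB b1 b0)) => z Sz /=.
rewrite -mulrBl normrM.
apply: (@le_trans _ _ (e * m / (`|C| + 1) * (`|C| + 1))).
  apply: ler_pM => //; first exact: h.
  apply: (@le_trans _ _ C); last by rewrite (le_trans (ler_norm _))// lerDl ler01.
  by apply: hC; rewrite enormZ Sz mulr1 gtr0_norm.
by rewrite divfK// gt_eqF.
Qed.

(* Limits along an ultrafilter exist at every point of the ball, and equicontinuity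
   makes them locally uniform; only then is a subsequence extracted. *)
Theorem montel (u : nat -> 'rV[R]_n -> R) :
  (forall k, real_harmonic_on unit_ball (u k)) -> locally_uniformly_bounded u ->
  exists phi : nat -> nat, {homo phi : i j / (i < j)%N} /\
    exists2 v, real_harmonic_on unit_ball v &
      cvg_locally_uniformly (fun k => u (phi k)) v.
Proof.
move=> hu bu.
have [U [UU ooU]] := ultraFilterLemma (F := \oo : set_system nat) _.
have UF : Filter U by exact: ultra_proper.
have hx (x : 'rV[R]_n) : exists l : R, unit_ball x -> u k x @[k --> U] --> l.
  have [Bx|nBx] := pselect (unit_ball x); last by exists 0.
  have [C hC] := bu _ Bx.
  have [l hl] := ultra_bounded_cvg UU (fun k => hC k x (lexx _)).
  by exists l.
have [v hv] := choice hx.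
have vlim x (c d : R) : unit_ball x -> (\forall k \near U, `|u k x - c| <= d) -> `|v x - c| <= d.
  move=> Bx h; apply/ler_addgt0Pr => e e0.
  have /cvgrPdist_le/(_ _ e0) he := hv x Bx.
  have [k [h1 h2]] := filter_ex (filterI h he).
  rewrite (_ : v x - c = (u k x - c) + (v x - u k x)); last by ring.
  by rewrite (le_trans (ler_normD _ _))// lerD.
have equi x0 e : unit_ball x0 -> 0 < e ->
    \forall x \near x0, unit_ball x /\ (forall k, `|u k x - u k x0| <= e) /\ `|v x - v x0| <= e.
  move=> Bx0 e0; have e2 : 0 < e / 2 by rewrite divr_gt0.
  have nB : \forall x \near x0, unit_ball x.
    by apply: open_nbhs_nbhs; split => //; exact: open_eball.
  apply: filterS2 nB (equicontinuous_harmonic hu bu Bx0 e2) => x Bx h.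
  split => //; split => [k|]; first by rewrite (le_trans (h k))// ler_pdivrMr// ler_pMr// ler1n.
  apply: vlim => //; have /cvgrPdist_le/(_ _ e2) := hv x0 Bx0.
  apply: filterS => k h2.
  rewrite (_ : _ - v x0 = (u k x - u k x0) - (v x0 - u k x0)); last by ring.
  by rewrite (le_trans (ler_normB _ _))// [leRHS]splitr lerD.
have cv x : unit_ball x -> {for x, continuous v}.
  move=> Bx; apply/(@cvgrPdist_le _ _ _ (nbhs x)) => e e0.
  by apply: filterS (equi x e Bx e0) => y [_ [_]]; rewrite distrC.
have unif t e : t < 1 -> 0 < e ->
    \forall k \near U, forall x, enorm x <= t -> `|u k x - v x| <= e.
  move=> t1 e0; have e3 : 0 < e / 3 by rewrite divr_gt0.
  have := @compact_eball R n t => /compact_near_coveringP.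
  move=> /(_ _ U (fun k x => `|u k x - v x| <= e) UF); apply => x0 /= x0t.
  have Bx0 : unit_ball x0 by exact: le_lt_trans t1.
  have /cvgrPdist_le/(_ _ e3) h2 := hv x0 Bx0.
  exists ([set x | unit_ball x /\ (forall k, `|u k x - u k x0| <= e / 3) /\ `|v x - v x0| <= e / 3],
          [set k | `|v x0 - u k x0| <= e / 3]) => /=.
    by split => //; exact: equi.
  move=> [x k] /= [[_ [h3 h4]] h5].
  rewrite (_ : u k x - v x = (u k x - u k x0) - ((v x0 - u k x0) + (v x - v x0))); last by ring.
  have := ler_normB (u k x - u k x0) ((v x0 - u k x0) + (v x - v x0)).
  have := ler_normD (v x0 - u k x0) (v x - v x0).
  have := h3 k; lra.
(* The radius tends to 1 and the tolerance to 0 together, so that one diagonal subsequence serves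
   every smaller ball. *)
have hex (j m : nat) : exists2 k, (m < k)%N &
    forall x : 'rV[R]_n, enorm x <= 1 - j.+2%:R^-1 -> `|u k x - v x| <= j.+1%:R^-1.
  have t1 : 1 - j.+2%:R^-1 < 1 :> R by rewrite ltrBlDr ltrDl.
  have j0 : 0 < j.+1%:R^-1 :> R by [].
  have hm : U [set k | (m < k)%N] by apply: ooU; exact: nbhs_infty_gt.
  have [k [mk hk]] := filter_ex (filterI hm (unif _ _ t1 j0)).
  by exists k.
have [phi [phi_inc hphi]] := extract_subsequence hex.
exists phi; split => //; exists v; last first.
  move=> t e t1 e0.
  have t10 : 0 < 1 - t by rewrite subr_gt0.
  have [K1 _ hK1] := near_infty_natSinv_lt (PosNum t10).
  have [K2 _ hK2] := near_infty_natSinv_lt (PosNum e0).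
  exists (maxn K1 K2) => k x; rewrite geq_max => /andP[k1 k2] xt.
  apply: le_trans (hphi k x _) _; last exact: ltW (hK2 k k2).
  apply: (le_trans xt); rewrite lerBrDr -lerBrDl.
  exact: ltW (hK1 k.+1 (leqW k1)).
(* The Poisson formula for [u k] passes to the limit: around [x], [v] is the normalised Poisson
   integral of its own values on a sphere of radius between [|x|] and 1. *)
apply: real_harmonic_on_local => x Bx; pose r := (1 + enorm x) / 2.
have r1 : r < 1 by rewrite /r; move: Bx; rewrite /unit_ball/=; lra.
have xr : enorm x < r by rewrite /r; move: Bx; rewrite /unit_ball/=; lra.
have r0 : 0 < r by rewrite (le_lt_trans (enorm_ge0 x)).
have oU : open [set y : 'rV[R]_n | enorm y < r] by exact: open_eball.
exists [set y : 'rV[R]_n | enorm y < r] => //; split => //.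
have bg := bmeas_dilate r0 r1 cv; have [s1 _ _] := hsigma.
have hP := real_harmonicZ (\int[sigma]_(z in S) poisson r 0 (r *: (z : 'rV[R]_n)))^-1 oU
  (poisson_integral_harmonic hsigma r0 bg).
apply: real_harmonic_on_eq oU _ hP => y /= yr.
set m := \int[sigma]_(z in S) poisson r 0 (r *: (z : 'rV[R]_n)).
have m0 : 0 < m by exact: (poisson_mass_gt0 hsigma).
apply/eqP; rewrite eq_sym -subr_eq0 -normr_eq0 eq_le normr_ge0 andbT.
apply/ler_addgt0Pl => e e0; rewrite addr0.
have By : unit_ball y by exact: lt_trans r1.
apply: vlim => //.
apply: filterS (unif r e r1 e0) => k hk.
rewrite (poisson_representation hsigma n0 r0 r1 (hu k) yr) -/m -mulrBr.
have bk := bmeas_dilate r0 r1 (fun x => @real_harmonic_continuous _ _ _ _ x (hu k)).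
have bK := bmeas_kernel r0 (@offdiag_poisson R n r) yr.
have /= <- := RintB sigma mS (bmeasM bK bk) (bmeasM bK bg).
rewrite normrM gtr0_norm ?invr_gt0// ler_pdivrMl// mulrC.
have bb := bmeasB (bmeasM bK bk) (bmeasM bK bg).
apply: (le_trans (Rint_norm sigma mS bb)).
have me : m = \int[sigma]_(z in S) poisson r y (r *: (z : 'rV[R]_n)).
  by rewrite (poisson_mass hsigma n0 r0 yr).
rewrite me; have /= <- := RintZ sigma e mS bK.
apply: (Rint_le sigma mS (bmeas_norm bb) (bmeasZ e bK)) => z Sz /=.
have P0 : 0 <= poisson r y (r *: (z : 'rV[R]_n)) by apply: poisson_ge0; exact: ltW.
rewrite -mulrBr normrM (ger0_norm P0) [e * _]mulrC; apply: (ler_wpM2l P0).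
by apply: hk; rewrite enormZ Sz mulr1 gtr0_norm.
Qed.

End Montel.

(** * The harmonic Bergman space *)

Section SquareIntegrable.
Context d (T : measurableType d) (R : realType).
Variables (P : probability T R) (D : set T).
Hypothesis mD : measurable D.
Implicit Types g h : T -> R.

(** Real-valued functions: complex ones are split into [re] and [im], and the Hilbert space
    arguments are carried out over the reals. *)
Definition sqint g := measurable_fun D g /\
  (\int[P]_(x in D) (g x * g x)%:E < +oo)%E.

Definition ip g h := \int[P]_(x in D) (g x * h x).

Let sqr_ge0E g x : (0 <= (g x * g x)%:E)%E.
Proof. by rewrite lee_fin -expr2 sqr_ge0. Qed.

Let msqr g h : measurable_fun D g -> measurable_fun D h ->
  measurable_fun D (fun x => (g x * h x)%:E).
Proof. by move=> mg mh; apply/measurable_EFinP; exact: measurable_funM. Qed.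

Lemma sqint_integrable g : sqint g -> P.-integrable D (EFin \o (fun x => g x * g x)).
Proof.
move=> [mg ig]; apply/integrableP; split; first exact: msqr.
apply: le_lt_trans ig; rewrite le_eqVlt; apply/orP; left; apply/eqP.
by apply: eq_integral => x _ /=; rewrite ger0_norm// -expr2 sqr_ge0.
Qed.

Lemma sqint_integrableM g h : sqint g -> sqint h ->
  P.-integrable D (EFin \o (fun x => g x * h x)).
Proof.
move=> sg sh; have ig := sqint_integrable sg; have ih := sqint_integrable sh.
apply: (@le_integrable _ _ _ P D mD _ (EFin \o (fun x => g x * g x + h x * h x))).
- by case: sg => mg _; case: sh => mh _; exact: msqr.
- move=> x _ /=; rewrite lee_fin normrM [leRHS]ger0_norm; last first.
    by rewrite addr_ge0// -expr2 sqr_ge0.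
  have := sqr_ge0 (`|g x| - `|h x|).
  have e1 : `|g x| * `|g x| = g x * g x by rewrite -normrM ger0_norm// -expr2 sqr_ge0.
  have e2 : `|h x| * `|h x| = h x * h x by rewrite -normrM ger0_norm// -expr2 sqr_ge0.
  by have := normr_ge0 (g x); have := normr_ge0 (h x); nra.
- by have := integrableD mD ig ih; apply: eq_integrable.
Qed.

Lemma integrable_sqint g : measurable_fun D g ->
  P.-integrable D (EFin \o (fun x => g x * g x)) -> sqint g.
Proof.
move=> mg /integrableP[_ ig]; split => //; apply: le_lt_trans ig.
rewrite le_eqVlt; apply/orP; left; apply/eqP.
by apply: eq_integral => x _ /=; rewrite ger0_norm// -expr2 sqr_ge0.
Qed.

Lemma ipC g h : ip g h = ip h g.
Proof. by apply: Rint_eq => x _; rewrite mulrC. Qed.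

Lemma ip_ge0 g : 0 <= ip g g.
Proof. by apply: Rintegral_ge0 => x _; rewrite -expr2 sqr_ge0. Qed.

Lemma sqintD g h : sqint g -> sqint h -> sqint (fun x => g x + h x).
Proof.
move=> sg sh; have igh := sqint_integrableM sg sh.
have ig := sqint_integrable sg; have ih := sqint_integrable sh.
have [mg _] := sg; have [mh _] := sh.
apply: integrable_sqint; first exact: measurable_funD.
have i2 := integrableD mD (integrableD mD ig ih) (integrableD mD igh igh).
apply: eq_integrable i2 => // x _ /=; congr EFin; ring.
Qed.

Lemma sqintZ (c : R) g : sqint g -> sqint (fun x => c * g x).
Proof.
move=> sg; have [mg _] := sg.
apply: integrable_sqint; first by apply: measurable_funM => //; exact: measurable_cst.
have := integrableZl mD (c * c) (sqint_integrable sg).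
by apply: eq_integrable => // x _ /=; congr EFin; ring.
Qed.

Lemma sqintB g h : sqint g -> sqint h -> sqint (fun x => g x - h x).
Proof.
move=> sg /(sqintZ (-1)) sh; have := sqintD sg sh.
by under eq_fun do rewrite mulN1r.
Qed.

Lemma sqint_bmeas g : bmeas D g -> sqint g.
Proof.
move=> bg; apply: integrable_sqint; first by case: bg.
by apply: bmeas_integrable => //; exact: bmeasM.
Qed.

Lemma sqintM_bmeas g h : bmeas D g -> sqint h -> sqint (fun x => g x * h x).
Proof.
move=> [mg [M gM]] sh; have [mh _] := sh.
apply: integrable_sqint; first exact: measurable_funM.
have i2 := integrableZl mD (M ^+ 2) (sqint_integrable sh).
apply: le_integrable i2 => //.
  by apply/measurable_EFinP; apply: measurable_funM; exact: measurable_funM.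
move=> x Dx /=; rewrite lee_fin !ger0_norm; last 2 first.
- by rewrite mulr_ge0 ?sqr_ge0// -expr2 sqr_ge0.
- by rewrite -expr2 sqr_ge0.
rewrite (_ : g x * h x * (g x * h x) = g x ^+ 2 * (h x * h x)); last by ring.
rewrite ler_wpM2r//; first by rewrite -expr2 sqr_ge0.
by rewrite -(ger0_norm (sqr_ge0 _)) normrX ler_pXn2r ?nnegrE// ?gM// (le_trans _ (gM _ Dx)).
Qed.

Lemma ipDl g h k : sqint g -> sqint h -> sqint k ->
  ip (fun x => g x + h x) k = ip g k + ip h k.
Proof.
move=> sg sh sk; rewrite /ip.
under eq_Rintegral => x _ do rewrite mulrDl.
exact: (RintegralD mD (sqint_integrableM sg sk) (sqint_integrableM sh sk)).
Qed.

Lemma ipZl (c : R) g k : sqint g -> sqint k -> ip (fun x => c * g x) k = c * ip g k.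
Proof.
move=> sg sk; rewrite /ip.
under eq_Rintegral => x _ do rewrite -mulrA.
exact: (RintegralZl _ mD (sqint_integrableM sg sk)).
Qed.

Lemma ipBl g h k : sqint g -> sqint h -> sqint k ->
  ip (fun x => g x - h x) k = ip g k - ip h k.
Proof.
move=> sg sh sk; rewrite /ip.
under eq_Rintegral => x _ do rewrite mulrBl.
exact: (RintegralB mD (sqint_integrableM sg sk) (sqint_integrableM sh sk)).
Qed.

Lemma ipDr g h k : sqint g -> sqint h -> sqint k ->
  ip k (fun x => g x + h x) = ip k g + ip k h.
Proof. by move=> sg sh sk; rewrite ipC ipDl// !(ipC k). Qed.

Lemma ipBr g h k : sqint g -> sqint h -> sqint k ->
  ip k (fun x => g x - h x) = ip k g - ip k h.
Proof. by move=> sg sh sk; rewrite ipC ipBl// !(ipC k). Qed.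

Lemma ip_sqrB g h : sqint g -> sqint h ->
  ip (fun x => g x - h x) (fun x => g x - h x) = ip g g - 2 * ip g h + ip h h.
Proof.
move=> sg sh; rewrite ipBl//; last exact: sqintB.
by rewrite !ipBr// (ipC h g); ring.
Qed.

Lemma ip_sqrB_le g h : sqint g -> sqint h ->
  ip (fun x => g x - h x) (fun x => g x - h x) <= 2 * (ip g g + ip h h).
Proof.
move=> sg sh; have := ip_ge0 (fun x => g x + h x).
rewrite ip_sqrB// ipDl//; last exact: sqintD.
by rewrite !ipDr// (ipC h g); lra.
Qed.

Lemma ip_le g h : sqint g -> sqint h -> 2 * ip g h <= ip g g + ip h h.
Proof. by move=> sg sh; have := ip_ge0 (fun x => g x - h x); rewrite ip_sqrB//; lra. Qed.

(* The parameter [t] replaces the square root in the Cauchy-Schwarz inequality. *)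
Lemma ip_young (t : R) g h : 0 < t -> sqint g -> sqint h ->
  2 * `|ip g h| <= t * ip g g + t^-1 * ip h h.
Proof.
move=> t0 sg sh; have t_neq0 : t != 0 by rewrite gt_eqF.
have s1 := ip_ge0 (fun x => t * g x - h x); have s2 := ip_ge0 (fun x => t * g x + h x).
have sZ := sqintZ t sg.
rewrite ip_sqrB// ipZl// ipC ipZl// ipZl// in s1.
have eD : ip (fun x => t * g x + h x) (fun x => t * g x + h x) =
    t * (t * ip g g) + 2 * (t * ip g h) + ip h h.
  rewrite ipDl//; last exact: sqintD.
  by rewrite !ipDr// ipZl// ipC ipZl// (ipC h) ipZl//; ring.
rewrite eD in s2.
have -> : t * ip g g + t^-1 * ip h h = t^-1 * (t * (t * ip g g) + ip h h) by field.
rewrite -ler_pdivrMl ?invr_gt0// invrK.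
by rewrite mulrCA -(gtr0_norm t0) -normrM (gtr0_norm t0); case: ler0P; lra.
Qed.

(** Fatou's lemma for the squares. It keeps limits of norm-bounded sequences in the space with the
    same bound, given only pointwise convergence on [D]. *)
Lemma fatou_sqint (g : nat -> T -> R) (h : T -> R) (M : R) :
  (forall k, sqint (g k)) -> (forall k, ip (g k) (g k) <= M) ->
  (forall x, D x -> g k x @[k --> \oo] --> h x) -> sqint h /\ ip h h <= M.
Proof.
move=> sg gM gh.
have mh : measurable_fun D h.
  apply: (@measurable_fun_cvg _ _ _ D g); last exact: gh.
  by move=> k; case: (sg k).
have gEM k : (\int[P]_(x in D) (g k x * g k x)%:E <= M%:E)%E.
  have := gM k; rewrite /ip -lee_fin /Rintegral fineK//.
  exact: (integrable_fin_num mD (sqint_integrable (sg k))).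
have hM : (\int[P]_(x in D) (h x * h x)%:E <= M%:E)%E.
  apply: (@le_trans _ _ (\int[P]_(x in D) limn_einf (fun k => (g k x * g k x)%:E))%E).
    rewrite le_eqVlt; apply/orP; left; apply/eqP; apply: eq_integral => x /set_mem Dx.
    apply/esym; have c : ((g k x * g k x)%:E @[k --> \oo] --> (h x * h x)%:E)%E.
      by apply: cvg_EFin; [exact: nearW|apply: cvgM; exact: gh].
    by have [-> _] := cvg_limn_einf_sup c.
  apply: le_trans (fatou P mD _ _) _ => //.
  - by move=> k; case: (sg k) => mgk _; exact: msqr.
  - rewrite limn_einf_lim; apply: lime_le; first exact: is_cvg_einfs.
    apply: nearW => k; apply: le_trans (gEM k).
    by apply: ereal_inf_lbound; exists k => /=.
have sh : sqint h by split => //; exact: le_lt_trans hM (ltry _).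
split => //; rewrite -lee_fin /ip /Rintegral fineK//.
exact: (integrable_fin_num mD (sqint_integrable sh)).
Qed.

End SquareIntegrable.

(** * Bounds for point evaluations *)

Section RealBergman.
Context {R : realType} {n : nat}.
Local Notation E := (borel_space R n).
Variables sigma nu : probability E R.
Hypothesis hsigma : invariant_probability_on sigma unit_sphere.
Hypothesis hnu : invariant_probability_on nu unit_ball.
Hypothesis hnu_bdry : forall r : R, 0 < r -> r < 1 ->
  (0 < nu [set x | unit_ball x /\ (r <= enorm x)%R])%E.
Hypothesis n0 : (0 < n)%N.
Local Notation S := (unit_sphere : set E).
Local Notation B := (unit_ball : set E).

Let mS := @measurable_sphere R n.
Let mB := @measurable_ball R n.

(** The variance of [g] is nonnegative. *)
Lemma Rint_sqr_le d (T : measurableType d) (P : probability T R) (D : set T) (g : T -> R) :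
  measurable D -> P D = 1%E -> bmeas D g ->
  (\int[P]_(x in D) g x) ^+ 2 <= \int[P]_(x in D) (g x * g x).
Proof.
move=> mD PD bg; set m := Rintegral _ _ _.
have sg := sqint_bmeas P mD bg; have sm := sqint_bmeas P mD (bmeas_cst D m).
have := ip_ge0 P D (fun x => g x - m); rewrite (ip_sqrB mD sg sm).
have e1 : ip P D g (fun=> m) = m * m.
  rewrite ipC /ip; have /= -> := RintZ P m mD bg.
  by rewrite -/m.
have e2 : ip P D (fun=> m) (fun=> m) = m * m by rewrite /ip Rint_cst.
by rewrite e1 e2 -/(ip P D g g); lra.
Qed.

Lemma measurable_annulus (s : R) :
  measurable ([set x | unit_ball x /\ (s <= enorm x)%R] : set E).
Proof.
have -> : ([set x | unit_ball x /\ (s <= enorm x)%R] : set E) =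
    B `&` ~` [set x : 'rV[R]_n | enorm x < s].
  apply/seteqP; split => x [Bx] /=; first by move=> sx; split => //=; apply/negP; rewrite -leNgt.
  by move=> /negP; rewrite -leNgt.
by apply: measurableI => //; apply: measurableC; apply: open_measurable; exact: open_eball.
Qed.

(** For each [y] with [|y| >= s], the Poisson formula on the sphere of radius [|y|] and the
    inequality for the square of a mean bound [u x ^ 2] by a multiple of the mean of [u^2] over that
    sphere. Integrated over these [y], the means add up to at most the integral of [u^2] by the
    polar decomposition, while the left side gains the positive measure [dl] of the annulus. *)
Lemma point_evaluation (t : R) : t < 1 -> exists2 C : R, 0 <= C &
  forall u, real_harmonic_on unit_ball u -> sqint nu B u ->
  forall x : 'rV[R]_n, enorm x <= t -> u x ^+ 2 <= C * ip nu B u u.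
Proof.
move=> t1; pose t' := Num.max t 0.
have t'1 : t' < 1 by rewrite gt_max t1 ltr01.
have t'0 : 0 <= t' by rewrite le_max lexx orbT.
have tt' : t <= t' by rewrite le_max lexx.
pose s := (1 + t') / 2.
have s1 : s < 1 by rewrite /s; lra.
have s0 : 0 < s by rewrite /s; lra.
have st : 0 < s - t' by rewrite /s; lra.
(* For [|x| <= t'] and [|w| = |y| >= s] the kernel is at most [(s - t')^(-n)] and its mass is at
   least [s^2]. *)
pose c := ((s - t') ^+ 2) `^ (- (n%:R / 2)) / s ^+ 2.
have c0 : 0 < c by rewrite divr_gt0 ?powR_gt0 ?exprn_gt0.
pose D : set E := [set y | unit_ball y /\ (s <= enorm y)%R].
have mD : measurable D by exact: measurable_annulus.
pose dl := fine (nu D).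
have nuD : nu D = dl%:E by rewrite /dl fineK// fin_num_measure.
have dl0 : 0 < dl by rewrite -lte_fin -nuD; exact: hnu_bdry.
exists (c ^+ 2 / dl); first by rewrite divr_ge0 ?sqr_ge0// ltW.
move=> u hu su x xt; have [sg1 _ _] := hsigma.
have cu y : unit_ball y -> {for y, continuous u} := fun By => real_harmonic_continuous hu By.
have key (y : 'rV[R]_n) : D y ->
    u x ^+ 2 <= c ^+ 2 * \int[sigma]_(z in S) (u (polar (y, z)) * u (polar (y, z))).
  move=> [By sy]; have y0 : 0 < enorm y by exact: lt_le_trans sy.
  have xy : enorm x < enorm y by rewrite (le_lt_trans (le_trans xt tt'))// (lt_le_trans _ sy)//; lra.
  have bg := bmeas_dilate y0 By cu.
  have bK := bmeas_kernel y0 (@offdiag_poisson R n (enorm y)) xy.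
  set m := \int[sigma]_(z in S) poisson (enorm y) 0 (enorm y *: (z : 'rV[R]_n)).
  have m0 : 0 < m by exact: (poisson_mass_gt0 hsigma).
  rewrite (poisson_representation hsigma n0 y0 By hu xy) -/m.
  have bKg := bmeasZ m^-1 (bmeasM bK bg).
  have /= <- := RintZ sigma m^-1 mS (bmeasM bK bg).
  apply: (le_trans (Rint_sqr_le mS sg1 bKg)).
  have /= <- := RintZ sigma (c ^+ 2) mS (bmeasM bg bg).
  apply: (Rint_le sigma mS (bmeasM bKg bKg) (bmeasZ _ (bmeasM bg bg))) => z Sz /=.
  set w := enorm y *: (z : 'rV[R]_n).
  have P0 : 0 <= poisson (enorm y) x w by apply: poisson_ge0; exact: ltW.
  have wE : enorm w = enorm y by rewrite /w enormZ Sz mulr1 gtr0_norm.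
  have Kc : m^-1 * poisson (enorm y) x w <= c.
    have mE : m = enorm y ^+ 2 * (enorm y ^+ 2) `^ (- (n%:R / 2)) := poisson_mass0 hsigma (enorm y).
    have y1 : 1 <= (enorm y ^+ 2) `^ (- (n%:R / 2)).
      rewrite powRN invf_ge1 ?powR_gt0 ?exprn_gt0//.
      have h : (enorm y ^+ 2) `^ (n%:R / 2) <= 1 `^ (n%:R / 2).
        rewrite ge0_ler_powR ?nnegrE ?divr_ge0 ?sqr_ge0//.
        by rewrite exprn_ile1 ?enorm_ge0// ltW.
      by move: h; rewrite powR1.
    have sm : s ^+ 2 <= m.
      rewrite mE (le_trans (_ : _ <= enorm y ^+ 2))//.
        by rewrite ler_pXn2r ?nnegrE ?enorm_ge0// ltW.
      by rewrite ler_peMr// sqr_ge0.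
    have Pc : poisson (enorm y) x w <= ((s - t') ^+ 2) `^ (- (n%:R / 2)).
      rewrite /poisson -[leRHS]mul1r ler_pM ?powR_ge0//.
      - by rewrite subr_ge0 -sqr_enorm ler_pXn2r ?nnegrE ?enorm_ge0// ltW.
      - rewrite lerBlDr ler_wpDr ?dotp_ge0// exprn_ile1 ?enorm_ge0//; exact: ltW.
      - rewrite /distpow !powRN.
        have xw : s - t' <= enorm (x - w).
          rewrite enormB (le_trans _ (enormB_ge _ _))// wE lerB//; exact: le_trans tt'.
        have xw0 := lt_le_trans st xw.
        rewrite lef_pV2 ?posrE ?powR_gt0 ?exprn_gt0//; last by rewrite /sqdist -sqr_enorm exprn_gt0.
        rewrite ge0_ler_powR ?nnegrE ?divr_ge0 ?sqr_ge0 ?dotp_ge0//.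
        rewrite /sqdist -sqr_enorm ler_pXn2r ?nnegrE ?enorm_ge0//; exact: ltW.
    rewrite mulrC /c ler_pM ?invr_ge0 ?(ltW m0)//.
    by rewrite lef_pV2 ?posrE ?exprn_gt0.
  have q0 : 0 <= m^-1 * poisson (enorm y) x w by rewrite mulr_ge0// invr_ge0 ltW.
  have u2 : 0 <= u w * u w by rewrite -expr2 sqr_ge0.
  rewrite (_ : _ * _ = (m^-1 * poisson (enorm y) x w) ^+ 2 * (u w * u w)); last by ring.
  by rewrite ler_wpM2r// ler_pXn2r ?nnegrE// ltW.
have [mu_ _] := su.
have mu2 : measurable_fun B (fun y : E => (u y * u y)%:E) by apply/measurable_EFinP; exact: measurable_funM.
have u20 (y : E) : B y -> (0 <= (u y * u y)%:E)%E by rewrite lee_fin -expr2 sqr_ge0.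
have E1 : ((u x ^+ 2 * dl)%:E <= (c ^+ 2 * ip nu B u u)%:E)%E.
  have -> : ((c ^+ 2 * ip nu B u u)%:E = \int[nu]_(y in B) ((c ^+ 2)%:E * \int[sigma]_(z in S) (u (polar (y, z)) * u (polar (y, z)))%:E))%E.
    rewrite ge0_integralZl//; last 3 first.
    - exact: (polar_measurable hsigma mu2 u20).
    - by move=> y _; apply: integral_ge0 => z _; rewrite lee_fin -expr2 sqr_ge0.
    - by rewrite lee_fin sqr_ge0.
    rewrite -(polar_integral hsigma hnu mu2 u20) EFinM /ip /Rintegral fineK//.
    exact: (integrable_fin_num mB (sqint_integrable su)).
  apply: (@le_trans _ _ (\int[nu]_(y in B) (u x ^+ 2 * \1_D y)%:E)%E).
    rewrite le_eqVlt; apply/orP; left; apply/eqP.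
    have -> : (\int[nu]_(y in B) (u x ^+ 2 * \1_D y)%:E = (u x ^+ 2)%:E * \int[nu]_(y in B) (\1_D y)%:E)%E.
      rewrite -ge0_integralZl//.
      + by apply/measurable_EFinP; exact: measurable_indic.
      + by rewrite lee_fin sqr_ge0.
    rewrite integral_indic// EFinM -nuD; congr (_ * nu _)%E.
    by apply/seteqP; split => [y [By sy]|y []].
  apply: ge0_le_integral => //.
  - by move=> y _; rewrite lee_fin mulr_ge0 ?sqr_ge0.
  - by apply/measurable_EFinP; apply: measurable_funM => //; exact: measurable_indic.
  - by apply: emeasurable_funM => //; exact: (polar_measurable hsigma mu2 u20).
  move=> y By; rewrite indicE; case: (boolP (y \in D)) => [/set_mem Dy|_]; last first.
    rewrite mulr0; apply: mule_ge0; first by rewrite lee_fin sqr_ge0.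
    by apply: integral_ge0 => z _; rewrite lee_fin -expr2 sqr_ge0.
  rewrite mulr1; have [_ sy] := Dy; have y0 : 0 < enorm y by exact: lt_le_trans sy.
  have bg := bmeas_dilate y0 By cu.
  have /= <- := EFin_Rint sigma mS (bmeasM bg bg).
  by rewrite -EFinM lee_fin; exact: key.
by rewrite mulrAC ler_pdivlMr// -lee_fin.
Qed.

End RealBergman.

(** * Montel's theorem and orthogonal projection in the real Bergman space *)

Section BergmanSpace.
Context {R : realType} {n : nat}.
Local Notation E := (borel_space R n).
Variables sigma nu : probability E R.
Hypothesis hsigma : invariant_probability_on sigma unit_sphere.
Hypothesis hnu : invariant_probability_on nu unit_ball.
Hypothesis hnu_bdry : forall r : R, 0 < r -> r < 1 ->
  (0 < nu [set x | unit_ball x /\ (r <= enorm x)%R])%E.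
Hypothesis n0 : (0 < n)%N.
Local Notation B := (unit_ball : set E).
Local Notation ip := (ip nu B).
Local Notation sqint := (sqint nu B).

Let mB := @measurable_ball R n.

Definition real_bergman (v : 'rV[R]_n -> R) := sqint v /\ real_harmonic_on unit_ball v.

Lemma real_bergmanD u v : real_bergman u -> real_bergman v ->
  real_bergman (fun x => u x + v x).
Proof.
by move=> [su hu] [sv hv]; split; [exact: sqintD|exact: (real_harmonicD open_unit_ball)].
Qed.

Lemma real_bergmanZ (c : R) u : real_bergman u -> real_bergman (fun x => c * u x).
Proof.
by move=> [su hu]; split; [exact: sqintZ|exact: (real_harmonicZ _ open_unit_ball)].
Qed.

Lemma real_bergmanB u v : real_bergman u -> real_bergman v ->
  real_bergman (fun x => u x - v x).
Proof.
by move=> [su hu] [sv hv]; split; [exact: sqintB|exact: (real_harmonicB open_unit_ball)].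
Qed.

Lemma real_bergman0 : real_bergman (fun=> 0).
Proof.
split; first by apply: (sqint_bmeas nu mB); exact: bmeas_cst.
exact: (real_harmonic_cst _ open_unit_ball).
Qed.

Lemma real_bergman_montel (u : nat -> 'rV[R]_n -> R) (M : R) :
  (forall k, real_bergman (u k)) -> (forall k, ip (u k) (u k) <= M) ->
  exists phi : nat -> nat, {homo phi : i j / (i < j)%N} /\
    exists2 v, real_bergman v & cvg_locally_uniformly (fun k => u (phi k)) v.
Proof.
move=> bu uM; have [phi [phi_inc [v hv cv]]] : exists phi : nat -> nat, {homo phi : i j / (i < j)%N} /\
    exists2 v, real_harmonic_on unit_ball v & cvg_locally_uniformly (fun k => u (phi k)) v.
  apply: (montel hsigma n0) => [k|t t1]; first by case: (bu k).
  have [C C0 hC] := point_evaluation hsigma hnu hnu_bdry n0 t1.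
  (* From [u^2 <= C M <= (C M + 1)^2], which avoids a square root. *)
  exists (C * M + 1) => k x xt; have [sk hk] := bu k.
  have h := le_trans (hC _ hk sk x xt) (ler_wpM2l C0 (uM k)).
  have h0 : 0 <= C * M by rewrite (le_trans _ h)// sqr_ge0.
  rewrite -(@ler_pXn2r _ 2)// ?nnegrE ?addr_ge0//.
  rewrite -normrX ger0_norm ?sqr_ge0// (le_trans h)//; nra.
exists phi; split => //; exists v => //; split => //.
have [] := @fatou_sqint _ _ _ nu B mB (fun k => u (phi k)) v M => //.
- by move=> k; case: (bu (phi k)).
- move=> x Bx; apply/cvgrPdist_le => e e0.
  have [K hK] := cv (enorm x) e Bx e0.
  by exists K => // k /= Kk; rewrite distrC; exact: hK.
Qed.

(** At [t = b / (c + 1)] the quadratic equals [- b^2 (c + 2) / (c + 1)^2]; the shift by 1 includes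
    the case [c = 0]. *)
Let quadratic_zero (b c : R) : 0 <= c -> (forall t, 0 <= t * t * c - 2 * t * b) -> b = 0.
Proof.
move=> c0 h; have := h (b / (c + 1)).
have c1 : 0 < c + 1 by lra.
rewrite (_ : _ - _ = - (b ^+ 2 * ((c + 2) / (c + 1) ^+ 2))); last by field; rewrite gt_eqF.
rewrite oppr_ge0 pmulr_lle0; last by rewrite divr_gt0 ?exprn_gt0//; lra.
by move=> hb; apply/eqP; rewrite -sqrf_eq0 eq_le hb sqr_ge0.
Qed.

(** A minimiser of the distance to [h] is found by compactness: a minimising sequence is bounded, so
    a subsequence converges locally uniformly in the space, and by Fatou's lemma the limit does not
    exceed the infimum. Orthogonality is the vanishing of the first variation. *)
Lemma real_projection (h : E -> R) : sqint h ->
  exists2 q, real_bergman q &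
    forall v, real_bergman v -> ip (fun x => h x - q x) v = 0.
Proof.
move=> sh.
pose J v := ip (fun x => h x - v x) (fun x => h x - v x).
pose A := [set J v | v in [set v | real_bergman v]].
have Alb : has_lbound A by exists 0 => _ [v _ <-]; exact: ip_ge0.
have Ainf : has_inf A by split => //; exists (J (fun=> 0)); exists (fun=> 0) => //; exact: real_bergman0.
pose m := inf A.
have mle v : real_bergman v -> m <= J v by move=> bv; apply: ge_inf => //; exists v.
have hex (k : nat) : exists v, real_bergman v /\ J v < m + k.+1%:R^-1.
  have k0 : 0 < k.+1%:R^-1 :> R by [].
  by have [_ [v bv <-] hv] := inf_adherent k0 Ainf; exists v.
have [u hu] := choice hex.
have bu k : real_bergman (u k) by case: (hu k).
have uM k : ip (u k) (u k) <= 2 * (ip h h + (m + 1)).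
  have [su _] := bu k.
  have e : ip (u k) (u k) = ip (fun x => h x - (h x - u k x)) (fun x => h x - (h x - u k x)).
    by apply: Rint_eq => x _; ring.
  rewrite e (le_trans (ip_sqrB_le mB sh (sqintB mB sh su)))// ler_wpM2l//.
  rewrite lerD2l (le_trans (ltW (hu k).2))// lerD2l.
  by rewrite invf_le1// ler1n.
have [phi [phi_inc [v bv cv]]] := real_bergman_montel bu uM.
have Jv : J v <= m.
  apply/ler_addgt0Pr => e e0.
  have [K _ hK] := near_infty_natSinv_lt (PosNum e0).
  (* The shift by [K] discards the finitely many terms whose distance may exceed [m + e]. *)
  have [] := @fatou_sqint _ _ _ nu B mB (fun k x => h x - u (phi (k + K)%N) x) (fun x => h x - v x) (m + e) => //.
  - by move=> k; have [su _] := bu (phi (k + K)%N); exact: sqintB.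
  - move=> k; apply: (le_trans (ltW (hu _).2)); rewrite lerD2l ltW//.
    apply: hK => /=; apply: leq_trans (leq_addl k K) _.
    have inc : forall j, (j <= phi j)%N.
      elim=> // j IH; exact: leq_ltn_trans IH (phi_inc _ _ (ltnSn j)).
    exact: inc.
  - move=> x Bx; apply/cvgrPdist_le => d d0.
    have [L hL] := cv (enorm x) d Bx d0.
    exists L => // k /= Lk; rewrite (_ : _ - _ = u (phi (k + K)%N) x - v x); last by ring.
    by apply: hL => //; rewrite (leq_trans Lk)// leq_addr.
exists v => // w bw; have [sv _] := bv; have [sw _] := bw.
have shv := sqintB mB sh sv.
apply: (quadratic_zero (ip_ge0 nu B w)) => t.
have bt : real_bergman (fun x => v x + t * w x) by exact: (real_bergmanD bv (real_bergmanZ t bw)).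
have := le_trans Jv (mle _ bt); rewrite {2}/J.
have -> : ip (fun x => h x - (v x + t * w x)) (fun x => h x - (v x + t * w x)) =
    ip (fun x => (h x - v x) - t * w x) (fun x => (h x - v x) - t * w x).
  by apply: Rint_eq => x _; ring.
have stw := sqintZ mB t sw.
have e1 : ip (fun x => h x - v x) (fun x => t * w x) = t * ip (fun x => h x - v x) w.
  by rewrite ipC (ipZl mB _ sw shv) ipC.
have e2 : ip (fun x => t * w x) (fun x => t * w x) = t * (t * ip w w).
  by rewrite (ipZl mB _ sw stw) ipC (ipZl mB _ sw sw).
by rewrite (ip_sqrB mB shv stw) -/(J v) e1 e2; lra.
Qed.

End BergmanSpace.

Section ComplexParts.
Context {R : realType}.
Implicit Types x y : R[i].

Lemma sqr_normc x :
  Normc.normc x ^+ 2 = complex.Re x * complex.Re x + complex.Im x * complex.Im x.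
Proof.
by case: x => a b /=; rewrite sqr_sqrtr -?expr2// addr_ge0 ?sqr_ge0.
Qed.

Lemma ReD x y : complex.Re (x + y) = complex.Re x + complex.Re y.
Proof. by case: x; case: y. Qed.

Lemma ImD x y : complex.Im (x + y) = complex.Im x + complex.Im y.
Proof. by case: x; case: y. Qed.

Lemma ReB x y : complex.Re (x - y) = complex.Re x - complex.Re y.
Proof. by case: x; case: y. Qed.

Lemma ImB x y : complex.Im (x - y) = complex.Im x - complex.Im y.
Proof. by case: x; case: y. Qed.

Lemma ReM x y : complex.Re (x * y) =
  complex.Re x * complex.Re y - complex.Im x * complex.Im y.
Proof. by case: x; case: y. Qed.

Lemma ImM x y : complex.Im (x * y) =
  complex.Re x * complex.Im y + complex.Im x * complex.Re y.
Proof. by case: x; case: y. Qed.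

Lemma Re_conjc x : complex.Re (conjc x) = complex.Re x.
Proof. by case: x. Qed.

Lemma Im_conjc x : complex.Im (conjc x) = - complex.Im x.
Proof. by case: x. Qed.

Lemma normc_ge0 x : 0 <= Normc.normc x.
Proof. by case: x => a b /=; exact: sqrtr_ge0. Qed.

Lemma Re_le_normc x : `|complex.Re x| <= Normc.normc x.
Proof.
rewrite -(@ler_pXn2r _ 2)// ?nnegrE ?normc_ge0// sqr_normc -normrX ger0_norm ?sqr_ge0//.
by rewrite expr2 lerDl -expr2 sqr_ge0.
Qed.

Lemma Im_le_normc x : `|complex.Im x| <= Normc.normc x.
Proof.
rewrite -(@ler_pXn2r _ 2)// ?nnegrE ?normc_ge0// sqr_normc -normrX ger0_norm ?sqr_ge0//.
by rewrite expr2 lerDr -expr2 sqr_ge0.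
Qed.

End ComplexParts.

(** * The complex Bergman space and the projection, through real and imaginary parts *)

Section ComplexBergman.
Context {R : realType} {n : nat}.
Local Notation E := (borel_space R n).
Variables sigma nu : probability E R.
Hypothesis hsigma : invariant_probability_on sigma unit_sphere.
Hypothesis hnu : invariant_probability_on nu unit_ball.
Hypothesis hnu_bdry : forall r : R, 0 < r -> r < 1 ->
  (0 < nu [set x | unit_ball x /\ (r <= enorm x)%R])%E.
Hypothesis n0 : (0 < n)%N.
Local Notation B := (unit_ball : set E).
Local Notation ip := (ip nu B).
Local Notation sqint := (sqint nu B).
Local Notation fct := ('rV[R]_n -> R[i]).

Let mB := @measurable_ball R n.

Definition re (h : fct) : E -> R := fun x => complex.Re (h x).
Definition im (h : fct) : E -> R := fun x => complex.Im (h x).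

Lemma L2P (h : fct) : L2 nu h <-> sqint (re h) /\ sqint (im h).
Proof.
have e : (\int[nu]_(x in B) ((Normc.normc (h x)) ^+ 2)%:E =
    \int[nu]_(x in B) (re h x * re h x + im h x * im h x)%:E)%E.
  by apply: eq_integral => x _; rewrite sqr_normc.
split=> [[[m1 m2]]|[s1 s2]].
  rewrite e => h2; split; split => //; apply: le_lt_trans h2; apply: ge0_le_integral => //.
  - by move=> x _; rewrite lee_fin -expr2 sqr_ge0.
  - by apply/measurable_EFinP; exact: measurable_funM.
  - by apply/measurable_EFinP; apply: measurable_funD; exact: measurable_funM.
  - by move=> x _; rewrite lee_fin lerDl -expr2 sqr_ge0.
  - by move=> x _; rewrite lee_fin -expr2 sqr_ge0.
  - by apply/measurable_EFinP; exact: measurable_funM.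
  - by apply/measurable_EFinP; apply: measurable_funD; exact: measurable_funM.
  - by move=> x _; rewrite lee_fin lerDr -expr2 sqr_ge0.
split; first by split; [case: s1|case: s2].
rewrite /mkset e; have [m1 i1] := s1; have [m2 i2] := s2.
under eq_integral => x _ do rewrite EFinD.
rewrite ge0_integralD//; first exact: lte_add_pinfty.
- by move=> x _; rewrite lee_fin -expr2 sqr_ge0.
- by apply/measurable_EFinP; exact: measurable_funM.
- by move=> x _; rewrite lee_fin -expr2 sqr_ge0.
- by apply/measurable_EFinP; exact: measurable_funM.
Qed.

Definition sqr_L2norm (h : fct) := ip (re h) (re h) + ip (im h) (im h).

Lemma sqr_L2norm_ge0 h : 0 <= sqr_L2norm h.
Proof. by rewrite addr_ge0// ip_ge0. Qed.

Lemma L2normE h : L2 nu h -> L2norm nu h = Num.sqrt (sqr_L2norm h).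
Proof.
move=> /L2P[s1 s2]; congr Num.sqrt.
transitivity (\int[nu]_(x in B) (re h x * re h x + im h x * im h x)).
  by apply: Rint_eq => x _; rewrite sqr_normc.
exact: (RintegralD mB (sqint_integrable s1) (sqint_integrable s2)).
Qed.

Lemma harmonic_bergmanP (u : fct) :
  harmonic_bergman nu u <-> real_bergman nu (re u) /\ real_bergman nu (im u).
Proof.
split=> [[/L2P[s1 s2] [h1 h2]]|[[s1 h1] [s2 h2]]].
  exact: (conj (conj s1 h1) (conj s2 h2)).
have Lu : L2 nu u by exact/L2P.
exact: (conj Lu (conj h1 h2)).
Qed.

Lemma L2B g h : L2 nu g -> L2 nu h -> L2 nu (fun x => g x - h x).
Proof.
move=> /L2P[g1 g2] /L2P[h1 h2]; apply/L2P; split.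
  rewrite (_ : re _ = fun x => re g x - re h x); first exact: sqintB.
  by apply/funext => x; exact: ReB.
rewrite (_ : im _ = fun x => im g x - im h x); first exact: sqintB.
by apply/funext => x; exact: ImB.
Qed.

Lemma harmonic_bergmanB u v : harmonic_bergman nu u -> harmonic_bergman nu v ->
  harmonic_bergman nu (fun x => u x - v x).
Proof.
move=> /harmonic_bergmanP[g1 g2] /harmonic_bergmanP[h1 h2]; apply/harmonic_bergmanP; split.
  rewrite (_ : re _ = fun x => re u x - re v x); first exact: real_bergmanB.
  by apply/funext => x; exact: ReB.
rewrite (_ : im _ = fun x => im u x - im v x); first exact: real_bergmanB.
by apply/funext => x; exact: ImB.
Qed.

Let inner_re (d v : fct) : L2 nu d -> L2 nu v ->
  complex.Re (L2inner nu d v) = ip (re d) (re v) + ip (im d) (im v).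
Proof.
move=> /L2P[d1 d2] /L2P[v1 v2] /=.
transitivity (\int[nu]_(x in B) (re d x * re v x + im d x * im v x)).
  by apply: Rint_eq => x _; rewrite ReM Re_conjc Im_conjc mulrN opprK.
exact: (RintegralD mB (sqint_integrableM mB d1 v1) (sqint_integrableM mB d2 v2)).
Qed.

Let inner_im (d v : fct) : L2 nu d -> L2 nu v ->
  complex.Im (L2inner nu d v) = ip (im d) (re v) - ip (re d) (im v).
Proof.
move=> /L2P[d1 d2] /L2P[v1 v2] /=.
transitivity (\int[nu]_(x in B) (im d x * re v x - re d x * im v x)).
  by apply: Rint_eq => x _; rewrite ImM Re_conjc Im_conjc mulrN addrC.
exact: (RintegralB mB (sqint_integrableM mB d2 v1) (sqint_integrableM mB d1 v2)).
Qed.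

(** Membership in the space is a condition on both parts separately, so projecting the two parts
    gives an orthogonal projection; its existence determines what the choice in [bergman_projection]
    returns. *)
Lemma projectionP (h : fct) : L2 nu h ->
  is_orthogonal_projection nu h (bergman_projection nu h).
Proof.
move=> Lh; apply: (@xgetPex _ (fun=> 0) [set q | is_orthogonal_projection nu h q]).
have /L2P[h1 h2] := Lh.
have [q1 b1 o1] := real_projection hsigma hnu hnu_bdry n0 h1.
have [q2 b2 o2] := real_projection hsigma hnu hnu_bdry n0 h2.
pose q : fct := fun x => Complex (q1 x) (q2 x).
have bq : harmonic_bergman nu q by apply/harmonic_bergmanP; exact: (conj b1 b2).
exists q; split => // v bv; have [Lv _] := bv; have [Lq _] := bq.
have /harmonic_bergmanP[v1 v2] := bv.
have Ld := L2B Lh Lq.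
have e1 : re (fun x => h x - q x) = fun x => re h x - q1 x by apply/funext => x; exact: ReB.
have e2 : im (fun x => h x - q x) = fun x => im h x - q2 x by apply/funext => x; exact: ImB.
have r0 := inner_re Ld Lv; have i0 := inner_im Ld Lv.
rewrite e1 e2 (o1 _ v1) (o2 _ v2) addr0 in r0.
rewrite e1 e2 (o1 _ v2) (o2 _ v1) subr0 in i0.
by case: (L2inner _ _ _) r0 i0 => a b /= -> ->.
Qed.

Lemma projection_re (h q v : fct) : L2 nu h -> is_orthogonal_projection nu h q ->
  harmonic_bergman nu v ->
  ip (re q) (re v) + ip (im q) (im v) = ip (re h) (re v) + ip (im h) (im v).
Proof.
move=> Lh [bq oq] bv; have [Lq _] := bq; have [Lv _] := bv.
have := inner_re (L2B Lh Lq) Lv; rewrite oq// => /esym.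
have e1 : re (fun x => h x - q x) = fun x => re h x - re q x by apply/funext => x; exact: ReB.
have e2 : im (fun x => h x - q x) = fun x => im h x - im q x by apply/funext => x; exact: ImB.
have /L2P[h1 h2] := Lh; have /L2P[q1 q2] := Lq; have /L2P[v1 v2] := Lv.
by rewrite e1 e2 !ipBl//= => h0; lra.
Qed.

(** With [d = q - q'] and [k = h - h'], orthogonality gives [|d|^2 = Re <k, d>], which is at most
    [(|k|^2 + |d|^2) / 2]. The estimate concerns differences because [bergman_projection] chooses a
    function and need not be additive pointwise. *)
Lemma projection_contraction (h h' q q' : fct) : L2 nu h -> L2 nu h' ->
  is_orthogonal_projection nu h q -> is_orthogonal_projection nu h' q' ->
  sqr_L2norm (fun x => q x - q' x) <= sqr_L2norm (fun x => h x - h' x).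
Proof.
move=> Lh Lh' hq hq'; have [bq _] := hq; have [bq' _] := hq'.
have bd := harmonic_bergmanB bq bq'; have [Ld _] := bd.
have E1 := projection_re Lh hq bd; have E2 := projection_re Lh' hq' bd.
have e (a b : fct) : (re (fun x => a x - b x) = fun x => re a x - re b x) /\
    (im (fun x => a x - b x) = fun x => im a x - im b x).
  by split; apply/funext => x; [exact: ReB|exact: ImB].
have [Lq _] := bq; have [Lq' _] := bq'.
have /L2P[h1 h2] := Lh; have /L2P[h1' h2'] := Lh'; have /L2P[d1 d2] := Ld.
have /L2P[q1 q2] := Lq; have /L2P[q1' q2'] := Lq'.
have /L2P[k1 k2] := L2B Lh Lh'.
have y1 := ip_le mB k1 d1; have y2 := ip_le mB k2 d2.
have x1 : ip (re (fun x => h x - h' x)) (re (fun x => q x - q' x)) =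
    ip (re h) (re (fun x => q x - q' x)) - ip (re h') (re (fun x => q x - q' x)).
  by rewrite {1}(e h h').1 ipBl.
have x2 : ip (im (fun x => h x - h' x)) (im (fun x => q x - q' x)) =
    ip (im h) (im (fun x => q x - q' x)) - ip (im h') (im (fun x => q x - q' x)).
  by rewrite {1}(e h h').2 ipBl.
have z1 : ip (re (fun x => q x - q' x)) (re (fun x => q x - q' x)) =
    ip (re q) (re (fun x => q x - q' x)) - ip (re q') (re (fun x => q x - q' x)).
  by rewrite {1}(e q q').1 ipBl.
have z2 : ip (im (fun x => q x - q' x)) (im (fun x => q x - q' x)) =
    ip (im q) (im (fun x => q x - q' x)) - ip (im q') (im (fun x => q x - q' x)).
  by rewrite {1}(e q q').2 ipBl.
rewrite /sqr_L2norm; clear - E1 E2 y1 y2 x1 x2 z1 z2; lra.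
Qed.

Lemma bmeas_re_im (f : fct) : cmeasurable unit_ball f -> bounded_on unit_ball f ->
  bmeas B (re f) /\ bmeas B (im f).
Proof.
move=> [m1 m2] [M fM]; split; split => //; exists M => x Bx.
  by rewrite (le_trans (Re_le_normc _))// fM.
by rewrite (le_trans (Im_le_normc _))// fM.
Qed.

Lemma L2_mul_bounded (f u : fct) : cmeasurable unit_ball f ->
  bounded_on unit_ball f -> L2 nu u -> L2 nu (fun x => f x * u x).
Proof.
move=> mf bf /L2P[u1 u2]; have [b1 b2] := bmeas_re_im mf bf.
apply/L2P; split.
  rewrite (_ : re _ = fun x => re f x * re u x - im f x * im u x).
    by apply: sqintB => //; exact: sqintM_bmeas.
  by apply/funext => x; exact: ReM.
rewrite (_ : im _ = fun x => re f x * im u x + im f x * re u x).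
  by apply: sqintD => //; exact: sqintM_bmeas.
by apply/funext => x; exact: ImM.
Qed.

Lemma toeplitzP (f u : fct) : cmeasurable unit_ball f ->
  bounded_on unit_ball f -> L2 nu u ->
  is_orthogonal_projection nu (fun x => f x * u x) (toeplitz nu f u).
Proof. by move=> mf bf Lu; apply: projectionP; exact: L2_mul_bounded. Qed.

End ComplexBergman.

Section ComplexMontel.
Context {R : realType} {n : nat}.
Local Notation E := (borel_space R n).
Variables sigma nu : probability E R.
Hypothesis hsigma : invariant_probability_on sigma unit_sphere.
Hypothesis hnu : invariant_probability_on nu unit_ball.
Hypothesis hnu_bdry : forall r : R, 0 < r -> r < 1 ->
  (0 < nu [set x | unit_ball x /\ (r <= enorm x)%R])%E.
Hypothesis n0 : (0 < n)%N.
Local Notation B := (unit_ball : set E).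
Local Notation S := (unit_sphere : set E).
Local Notation ip := (ip nu B).
Local Notation sqint := (sqint nu B).
Local Notation fct := ('rV[R]_n -> R[i]).
Local Notation sqr_L2norm := (sqr_L2norm nu).

Let mB := @measurable_ball R n.
Let mS := @measurable_sphere R n.

Lemma measurable_sqr_normc (h : fct) : L2 nu h ->
  measurable_fun B (fun x => (Normc.normc (h x) ^+ 2)%:E).
Proof.
move=> [[m1 m2] _]; apply/measurable_EFinP.
rewrite (_ : (fun _ => _) = fun x => re h x * re h x + im h x * im h x).
  by apply: measurable_funD; exact: measurable_funM.
by apply/funext => x; exact: sqr_normc.
Qed.

Lemma sqr_L2norm_integral (h : fct) : L2 nu h ->
  ((sqr_L2norm h)%:E = \int[nu]_(x in B) (Normc.normc (h x) ^+ 2)%:E)%E.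
Proof.
move=> Lh; have [_ fin] := Lh; have e := L2normE Lh.
have := @sqr_sqrtr _ (sqr_L2norm h) (sqr_L2norm_ge0 nu h); rewrite -e sqr_sqrtr => [<-|].
  rewrite fineK// ge0_fin_numE//; apply: integral_ge0 => x _.
  by rewrite lee_fin sqr_ge0.
by apply: Rintegral_ge0 => x _; exact: sqr_ge0.
Qed.

Lemma ae_sqr_L2norm_le (h w : fct) (a c : R) : L2 nu h -> L2 nu w -> 0 <= a -> 0 <= c ->
  {ae nu, forall x, B x -> Normc.normc (h x) ^+ 2 <= a * Normc.normc (w x) ^+ 2 + c} ->
  sqr_L2norm h <= a * sqr_L2norm w + c.
Proof.
move=> Lh Lw a0 c0 hw; rewrite -lee_fin (EFinD (a * _) c) EFinM !sqr_L2norm_integral//.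
have mw := measurable_sqr_normc Lw.
rewrite -ge0_integralZl//; last by move=> x _; rewrite lee_fin sqr_ge0.
have -> : c%:E = (\int[nu]_(x in B) c%:E)%E.
  by rewrite integral_cst//; case: hnu => h1 _ _; rewrite -[LHS]mule1; congr (_ * _)%E.
rewrite -ge0_integralD//.
- apply: ae_ge0_le_integral => //.
  + by move=> x _; rewrite lee_fin sqr_ge0.
  + exact: measurable_sqr_normc.
  + by move=> x _; rewrite -EFinM -EFinD lee_fin addr_ge0// mulr_ge0// sqr_ge0.
  + by apply: emeasurable_funD => //; exact: measurable_funeM.
- by move=> x _; rewrite -EFinM lee_fin mulr_ge0// sqr_ge0.
- exact: measurable_funeM.
Qed.

Lemma sqr_L2normB_le (u v : fct) : L2 nu u -> L2 nu v ->
  sqr_L2norm (fun x => u x - v x) <= 2 * (sqr_L2norm u + sqr_L2norm v).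
Proof.
move=> /L2P[u1 u2] /L2P[v1 v2].
have e1 : re (fun x => u x - v x) = fun x => re u x - re v x by apply/funext => x; exact: ReB.
have e2 : im (fun x => u x - v x) = fun x => im u x - im v x by apply/funext => x; exact: ImB.
rewrite /sqr_L2norm e1 e2.
have := ip_sqrB_le mB u1 v1; have := ip_sqrB_le mB u2 v2; lra.
Qed.

Lemma sqr_L2norm_le (u : fct) (M : R) : L2 nu u -> L2norm nu u <= M ->
  sqr_L2norm u <= M ^+ 2.
Proof.
move=> Lu; rewrite L2normE// => uM.
rewrite -(sqr_sqrtr (sqr_L2norm_ge0 nu u)) ler_pXn2r// nnegrE ?sqrtr_ge0//.
by rewrite (le_trans _ uM)// sqrtr_ge0.
Qed.

Definition cvg_locally_uniformly_complex (u : nat -> fct) (v : fct) :=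
  forall t e : R, t < 1 -> 0 < e -> exists K : nat, forall k x, (K <= k)%N ->
    enorm x <= t -> Normc.normc (u k x - v x) ^+ 2 <= e.

Lemma subseq_ge (phi : nat -> nat) : {homo phi : i j / (i < j)%N} -> forall k, (k <= phi k)%N.
Proof.
by move=> h; elim=> // k IH; rewrite (leq_ltn_trans IH)// h.
Qed.

Lemma harmonic_bergman_montel (u : nat -> fct) (M : R) :
  (forall k, harmonic_bergman nu (u k)) -> (forall k, sqr_L2norm (u k) <= M) ->
  exists phi : nat -> nat, {homo phi : i j / (i < j)%N} /\
    exists2 v, harmonic_bergman nu v &
      cvg_locally_uniformly_complex (fun k => u (phi k)) v.
Proof.
move=> bu uM.
have b1 k : real_bergman nu (re (u k)) by have /harmonic_bergmanP[] := bu k.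
have b2 k : real_bergman nu (im (u k)) by have /harmonic_bergmanP[] := bu k.
have M1 k : ip (re (u k)) (re (u k)) <= M.
  by rewrite (le_trans _ (uM k))// lerDl ip_ge0.
have M2 k : ip (im (u k)) (im (u k)) <= M.
  by rewrite (le_trans _ (uM k))// lerDr ip_ge0.
have [phi [phi_inc [v1 bv1 c1]]] := real_bergman_montel hsigma hnu hnu_bdry n0 b1 M1.
have [psi [psi_inc [v2 bv2 c2]]] := real_bergman_montel hsigma hnu hnu_bdry n0
  (fun k => b2 (phi k)) (fun k => M2 (phi k)).
exists (phi \o psi); split; first by move=> i j ij; exact/phi_inc/psi_inc.
exists (fun x => Complex (v1 x) (v2 x)); first by apply/harmonic_bergmanP; exact: (conj bv1 bv2).
(* As [d <= 1], [d^2 <= d <= e / 2], and the two parts add up to at most [e] in the squared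
   modulus. *)
move=> t e t1 e0; pose d := Num.min (e / 2) 1.
have d0 : 0 < d by rewrite lt_min ltr01 divr_gt0.
have dd : d * d <= e / 2.
  rewrite (le_trans (ler_wpM2l (ltW d0) (_ : d <= 1)))//; first by rewrite ge_min lexx orbT.
  by rewrite mulr1 ge_min lexx.
have [K1 h1] := c1 t d t1 d0; have [K2 h2] := c2 t d t1 d0.
exists (maxn K1 K2) => k x; rewrite geq_max => /andP[k1 k2] xt.
rewrite sqr_normc ReB ImB/=.
have a1 := h1 (psi k) x (leq_trans k1 (subseq_ge psi_inc k)) xt.
have a2 := h2 k x k2 xt.
have sq (s : R) : `|s| <= d -> s * s <= d * d.
  by move=> sd; have := normr_ge0 s; have := ler_normlP _ _ sd => -[]; nra.
have := sq _ a1; have := sq _ a2; rewrite /re /im; lra.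
Qed.

End ComplexMontel.

(** * Compactness of the Toeplitz operator *)

Section CompactIfZero.
Context {R : realType} {n : nat}.
Local Notation E := (borel_space R n).
Variables sigma nu : probability E R.
Hypothesis hsigma : invariant_probability_on sigma unit_sphere.
Hypothesis hnu : invariant_probability_on nu unit_ball.
Hypothesis hnu_bdry : forall r : R, 0 < r -> r < 1 ->
  (0 < nu [set x | unit_ball x /\ (r <= enorm x)%R])%E.
Hypothesis n0 : (0 < n)%N.
Variables f fs : 'rV[R]_n -> R[i].
Hypothesis mf : cmeasurable unit_ball f.
Hypothesis bf : bounded_on unit_ball f.
Hypothesis hfs : uniform_radial_limit f fs.
Local Notation B := (unit_ball : set E).
Local Notation S := (unit_sphere : set E).
Local Notation fct := ('rV[R]_n -> R[i]).
Local Notation sqr_L2norm := (sqr_L2norm nu).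

Let mB := @measurable_ball R n.
Let mS := @measurable_sphere R n.

Lemma uniform_radial_limit_near (e : R) : 0 < e -> exists2 s : R, 0 < s < 1 &
  forall r z, s <= r -> r < 1 -> unit_sphere z ->
    Normc.normc (f (r *: z) - fs z) <= e.
Proof.
move=> e0; have /hfs : nbhs (0%E : \bar R) [set y | (y < e%:E)%E].
  by apply: open_nbhs_nbhs; split; [exact: open_ereal_lt_ereal|rewrite /= lte_fin].
move=> /nbhs_ballP[d /= d0 hd].
have s1 : 1 - Num.min (d / 2) (1 / 2) < 1 :> R by rewrite ltrBlDr ltrDl lt_min !divr_gt0.
exists (1 - Num.min (d / 2) (1 / 2)).
  rewrite s1 andbT subr_gt0 gt_min; apply/orP; right; lra.
move=> r z sr r1 Sz; rewrite -lee_fin ltW//.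
apply: (le_lt_trans _ (hd r _ r1)); first by apply: ereal_sup_ubound; exists z.
rewrite /ball/= ger0_norm ?subr_ge0 1?ltW//.
have : Num.min (d / 2) (1 / 2) <= d / 2 by rewrite ge_min lexx.
by move: (Num.min _ _) sr => m; lra.
Qed.

Let normcf_measurable (e s : R) :
  measurable ([set x | unit_ball x /\ s <= enorm x /\ e < Normc.normc (f x) ^+ 2] : set E).
Proof.
have -> : [set x | unit_ball x /\ s <= enorm x /\ e < Normc.normc (f x) ^+ 2] =
    [set x | unit_ball x /\ (s <= enorm x)%R] `&`
    (B `&` [set x | e < re f x * re f x + im f x * im f x]).
  apply/seteqP; split=> x /=; first by rewrite sqr_normc => -[Bx [sx ex]].
  by rewrite sqr_normc => -[[Bx sx] [_ ex]].
apply: measurableI; first exact: measurable_annulus.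
have [m1 m2] := mf.
have mg : measurable_fun B (fun x => re f x * re f x + im f x * im f x).
  by apply: measurable_funD; exact: measurable_funM.
have := mg mB _ (measurable_itv `]e, +oo[).
by congr measurable; apply/seteqP; split=> x; rewrite /= in_itv/= andbT.
Qed.

Hypothesis fs0 : {ae sigma, forall z, unit_sphere z -> fs z = 0}.

(** Where [|x| >= s] and [|f x| > e], the direction of [x] lies in the null set [N] outside of which
    [fs] vanishes. In polar coordinates the integral of the indicator of this set over each sphere
    is at most the measure of [N]. *)
Lemma small_near_sphere (e : R) : 0 < e -> exists2 s : R, 0 < s < 1 &
  {ae nu, forall x, B x -> s <= enorm x -> Normc.normc (f x) ^+ 2 <= e ^+ 2}.
Proof.
move=> e0; have [s s01 hs] := uniform_radial_limit_near e0; exists s => //.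
pose A : set E := [set x | unit_ball x /\ s <= enorm x /\ e ^+ 2 < Normc.normc (f x) ^+ 2].
have mA : measurable A by exact: normcf_measurable.
exists A; split=> //; last first.
  by move=> x /= h; apply: contrapT => nA; apply: h => Bx sx; rewrite leNgt; apply/negP => ex; exact: nA.
have [N [mN N0 hN]] := fs0.
have nuA : fine (nu (A `&` B)) = 0.
  rewrite -Rint_indic//; apply/le_anti/andP; split; last by apply: Rintegral_ge0.
  rewrite (polar_Rint hsigma hnu); last exact: bmeas_indic.
  have bA : bmeas (B `*` S) ((\1_A : E -> R) \o polar).
    by apply: bmeas_polar; exact: bmeas_indic.
  have [S1 _ _] := hsigma; have [B1 _ _] := hnu.
  rewrite -(Rint_cst 0 mB B1); apply: (Rint_le nu mB (bmeas_Rint1 nu sigma mB mS bA)).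
    exact: bmeas_cst.
  move=> x Bx; apply: (@le_trans _ _ (\int[sigma]_(y in S) \1_N y)).
    have b1 : bmeas S (fun y => \1_A (polar (x, y)) : R) by exact: (bmeas_section1 mB mS Bx bA).
    have b2 : bmeas S (fun y => \1_N y : R) by exact: bmeas_indic.
    apply: (Rint_le sigma mS b1 b2) => y Sy /=.
    rewrite !indicE ler_nat; case: (boolP (polar (x, y) \in A)) => // /set_mem[_ [sx ex]].
    rewrite mem_set//; apply: hN => /(_ Sy) f0; move: ex; apply/negP; rewrite -leNgt.
    rewrite ler_pXn2r// ?nnegrE ?normc_ge0 ?(ltW e0)//.
    rewrite enorm_polar// in sx.
    by have := hs _ _ sx Bx Sy; rewrite f0 subr0.
  rewrite Rint_indic// le_eqVlt; apply/orP; left; apply/eqP.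
  suff -> : sigma (N `&` S) = 0%E by [].
  by apply: (subset_measure0 _ _ _ N0) => //; exact: measurableI.
have -> : A = A `&` B by apply/seteqP; split=> x [].
by rewrite -[LHS]fineK ?nuA// fin_num_measure//; exact: measurableI.
Qed.

Let L2f (u : fct) : L2 nu u -> L2 nu (fun x => f x * u x).
Proof. exact: L2_mul_bounded. Qed.

Lemma normcM_sqr (x y : R[i]) :
  Normc.normc (x * y) ^+ 2 = Normc.normc x ^+ 2 * Normc.normc y ^+ 2.
Proof. by rewrite !sqr_normc ReM ImM; ring. Qed.

Lemma mul_cvg0 (w : nat -> fct) (M : R) : (forall k, L2 nu (w k)) ->
  (forall k, sqr_L2norm (w k) <= M) -> cvg_locally_uniformly_complex w (fun=> 0) ->
  sqr_L2norm (fun x => f x * w k x) @[k --> \oo] --> (0 : R).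
Proof.
move=> Lw wM cw; apply/cvgrPdist_le => e e0.
have M0 : 0 <= M by rewrite (le_trans _ (wM 0%N))// sqr_L2norm_ge0.
have [C hC] := bf.
have C0 : 0 <= C by rewrite (le_trans _ (hC 0 _))// ?normc_ge0// /unit_ball/= enorm0.
(* Chosen so that [d^2 (M + 1) = e / 2], where [d^2 M] bounds the contribution near the sphere;
   [M + 1] avoids a division by 0. *)
pose d := Num.sqrt (e / 2 / (M + 1)).
have d0 : 0 < d by rewrite sqrtr_gt0 !divr_gt0// ltr_wpDl.
have [s /andP[s0 s1] hs] := small_near_sphere d0.
(* Away from the sphere [|f|^2 <= C^2], and [C^2] times this bound on [|w k|^2] is at most
   [e / 2]. *)
have c0 : 0 < e / 2 / (C ^+ 2 + 1) by rewrite !divr_gt0// ltr_wpDl// sqr_ge0.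
have [K hK] := cw s _ s1 c0.
exists K => // k /= Kk; rewrite sub0r normrN ger0_norm ?sqr_L2norm_ge0//.
have e2 := divr_gt0 e0 (ltr0n _ 2).
have dM : d ^+ 2 * (M + 1) = e / 2.
  have M1 : 0 < M + 1 by rewrite ltr_wpDl.
  by rewrite /d sqr_sqrtr; [rewrite divfK// gt_eqF|rewrite ltW// divr_gt0].
apply: (@le_trans _ _ (d ^+ 2 * sqr_L2norm (w k) + e / 2)); last first.
  have := ler_wpM2l (sqr_ge0 d) (wM k); have : 0 < d ^+ 2 by rewrite exprn_gt0.
  move: dM; rewrite mulrDr mulr1; lra.
apply: (ae_sqr_L2norm_le hnu (L2f (Lw k)) (Lw k) (sqr_ge0 _) (ltW e2)).
have [N [mN N0 hN]] := hs; exists N; split=> // x nx; apply: hN => hx; apply: nx => Bx.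
rewrite normcM_sqr; have w0 := sqr_ge0 (Normc.normc (w k x)).
have [sx|/ltW xs] := leP s (enorm x).
  by rewrite (le_trans (ler_wpM2r w0 (hx Bx sx)))// lerDl ltW.
have := hK k x Kk xs; rewrite subr0 => hw.
have fC : Normc.normc (f x) ^+ 2 <= C ^+ 2.
  by rewrite ler_pXn2r// ?nnegrE ?normc_ge0//; exact: hC.
apply: (@le_trans _ _ (e / 2)); last by rewrite lerDr mulr_ge0// sqr_ge0.
apply: (le_trans (ler_wpM2r w0 fC)); apply: (le_trans (ler_wpM2l (sqr_ge0 C) hw)).
rewrite mulrCA ger_pMr// ler_pdivrMr ?mul1r ?lerDl//.
by rewrite ltr_wpDl// sqr_ge0.
Qed.

Theorem compact_toeplitz : compact_operator nu (toeplitz nu f).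
Proof.
move=> u bu [M uM].
have Lu k : L2 nu (u k) by case: (bu k).
have uM2 k : sqr_L2norm (u k) <= M ^+ 2 by exact: sqr_L2norm_le.
have [phi [phi_inc [v bv cv]]] := harmonic_bergman_montel hsigma hnu hnu_bdry n0 bu uM2.
have Lv : L2 nu v by case: bv.
pose w k := (fun x => u (phi k) x - v x) : fct.
have Lw k : L2 nu (w k) by exact: L2B.
have hT h : L2 nu h -> is_orthogonal_projection nu (fun x => f x * h x) (toeplitz nu f h).
  by move=> Lh; exact: (toeplitzP hsigma hnu hnu_bdry n0 mf bf Lh).
exists phi; split => //; exists (toeplitz nu f v); first by case: (hT _ Lv).
have cw : cvg_locally_uniformly_complex w (fun=> 0).
  by move=> t e t1 e0; have [K hK] := cv t e t1 e0; exists K => k x Kk xt; rewrite subr0 hK.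
have wM k : sqr_L2norm (w k) <= 2 * (M ^+ 2 + sqr_L2norm v).
  by rewrite (le_trans (sqr_L2normB_le (Lu _) Lv))// ler_wpM2l// lerD2r.
have h0 := mul_cvg0 Lw wM cw.
pose D k := (fun x => toeplitz nu f (u (phi k)) x - toeplitz nu f v x) : fct.
have LD k : L2 nu (D k).
  by apply: L2B; [case: (hT _ (Lu (phi k))) => -[]|case: (hT _ Lv) => -[]].
have D0 : sqr_L2norm (D k) @[k --> \oo] --> (0 : R).
  apply: (squeeze_cvgr _ (cvg_cst 0) h0).
  apply: nearW => k; rewrite sqr_L2norm_ge0/=.
  have := projection_contraction (L2f (Lu (phi k))) (L2f Lv) (hT _ (Lu (phi k))) (hT _ Lv).
  congr (_ <= sqr_L2norm _); apply/funext => x; by rewrite mulrBr.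
have e : (fun k => L2norm nu (D k)) = fun k => Num.sqrt (sqr_L2norm (D k)).
  by apply/funext => k; exact: (L2normE (LD k)).
rewrite [X in X @ _ --> _]e.
by rewrite -(@sqrtr0 R); apply: (cvg_comp _ _ D0); exact: sqrt_continuous.
Qed.

End CompactIfZero.

(** * Necessity: test functions *)

Section WeakConvergence.
Context {R : realType} {n : nat}.
Local Notation E := (borel_space R n).
Variable nu : probability E R.
Local Notation B := (unit_ball : set E).
Local Notation S := (unit_sphere : set E).
Local Notation ip := (ip nu B).
Local Notation sqint := (sqint nu B).
Local Notation fct := ('rV[R]_n -> R[i]).
Local Notation sqr_L2norm := (sqr_L2norm nu).

Let mB := @measurable_ball R n.

Let outer (s : R) : E -> R := \1_[set x | unit_ball x /\ (s <= enorm x)%R].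

Let bmeas_outer s : bmeas B (outer s).
Proof. by apply: bmeas_indic; exact: measurable_annulus. Qed.

Let outer_sqr s x : outer s x * outer s x = outer s x.
Proof. by rewrite /outer indicE; case: (_ \in _); rewrite ?mul1r ?mul0r. Qed.

Let outer_le1 s x : 0 <= outer s x <= 1.
Proof. by rewrite /outer indicE ler0n lern1 leq_b1. Qed.

Let tail_cvg0 (g : E -> R) (e : R) : sqint g -> 0 < e ->
  exists2 s : R, s < 1 & ip (fun x => outer s x * g x) (fun x => outer s x * g x) <= e.
Proof.
move=> sg e0; pose s (k : nat) : R := 1 - k.+1%:R^-1.
have ig := sqint_integrable sg.
have mo k : measurable_fun B (fun x : E => (outer (s k) x * (g x * g x))%:E).
  by apply/measurable_EFinP; apply: measurable_funM; [case: (bmeas_outer (s k))|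
    apply: measurable_funM; case: sg].
have := @dominated_cvg _ _ _ nu B mB (fun k x => (outer (s k) x * (g x * g x))%:E)
  (fun=> 0%E) (EFin \o (fun x => g x * g x)) mo.
have h1 : forall x, B x -> (fun k => (outer (s k) x * (g x * g x))%:E) @ \oo --> 0%E.
  move=> x Bx; apply: cvg_near_cst.
  have d0 : 0 < 1 - enorm (x : 'rV[R]_n) by rewrite subr_gt0.
  have := near_infty_natSinv_lt (PosNum d0); apply: filterS => k /= hk.
  rewrite /outer indicE memNset ?mul0r// => -[_].
  by rewrite /s lerBlDr -lerBlDl leNgt hk.
have h2 : forall k (x : E), B x -> (`|(outer (s k) x * (g x * g x))%:E| <= (g x * g x)%:E)%E.
  move=> k x _; have /andP[p0 p1] := outer_le1 (s k) x; rewrite /= lee_fin.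
  have g0 : 0 <= g x * g x by rewrite -expr2 sqr_ge0.
  by rewrite normrM (ger0_norm p0) (ger0_norm g0) ler_piMl.
move=> /(_ h1 (fun _ _ => isT) ig h2); rewrite integral0 => /fine_cvg.
move=> /cvgrPdist_le /(_ _ e0)[K _ /(_ K (leqnn K))]; rewrite sub0r normrN => hK.
exists (s K); first by rewrite ltrBlDr ltrDl invr_gt0.
rewrite (_ : ip _ _ = \int[nu]_(x in B) (outer (s K) x * (g x * g x))).
  by rewrite (le_trans (ler_norm _)).
by apply: Rint_eq => x _; rewrite mulrACA outer_sqr.
Qed.

(** [g] is split into its tail near the sphere, small in norm by dominated convergence, and the
    rest, supported where [v k] is uniformly small. *)
Lemma weak_cvg0 (g : E -> R) (v : nat -> E -> R) (M : R) : nu B = 1%E ->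
  sqint g -> (forall k, sqint (v k)) -> (forall k, ip (v k) (v k) <= M) ->
  cvg_locally_uniformly v (fun=> 0) -> ip g (v k) @[k --> \oo] --> (0 : R).
Proof.
move=> nu1 sg sv vM cv; apply/cvgrPdist_le => e e0.
have M0 : 0 <= M by rewrite (le_trans _ (vM 0%N))// ip_ge0.
have M1 : 0 < M + 1 by rewrite ltr_wpDl.
(* Young's inequality is used twice. Weight [t] on [v k], with the tail of [g] at most [t e / 2],
   costs [e + e / 2]; weight [q] on [g] costs [e / 4 + e / 4]. Together this is [2 e], for twice the
   inner product. *)
pose t := e / (M + 1); have t0 : 0 < t by rewrite divr_gt0.
have tM : t * (M + 1) = e by rewrite divfK// gt_eqF.
have [s s1 hs] := @tail_cvg0 g (t * (e / 2)) sg (mulr_gt0 t0 (divr_gt0 e0 (ltr0n _ 2))).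
pose G := ip g g; have G0 : 0 <= G by exact: ip_ge0.
have G1 : 0 < G + 1 by rewrite ltr_wpDl.
pose q := e / 4 / (G + 1); have q0 : 0 < q by rewrite !divr_gt0.
have qG : q * (G + 1) = e / 4 by rewrite divfK// gt_eqF.
pose d := Num.min 1 (q * (e / 4)).
have d0 : 0 < d by rewrite lt_min ltr01 mulr_gt0// divr_gt0.
have [K hK] := cv s d s1 d0.
exists K => // k /= Kk; rewrite sub0r normrN.
pose inner x := 1 - outer s x.
have bi : bmeas B inner by apply: bmeasB; [exact: bmeas_cst|exact: bmeas_outer].
pose go x := outer s x * g x; pose vi x := inner x * v k x.
have sgo : sqint go by exact: sqintM_bmeas.
have svi : sqint vi by exact: sqintM_bmeas.
have e1 : ip g (v k) = ip go (v k) + ip g vi.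
  rewrite -(RintegralD mB (sqint_integrableM mB sgo (sv k)) (sqint_integrableM mB sg svi)).
  by apply: Rint_eq => x _; rewrite /go /vi /inner; ring.
have y1 := ip_young mB t0 (sv k) sgo; rewrite ipC in y1.
have y2 := ip_young mB q0 sg svi.
have vi_small x : B x -> vi x * vi x <= d.
  move=> Bx; have [sx|/ltW xs] := leP s (enorm (x : 'rV[R]_n)).
    by rewrite /vi /inner /outer indicE mem_set//= subrr !mul0r ltW.
  have := hK k x Kk xs; rewrite subr0 => hv.
  have /andP[p0 p1] := outer_le1 s x.
  have : `|vi x| <= d.
    rewrite normrM (le_trans _ hv)// ler_piMl// ger0_norm /inner ?subr_ge0//.
    by rewrite lerBlDr lerDl.
  have d1 : d <= 1 by rewrite ge_min lexx.
  move=> h; rewrite (le_trans (ler_norm _))// normrM.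
  by rewrite -[leRHS]mulr1 ler_pM// (le_trans h).
have i2 : ip vi vi <= d.
  rewrite -(Rint_cst d mB nu1); apply: le_Rintegral => //.
  - exact: sqint_integrable.
  - by apply: (bmeas_integrable nu mB); exact: bmeas_cst.
have dq : q^-1 * d <= e / 4.
  by rewrite -ler_pdivlMl ?invr_gt0// invrK ge_min lexx orbT.
have i1 : t^-1 * ip go go <= e / 2.
  by rewrite -ler_pdivlMl ?invr_gt0// invrK.
have i3 : t * ip (v k) (v k) <= e - t.
  by rewrite -tM mulrDr mulr1 addrK ler_wpM2l// ltW.
have i4 : q^-1 * ip vi vi <= e / 4.
  by rewrite (le_trans _ dq)// ler_wpM2l// invr_ge0 ltW.
have i5 : q * G <= e / 4 by rewrite -qG mulrDr mulr1 lerDl ltW.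
rewrite e1 (le_trans (ler_normD _ _))//.
move: y1 y2 i5; rewrite /G; lra.
Qed.

End WeakConvergence.

Section CompactSmall.
Context {R : realType} {n : nat}.
Local Notation E := (borel_space R n).
Variables sigma nu : probability E R.
Hypothesis hsigma : invariant_probability_on sigma unit_sphere.
Hypothesis hnu : invariant_probability_on nu unit_ball.
Hypothesis hnu_bdry : forall r : R, 0 < r -> r < 1 ->
  (0 < nu [set x | unit_ball x /\ (r <= enorm x)%R])%E.
Hypothesis n0 : (0 < n)%N.
Variables f : 'rV[R]_n -> R[i].
Hypothesis mf : cmeasurable unit_ball f.
Hypothesis bf : bounded_on unit_ball f.
Local Notation B := (unit_ball : set E).
Local Notation ip := (ip nu B).
Local Notation sqint := (sqint nu B).
Local Notation fct := ('rV[R]_n -> R[i]).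
Local Notation sqr_L2norm := (sqr_L2norm nu).

Let mB := @measurable_ball R n.
Let nu1 : nu B = 1%E. Proof. by case: hnu. Qed.

(** The real part of the Hermitian inner product; multiplying one argument by [i] gives access to
    the imaginary part. *)
Definition re_inner (g h : fct) := ip (re g) (re h) + ip (im g) (im h).

Let weak (g : fct) (v : nat -> fct) (M : R) : L2 nu g -> (forall k, L2 nu (v k)) ->
  (forall k, sqr_L2norm (v k) <= M) -> cvg_locally_uniformly_complex v (fun=> 0) ->
  re_inner g (v k) @[k --> \oo] --> (0 : R).
Proof.
move=> /L2P[g1 g2] Lv vM cv.
have v1 k : sqint (re (v k)) by have /L2P[] := Lv k.
have v2 k : sqint (im (v k)) by have /L2P[] := Lv k.
have cvr (p : fct -> 'rV[R]_n -> R) : (forall h x, `|p h x| <= Normc.normc (h x)) ->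
    cvg_locally_uniformly (fun k => p (v k)) (fun=> 0).
  move=> hp t e t1 e0; have [K hK] := cv t (e ^+ 2) t1 (exprn_gt0 2 e0).
  exists K => k x Kk xt; rewrite subr0 (le_trans (hp _ _))//.
  have := hK k x Kk xt.
  by rewrite subr0 ler_pXn2r// nnegrE ?normc_ge0// ltW.
have c1 := cvr (@re R n) (fun h x => Re_le_normc (h x)).
have c2 := cvr (@im R n) (fun h x => Im_le_normc (h x)).
have M1 k : ip (re (v k)) (re (v k)) <= M.
  by rewrite (le_trans _ (vM k))// lerDl ip_ge0.
have M2 k : ip (im (v k)) (im (v k)) <= M.
  by rewrite (le_trans _ (vM k))// lerDr ip_ge0.
rewrite -[0 in X in _ --> X](addr0 0).
exact: cvgD (weak_cvg0 nu1 g1 v1 M1 c1) (weak_cvg0 nu1 g2 v2 M2 c2).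
Qed.

Let re_inner_cvg0 (q : nat -> fct) (g : fct) (v : nat -> fct) (M : R) :
  (forall k, L2 nu (q k)) -> L2 nu g -> (forall k, L2 nu (v k)) ->
  L2norm nu (fun x => q k x - g x) @[k --> \oo] --> (0 : R) ->
  (forall k, sqr_L2norm (v k) <= M) -> cvg_locally_uniformly_complex v (fun=> 0) ->
  re_inner (q k) (v k) @[k --> \oo] --> (0 : R).
Proof.
move=> Lq Lg Lv qg vM cv; have w := weak Lg Lv vM cv.
pose D k := (fun x => q k x - g x) : fct.
have LD k : L2 nu (D k) by exact: L2B.
have D0 : sqr_L2norm (D k) @[k --> \oo] --> (0 : R).
  have -> : (fun k => sqr_L2norm (D k)) = fun k => L2norm nu (D k) * L2norm nu (D k).
    by apply/funext => k; rewrite (L2normE (LD k)) -expr2 sqr_sqrtr// sqr_L2norm_ge0.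
  rewrite -[0 in X in _ --> X](mulr0 0); exact: cvgM.
have M0 : 0 <= M by rewrite (le_trans _ (vM 0%N))// sqr_L2norm_ge0.
have M1 : 0 < M + 1 by rewrite ltr_wpDl.
have e k : re_inner (q k) (v k) = re_inner (D k) (v k) + re_inner g (v k).
  have /L2P[q1 q2] := Lq k; have /L2P[g1 g2] := Lg; have /L2P[v1 v2] := Lv k.
  have e1 : re (D k) = fun x => re (q k) x - re g x by apply/funext => x; exact: ReB.
  have e2 : im (D k) = fun x => im (q k) x - im g x by apply/funext => x; exact: ImB.
  rewrite /re_inner e1 e2 (ipBl mB q1 g1 v1) (ipBl mB q2 g2 v2); ring.
rewrite (_ : (fun k => re_inner (q k) (v k)) =
    fun k => re_inner (D k) (v k) + re_inner g (v k)); last by apply/funext.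
rewrite -[0 in X in _ --> X](addr0 0); apply: (cvgD _ w).
apply/cvgrPdist_le => d d0.
pose t := d / (M + 1); have t0 : 0 < t by rewrite divr_gt0.
have tM : t * (M + 1) = d by rewrite divfK// gt_eqF.
have d1 : 0 < t * d by rewrite mulr_gt0.
move/cvgrPdist_le : D0 => /(_ _ d1)[K _ hK]; exists K => // k /= Kk.
have := hK k Kk; rewrite !sub0r !normrN (ger0_norm (sqr_L2norm_ge0 nu _)) => hD.
have /L2P[D1 D2] := LD k; have /L2P[v1 v2] := Lv k.
have y1 := ip_young mB t0 v1 D1; have y2 := ip_young mB t0 v2 D2.
rewrite ipC in y1; rewrite ipC in y2.
have i1 : t * sqr_L2norm (v k) <= d by rewrite -tM ler_wpM2l ?(ltW t0)// (le_trans (vM k))// lerDl.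
have i2 : t^-1 * sqr_L2norm (D k) <= d by rewrite -ler_pdivlMl ?invr_gt0// invrK.
rewrite /re_inner (le_trans (ler_normD _ _))//.
move: i1 i2 y1 y2; rewrite /sqr_L2norm !mulrDr; lra.
Qed.

(** Along a subsequence [T_f u_k] converges in norm while [u_k] tends weakly to 0, so
    [<T_f u_k, u_k>] tends to 0; by orthogonality of the projection this is the integral of
    [f |u_k|^2]. A single index is all that the later contradiction uses. *)
Lemma compact_small (u : nat -> fct) (M : R) :
  compact_operator nu (toeplitz nu f) -> (forall k, harmonic_bergman nu (u k)) ->
  (forall k, sqr_L2norm (u k) <= M) -> cvg_locally_uniformly_complex u (fun=> 0) ->
  forall e : R, 0 < e -> exists k : nat,
    `|\int[nu]_(x in B) (re f x * Normc.normc (u k x) ^+ 2)| <= e /\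
    `|\int[nu]_(x in B) (im f x * Normc.normc (u k x) ^+ 2)| <= e.
Proof.
move=> hT bu uM cu e e0.
have Lu k : L2 nu (u k) by case: (bu k).
have [|phi [phi_inc [g bg cg]]] := hT u bu.
  by exists (Num.sqrt M) => k; rewrite (L2normE (Lu k)) ler_wsqrtr.
have [Lg _] := bg.
pose q k := toeplitz nu f (u (phi k)).
have hq k : is_orthogonal_projection nu (fun x => f x * u (phi k) x) (q k).
  exact: (toeplitzP hsigma hnu hnu_bdry n0 mf bf (Lu _)).
have Lq k : L2 nu (q k) by case: (hq k) => -[].
pose v k := u (phi k).
(* This is [i] times [v k]: pairing [f v] with it has real part the integral of [im f |v|^2]. *)
pose w k : fct := fun x => Complex (- im (v k) x) (re (v k) x).
have bw k : harmonic_bergman nu (w k).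
  have /harmonic_bergmanP[v1 v2] := bu (phi k).
  apply/harmonic_bergmanP; split; last exact: v1.
  have := real_bergmanZ (-1) v2; congr real_bergman; apply/funext => x.
  by rewrite mulN1r.
have nw k x : Normc.normc (w k x) ^+ 2 = Normc.normc (v k x) ^+ 2.
  by rewrite !sqr_normc /= mulrNN addrC.
have Lw k : L2 nu (w k) by case: (bw k).
have sw k : sqr_L2norm (w k) = sqr_L2norm (v k).
  rewrite /sqr_L2norm addrC; congr (_ + _).
  by apply: Rint_eq => x _; rewrite /im /re/= mulrNN.
have cv : cvg_locally_uniformly_complex v (fun=> 0).
  move=> t d t1 d0; have [K hK] := cu t d t1 d0; exists K => k x Kk; apply: hK.
  by rewrite (leq_trans Kk)// subseq_ge.
have cw : cvg_locally_uniformly_complex w (fun=> 0).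
  move=> t d t1 d0; have [K hK] := cv t d t1 d0; exists K => k x Kk xt.
  by rewrite subr0 nw; have := hK k x Kk xt; rewrite subr0.
have Lv k : L2 nu (v k) := Lu _.
have c1 := re_inner_cvg0 Lq Lg Lv cg (fun k => uM (phi k)) cv.
have wM k : sqr_L2norm (w k) <= M by rewrite sw; exact: uM.
have c2 := re_inner_cvg0 Lq Lg Lw cg wM cw.
have e1 k : re_inner (q k) (v k) = \int[nu]_(x in B) (re f x * Normc.normc (v k x) ^+ 2).
  have Lf := L2_mul_bounded mf bf (Lv k).
  rewrite /re_inner (projection_re Lf (hq k) (bu _)).
  have /L2P[f1 f2] := Lf; have /L2P[v1 v2] := Lv k.
  rewrite -(RintegralD mB (sqint_integrableM mB f1 v1) (sqint_integrableM mB f2 v2)).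
  by apply: Rint_eq => x _; rewrite /re /im ReM ImM sqr_normc; ring.
have e2 k : re_inner (q k) (w k) = \int[nu]_(x in B) (im f x * Normc.normc (v k x) ^+ 2).
  have Lf := L2_mul_bounded mf bf (Lv k).
  rewrite /re_inner (projection_re Lf (hq k) (bw _)).
  have /L2P[f1 f2] := Lf; have /L2P[v1 v2] := Lw k.
  rewrite -(RintegralD mB (sqint_integrableM mB f1 v1) (sqint_integrableM mB f2 v2)).
  by apply: Rint_eq => x _; rewrite /w /re /im ReM ImM sqr_normc /=; ring.
move/cvgrPdist_le : c1 => /(_ _ e0)[K1 _ hK1].
move/cvgrPdist_le : c2 => /(_ _ e0)[K2 _ hK2].
exists (phi (maxn K1 K2)).
have := hK1 (maxn K1 K2) (leq_maxl _ _); have := hK2 (maxn K1 K2) (leq_maxr _ _).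
by rewrite /= !sub0r !normrN e1 e2 => h2 h1; split.
Qed.

End CompactSmall.

(** * Polynomials in an isotropic linear form *)

Section IsotropicPolynomials.
Context {R : realType} {n : nat}.
Local Notation V := 'rV[R]_n.
Variables p q : V.

Definition zeta (x : V) : R[i] := Complex (dotp x p) (dotp x q).

Definition quad (x : V) : R := dotp x p ^+ 2 + dotp x q ^+ 2.

Lemma quad_normc x : Normc.normc (zeta x) ^+ 2 = quad x.
Proof. by rewrite sqr_normc /= -!expr2. Qed.

Lemma zetaD x y : zeta (x + y) = zeta x + zeta y.
Proof. by rewrite /zeta !dotpDl. Qed.

Lemma is_derive_dotpl (w x v : V) : is_derive x v (dotp^~ w) (dotp v w).
Proof.
apply/is_derive_line0.
have -> : (fun s : R => dotp (s *: v + x) w) = fun s => dotp v w * s + dotp x w.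
  by apply/funext => s; rewrite dotpDl dotpZl mulrC.
have did : is_derive (0:R) (1:R) (fun s : R => s) 1 by exact: is_derive_id.
have h := is_derive_add (is_derive_scale (dotp v w) did)
  (is_derive_const (0:R) (1:R) (dotp x w)).
by apply: (is_derive_eq h); rewrite mulr1 addr0.
Qed.

(** The two parts are treated together because multiplication by [zeta] mixes them at each step of
    the induction. *)
Lemma is_derive_horner (P : {poly R[i]}) (x v : V) :
  is_derive x v (fun y => complex.Re P.[zeta y]) (complex.Re (P^`().[zeta x] * zeta v)) /\
  is_derive x v (fun y => complex.Im P.[zeta y]) (complex.Im (P^`().[zeta x] * zeta v)).
Proof.
elim/poly_ind: P => [|P c [IH1 IH2]].
  have z0 (g : R[i] -> R) : (fun y => g (0 : {poly R[i]}).[zeta y]) = fun=> g 0.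
    by apply/funext => y; rewrite horner0.
  rewrite deriv0 horner0 mul0r (z0 (@complex.Re R)) (z0 (@complex.Im R)).
  by split; exact: is_derive_const.
have dp := is_derive_dotpl p x v; have dq := is_derive_dotpl q x v.
rewrite derivMXaddC hornerD hornerMX; split.
  rewrite (_ : (fun y => _) = fun y => (complex.Re P.[zeta y] * dotp y p +
      (-1) * (complex.Im P.[zeta y] * dotp y q)) + complex.Re c); last first.
    by apply/funext => y; rewrite hornerMXaddC ReD ReM mulN1r.
  have := is_derive_add (is_derive_add (is_derive_mul IH1 dp)
    (is_derive_scale (-1) (is_derive_mul IH2 dq))) (is_derive_const x v (complex.Re c)).
  move=> h; apply: (is_derive_eq h); rewrite !(ReM, ImM, ReD, ImD) /=; ring.
rewrite (_ : (fun y => _) = fun y => (complex.Re P.[zeta y] * dotp y q +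
    complex.Im P.[zeta y] * dotp y p) + complex.Im c); last first.
  by apply/funext => y; rewrite hornerMXaddC ImD ImM.
have := is_derive_add (is_derive_add (is_derive_mul IH1 dq)
  (is_derive_mul IH2 dp)) (is_derive_const x v (complex.Im c)).
move=> h; apply: (is_derive_eq h); rewrite !(ReM, ImM, ReD, ImD) /=; ring.
Qed.

Lemma continuous_horner (P : {poly R[i]}) (x : V) :
  {for x, continuous (fun y => complex.Re P.[zeta y])} /\
  {for x, continuous (fun y => complex.Im P.[zeta y])}.
Proof.
elim/poly_ind: P => [|P c [IH1 IH2]].
  have z0 (g : R[i] -> R) : (fun y => g (0 : {poly R[i]}).[zeta y]) = fun=> g 0.
    by apply/funext => y; rewrite horner0.
  by rewrite (z0 (@complex.Re R)) (z0 (@complex.Im R)); split; exact: cst_continuous.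
have dp := @dotp_continuousl R n p x; have dq := @dotp_continuousl R n q x.
have cc (d : R) : {for x, continuous (fun _ : V => d)} by exact: cst_continuous.
split.
  rewrite (_ : (fun y => _) = fun y => (complex.Re P.[zeta y] * dotp y p -
      complex.Im P.[zeta y] * dotp y q) + complex.Re c); last first.
    by apply/funext => y; rewrite hornerMXaddC ReD ReM.
  apply: (@cvgD _ _ _ (nbhs x)); last exact: cc.
  by apply: (@cvgB _ _ _ (nbhs x)); apply: (@cvgM _ _ (nbhs x)).
rewrite (_ : (fun y => _) = fun y => (complex.Re P.[zeta y] * dotp y q +
    complex.Im P.[zeta y] * dotp y p) + complex.Im c); last first.
  by apply/funext => y; rewrite hornerMXaddC ImD ImM.
apply: (@cvgD _ _ _ (nbhs x)); last exact: cc.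
by apply: (@cvgD _ _ _ (nbhs x)); apply: (@cvgM _ _ (nbhs x)).
Qed.

Hypotheses (pq : dotp p q = 0) (pp : dotp p p = dotp q q).

Let e_ (i : 'I_n) : V := delta_mx 0 i.

Let isotropic : \sum_i zeta (e_ i) * zeta (e_ i) = 0.
Proof.
have r : complex.Re (\sum_i zeta (e_ i) * zeta (e_ i)) = 0.
  rewrite (big_morph (@complex.Re R) ReD (erefl _)).
  rewrite (eq_bigr (fun i => p 0 i * p 0 i - q 0 i * q 0 i)) => [|i _].
    by rewrite sumrB -/(dotp p p) -/(dotp q q) pp subrr.
  by rewrite ReM /= !(dotpC (e_ i)) !dotp_delta.
have i0 : complex.Im (\sum_i zeta (e_ i) * zeta (e_ i)) = 0.
  rewrite (big_morph (@complex.Im R) ImD (erefl _)).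
  rewrite (eq_bigr (fun i => p 0 i * q 0 i + p 0 i * q 0 i)) => [|i _].
    by rewrite big_split/= -/(dotp p q) pq addr0.
  by rewrite ImM /= !(dotpC (e_ i)) !dotp_delta (mulrC (q 0 i)).
by case: (\sum_i _) r i0 => a b /= -> ->.
Qed.

(* The Laplacian of [P (zeta x)] is [P'' (zeta x)] times the square of the
   isotropic vector [p + i q]. *)
Lemma harmonic_horner (P : {poly R[i]}) (U : set V) : open U ->
  harmonic_on U (fun x => P.[zeta x]).
Proof.
move=> oU.
pose Q i : {poly R[i]} := P^`() * (zeta (e_ i))%:P.
pose T i j : {poly R[i]} := (Q i)^`() * (zeta (e_ j))%:P.
have hQ i x : (Q i).[zeta x] = P^`().[zeta x] * zeta (e_ i) by rewrite hornerM hornerC.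
have hT i j x : (T i j).[zeta x] = (Q i)^`().[zeta x] * zeta (e_ j).
  by rewrite hornerM hornerC.
have L x : \sum_i (T i i).[zeta x] = 0.
  rewrite (eq_bigr (fun i => P^`()^`().[zeta x] * (zeta (e_ i) * zeta (e_ i)))) => [|i _].
    by rewrite -mulr_sumr isotropic mulr0.
  by rewrite hT /Q derivM derivC mulr0 addr0 hornerM hornerC mulrA.
split; apply/(real_harmonic_onP _ oU).
  exists (fun i x => complex.Re (Q i).[zeta x]), (fun i j x => complex.Re (T i j).[zeta x]).
  move=> x _; split.
  - exact: (continuous_horner P x).1.
  - move=> i; split; last exact: (continuous_horner (Q i) x).1.
    by rewrite hQ; exact: (is_derive_horner P x (e_ i)).1.
  - move=> i j; split; last exact: (continuous_horner (T i j) x).1.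
    by rewrite hT; exact: (is_derive_horner (Q i) x (e_ j)).1.
  - by have := congr1 (@complex.Re R) (L x); rewrite (big_morph (@complex.Re R) ReD (erefl _)).
exists (fun i x => complex.Im (Q i).[zeta x]), (fun i j x => complex.Im (T i j).[zeta x]).
move=> x _; split.
- exact: (continuous_horner P x).2.
- move=> i; split; last exact: (continuous_horner (Q i) x).2.
  by rewrite hQ; exact: (is_derive_horner P x (e_ i)).2.
- move=> i j; split; last exact: (continuous_horner (T i j) x).2.
  by rewrite hT; exact: (is_derive_horner (Q i) x (e_ j)).2.
- by have := congr1 (@complex.Im R) (L x); rewrite (big_morph (@complex.Im R) ImD (erefl _)).
Qed.

Lemma quad_ge0 x : 0 <= quad x.
Proof. by rewrite addr_ge0// sqr_ge0. Qed.

(** Bessel's inequality for [p] and [q]: Cauchy-Schwarz for [x] and [(x.p) p + (x.q) q], whose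
    squared norm is [|p|^2 quad x], followed by division by [quad x]. *)
Lemma quad_le x : quad x <= enorm p ^+ 2 * enorm x ^+ 2.
Proof.
have [z0|z0] := eqVneq (quad x) 0; first by rewrite z0 mulr_ge0// sqr_ge0.
have zp : 0 < quad x by rewrite lt_neqAle eq_sym z0 quad_ge0.
have := sqr_dotp_le x (dotp x p *: p + dotp x q *: q).
rewrite !dotpDr !dotpDl !dotpZr !dotpZl (dotpC q p) pq -pp !sqr_enorm => h.
rewrite -(ler_pM2r zp) -expr2; move: h; rewrite /quad; lra.
Qed.

Lemma quadZ (c : R) x : quad (c *: x) = c ^+ 2 * quad x.
Proof. by rewrite /quad !dotpZl; ring. Qed.

(** Each difference of squares factors as [(x - y).w] times [(x + y).w], the latter at most 4; the
    two squares give 8. *)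
Lemma quad_lipschitz x y : enorm p <= 1 -> enorm x <= 2 -> enorm y <= 2 ->
  `|quad x - quad y| <= 8 * enorm (x - y).
Proof.
move=> p1 x2 y2.
have q1 : enorm q <= 1.
  by rewrite enormE -pp -enormE.
have h (w : V) : enorm w <= 1 ->
    `|dotp x w ^+ 2 - dotp y w ^+ 2| <= 4 * enorm (x - y).
  move=> w1; rewrite subr_sqr -dotpBl -dotpDl normrM mulrC.
  have a1 := dotp_le (x - y) w; have a2 := dotp_le (x + y) w; have a3 := enormD x y.
  have b1 : enorm (x - y) * enorm w <= enorm (x - y) by rewrite ler_piMr// enorm_ge0.
  have b2 : enorm (x + y) * enorm w <= enorm (x + y) by rewrite ler_piMr// enorm_ge0.
  by apply: ler_pM => //; lra.
rewrite /quad (_ : _ - _ = (dotp x p ^+ 2 - dotp y p ^+ 2) + (dotp x q ^+ 2 - dotp y q ^+ 2)); last by ring.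
rewrite (le_trans (ler_normD _ _))//; have := h p p1; have := h q q1; lra.
Qed.

End IsotropicPolynomials.

Lemma expr_negligible (R : realType) (s t c : R) : 0 <= s < t -> 0 < c ->
  exists k : nat, forall m, (k <= m)%N -> s ^+ m <= c * t ^+ m.
Proof.
move=> /andP[s0 st] c0; have t0 : 0 < t by exact: le_lt_trans st.
have r1 : `|s / t| < 1.
  by rewrite ger0_norm ?divr_ge0 ?(ltW t0)// ltr_pdivrMr// mul1r.
move/cvgrPdist_le : (cvg_expr r1) => /(_ _ c0)[k _ hk].
exists k => m /hk; rewrite /= sub0r normrN => /(le_trans (ler_norm _)) hr.
by rewrite -{1}(divfK (lt0r_neq0 t0) s) exprMn ler_wpM2r// exprn_ge0// ltW.
Qed.

(** * Radial and spherical moments of the test functions *)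

Section Moments.
Context {R : realType} {n : nat}.
Local Notation E := (borel_space R n).
Variables sigma nu : probability E R.
Hypothesis hsigma : invariant_probability_on sigma unit_sphere.
Hypothesis hnu : invariant_probability_on nu unit_ball.
Hypothesis hnu_bdry : forall r : R, 0 < r -> r < 1 ->
  (0 < nu [set x | unit_ball x /\ (r <= enorm x)%R])%E.
Local Notation B := (unit_ball : set E).
Local Notation S := (unit_sphere : set E).
Local Notation V := 'rV[R]_n.

Let mB := @measurable_ball R n.
Let mS := @measurable_sphere R n.

Lemma bmeas_continuous (D : set V) (g : V -> R) (r : R) : measurable (D : set E) ->
  (forall x, D x -> enorm x <= r) -> continuous g -> bmeas (D : set E) (g : E -> R).
Proof.
move=> mD Dr cg; split; first by apply: measurable_funTS; exact: continuous_measurable.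
have : compact (g @` [set x : V | enorm x <= r]).
  apply: continuous_compact; last exact: compact_eball.
  exact: continuous_subspaceT.
move=> /compact_bounded[M [_ hM]]; exists (M + 1) => x Dx.
by apply: (hM (M + 1)); [rewrite ltrDl|exists x => //; exact: Dr].
Qed.

Lemma ball_enorm_le1 x : B x -> enorm (x : V) <= 1. Proof. exact: ltW. Qed.

Lemma sphere_enorm_le1 x : S x -> enorm (x : V) <= 1. Proof. by move=> ->. Qed.

(** The complex vector [p + i q] has square 0. Its size is bounded from above only: [p = q = 0] is
    allowed, as Gram-Schmidt yields it from parallel vectors. *)
Definition isotropic (p q : V) := [/\ dotp p q = 0, dotp p p = dotp q q & enorm p <= 1].

Lemma quad_continuous p q m (y : V) : continuous (fun x : V => quad p q (x + y) ^+ m).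
Proof.
move=> x; elim: m => [|m IH].
  by rewrite (_ : (fun _ => _) = fun=> 1); [exact: cst_continuous|apply/funext].
have c (w : V) : {for x, continuous (fun z : V => dotp (z + y) w)}.
  rewrite (_ : (fun _ => _) = fun z => dotp z w + dotp y w); last first.
    by apply/funext => z; rewrite dotpDl.
  by apply: (@cvgD _ _ _ (nbhs x)); [exact: dotp_continuousl|exact: cvg_cst].
rewrite (_ : (fun _ => _) = fun z => (dotp (z + y) p * dotp (z + y) p +
    dotp (z + y) q * dotp (z + y) q) * quad p q (z + y) ^+ m); last first.
  by apply/funext => z; rewrite exprS {1}/quad -!expr2.
apply: (@cvgM _ _ (nbhs x)) => //.
by apply: (@cvgD _ _ _ (nbhs x)); apply: (@cvgM _ _ (nbhs x)); exact: c.
Qed.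

Lemma quad_continuous0 p q m : continuous (fun x : V => quad p q x ^+ m).
Proof.
have := @quad_continuous p q m 0.
by rewrite (_ : (fun x => _) = fun x => quad p q x ^+ m)//; apply/funext => x; rewrite addr0.
Qed.

Lemma bmeas_quad (D : set E) p q m y : measurable D ->
  (forall x : V, D x -> enorm x <= 1) -> bmeas D (fun x : E => quad p q ((x : V) + y) ^+ m).
Proof. by move=> mD D1; apply: (bmeas_continuous mD D1); exact: quad_continuous. Qed.

Lemma bmeas_quad0 (D : set E) p q m : measurable D ->
  (forall x : V, D x -> enorm x <= 1) -> bmeas D (fun x : E => quad p q (x : V) ^+ m).
Proof. by move=> mD D1; apply: (bmeas_continuous mD D1); exact: quad_continuous0. Qed.

Definition radial_moment m := \int[nu]_(x in B) (enorm (x : V) ^+ m.*2).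

Lemma bmeas_radial m : bmeas B (fun x : E => enorm (x : V) ^+ m.*2).
Proof.
apply: bmeasX; split; first by apply: measurable_funTS; exact: enorm_measurable.
by exists 1 => x Bx; rewrite ger0_norm ?enorm_ge0// ltW.
Qed.

Lemma polar_quad p q m : \int[nu]_(x in B) (quad p q (x : V) ^+ m) =
  radial_moment m * \int[sigma]_(z in S) (quad p q (z : V) ^+ m).
Proof.
rewrite (polar_Rint hsigma hnu (bmeas_quad0 p q m mB ball_enorm_le1)) mulrC.
rewrite -(RintZ nu _ mB (bmeas_radial m)); apply: Rint_eq => x Bx.
rewrite mulrC -(RintZ sigma _ mS (bmeas_quad0 p q m mS sphere_enorm_le1)).
by apply: Rint_eq => z Sz; rewrite /polar/= quadZ exprMn -exprM mul2n.
Qed.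

(** [nu] charges every annulus [|x| >= s], where the integrand is at least [s^(2m)]. As [s] can be
    any number below 1, the moments decay more slowly than every geometric sequence of ratio below
    1. *)
Lemma radial_moment_ge (s : R) : 0 < s < 1 -> exists2 K : R, 0 < K &
  forall m, K * s ^+ m.*2 <= radial_moment m.
Proof.
move=> /andP[s0 s1]; pose A : set E := [set x | unit_ball x /\ (s <= enorm x)%R].
have mA : measurable A by exact: measurable_annulus.
have AB : A `&` B = A by apply/seteqP; split=> x [].
exists (fine (nu A)).
  by rewrite fine_gt0// hnu_bdry//= ltey_eq fin_num_measure.
move=> m; have iA : \int[nu]_(x in B) \1_A x = fine (nu A) by rewrite Rint_indic// AB.
have bA : bmeas B (\1_A : E -> R) by exact: bmeas_indic.
rewrite -iA mulrC -(RintZ nu _ mB bA).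
apply: (Rint_le nu mB (bmeasZ _ bA) (bmeas_radial m)) => x Bx.
rewrite indicE; have [/set_mem[_ sx]|_] := boolP (x \in A).
  by rewrite mulr1; apply: lerXn2r => //; rewrite nnegrE ?enorm_ge0// ltW.
by rewrite mulr0 exprn_ge0// enorm_ge0.
Qed.

(** On a cap around the direction of [p] one has [z.p >= s |p|], and caps of equal radius have equal
    measure; hence one [K] for all pairs. The factor [|p|] stays, since [p] may be arbitrarily
    small. *)
Lemma sphere_moment_ge (s : R) : 0 < s < 1 -> exists2 K : R, 0 < K &
  forall m p q, isotropic p q ->
    K * (s * enorm p) ^+ m.*2 <= \int[sigma]_(z in S) (quad p q (z : V) ^+ m).
Proof.
move=> /andP[s0 s1]; have [e Se] := sphere_neq0 hsigma.
(* For unit vectors [|a - z|^2 = 2 - 2 a.z], so [|a - z|^2 < 1 - s] forces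
   [a.z > (1 + s) / 2 > s]. *)
pose t := Num.sqrt (1 - s); have t0 : 0 < t by rewrite sqrtr_gt0 subr_gt0.
have tt : t ^+ 2 = 1 - s by rewrite sqr_sqrtr// subr_ge0 ltW.
exists (fine (sigma (cap e t))).
  by rewrite fine_gt0// (cap_gt0 hsigma Se t0)/= ltey_eq fin_num_measure//; exact: measurable_cap.
move=> m p q [pq pp p1].
have [a Sa pa] : exists2 a, unit_sphere a & p = enorm p *: a.
  have [->|p0] := eqVneq p 0; first by exists e; rewrite // enorm0 scale0r.
  exists ((enorm p)^-1 *: p); first exact: unit_vector_normalize.
  by rewrite scalerA divff ?scale1r// gt_eqF// enorm_gt0.
have -> : sigma (cap e t) = sigma (cap a t).
  by apply: (sphere_cap_eq hsigma); rewrite Se Sa.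
have mC := @measurable_cap R n a t; have [S1 _ _] := hsigma.
have iC : \int[sigma]_(x in S) \1_(cap a t) x = fine (sigma (cap a t)).
  by rewrite Rint_indic//; congr fine; exact: measureI_full.
have bC : bmeas S (\1_(cap a t) : E -> R) by exact: bmeas_indic.
rewrite -iC mulrC -(RintZ sigma _ mS bC).
apply: (Rint_le sigma mS (bmeasZ _ bC) (bmeas_quad0 p q m mS sphere_enorm_le1)) => z Sz.
rewrite indicE; have [/set_mem za|_] := boolP (z \in _); last first.
  by rewrite mulr0 exprn_ge0// quad_ge0.
rewrite mulr1 -muln2 mulnC exprM; apply: lerXn2r; rewrite ?nnegrE ?quad_ge0 ?sqr_ge0//.
apply: (@le_trans _ _ (dotp (z : V) p ^+ 2)); last by rewrite lerDl sqr_ge0.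
have az : s <= dotp a z.
  have h : enorm (a - z) ^+ 2 <= t ^+ 2.
    by apply: lerXn2r; rewrite ?nnegrE ?enorm_ge0 ?ltW.
  move: h; rewrite tt sqr_enormB Sa Sz; lra.
rewrite {2}pa dotpZr mulrC dotpC; apply: lerXn2r; rewrite ?nnegrE ?mulr_ge0 ?enorm_ge0 ?(ltW s0)//.
  by rewrite (le_trans (ltW s0)).
by rewrite ler_wpM2l// enorm_ge0.
Qed.


End Moments.

Section TestFunctions.
Context {R : realType} {n : nat}.
Local Notation E := (borel_space R n).
Variables sigma nu : probability E R.
Hypothesis hsigma : invariant_probability_on sigma unit_sphere.
Hypothesis hnu : invariant_probability_on nu unit_ball.
Hypothesis hnu_bdry : forall r : R, 0 < r -> r < 1 ->
  (0 < nu [set x | unit_ball x /\ (r <= enorm x)%R])%E.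
Hypothesis n0 : (0 < n)%N.
Variables f : 'rV[R]_n -> R[i].
Hypothesis mf : cmeasurable unit_ball f.
Hypothesis bf : bounded_on unit_ball f.
Hypothesis hT : compact_operator nu (toeplitz nu f).
Local Notation B := (unit_ball : set E).
Local Notation S := (unit_sphere : set E).
Local Notation V := 'rV[R]_n.
Local Notation fct := (V -> R[i]).

Let mB := @measurable_ball R n.

Lemma normcX_sqr (z : R[i]) m : Normc.normc (z ^+ m) ^+ 2 = (Normc.normc z ^+ 2) ^+ m.
Proof.
elim: m => [|m IH]; first by rewrite !expr0 sqr_normc /= mulr1 mulr0 addr0.
by rewrite (exprS z) normcM_sqr IH (exprS _ m).
Qed.

Definition test_poly (c : R) (p q y : V) (m N : nat) : {poly R[i]} :=
  (Complex c 0)%:P * ('X^m * ('X + (zeta p q y)%:P) ^+ N).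

Definition test_fun c p q y m N : fct := fun x => (test_poly c p q y m N).[zeta p q x].

Lemma normc_test_fun c p q y m N x : Normc.normc (test_fun c p q y m N x) ^+ 2 =
  c ^+ 2 * (quad p q x ^+ m * quad p q (x + y) ^+ N).
Proof.
rewrite /test_fun /test_poly !(hornerM, hornerC, hornerXn, horner_exp, hornerD, hornerX).
rewrite !normcM_sqr !normcX_sqr -zetaD !quad_normc sqr_normc /=.
by rewrite mul0r addr0 -expr2.
Qed.

Lemma bergman_test_fun c (p q y : V) m N : isotropic p q ->
  harmonic_bergman nu (test_fun c p q y m N).
Proof.
move=> [pq pp p1]; split; last exact: (harmonic_horner pq pp _ open_unit_ball).
apply/L2P; split; apply: (sqint_bmeas nu mB); apply: (bmeas_continuous mB (@ball_enorm_le1 R n)) => x.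
  exact: (continuous_horner p q _ x).1.
exact: (continuous_horner p q _ x).2.
Qed.

Lemma sqr_L2norm_test_fun c (p q y : V) m N : isotropic p q ->
  sqr_L2norm nu (test_fun c p q y m N) =
  c ^+ 2 * \int[nu]_(x in B) (quad p q (x : V) ^+ m * quad p q ((x : V) + y) ^+ N).
Proof.
move=> pq; have [/L2P[s1 s2] _] := bergman_test_fun c y m N pq.
have b1 := bmeas_quad0 p q m mB (@ball_enorm_le1 R n).
have b2 := bmeas_quad p q N y mB (@ball_enorm_le1 R n).
rewrite /sqr_L2norm /ip -(RintegralD mB (sqint_integrable s1) (sqint_integrable s2)).
rewrite -(RintZ nu _ mB (bmeasM b1 b2)); apply: Rint_eq => x _.
by rewrite -normc_test_fun sqr_normc.
Qed.

Lemma quad_le4 (p q x y : V) : isotropic p q -> enorm x <= 1 -> enorm y <= 1 ->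
  quad p q (x + y) <= 4.
Proof.
move=> [pq pp p1] x1 y1; apply: (le_trans (quad_le pq pp (x + y))).
have h : enorm (x + y) <= 2 by have := enormD x y; lra.
rewrite -exprMn (_ : 4 = (1 * 2) ^+ 2); last by rewrite mul1r; ring.
apply: lerXn2r; rewrite ?nnegrE ?mulr_ge0 ?enorm_ge0//.
by apply: ler_pM => //; exact: enorm_ge0.
Qed.

(* Otherwise suitably normalized test functions form a bounded sequence which tends
   to [0] locally uniformly and contradicts [compact_small]. *)
Lemma test_small (F : E -> R) : F = re f \/ F = im f ->
  forall (N : nat) (e : R), 0 < e -> exists m0 : nat, forall m (p q y : V), (m0 <= m)%N ->
    isotropic p q -> unit_sphere y ->
    `|\int[nu]_(x in B) (F x * (quad p q (x : V) ^+ m * quad p q ((x : V) + y) ^+ N))| <=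
    e * \int[nu]_(x in B) (quad p q (x : V) ^+ m).
Proof.
move=> hF N e e0; apply: contrapT => hN.
pose I m (p q : V) := \int[nu]_(x in B) (quad p q (x : V) ^+ m).
pose bad k (w : nat * (V * (V * V))) := [/\ (k <= w.1)%N, isotropic w.2.1 w.2.2.1,
    unit_sphere w.2.2.2 & e * I w.1 w.2.1 w.2.2.1 <
    `|\int[nu]_(x in B) (F x * (quad w.2.1 w.2.2.1 (x : V) ^+ w.1 *
       quad w.2.1 w.2.2.1 ((x : V) + w.2.2.2) ^+ N))|].
have /choice[w hw] : forall k, exists w, bad k w.
  move=> k.
  apply: contrapT => hk; apply: hN; exists k => m p q y km pq Sy.
  by rewrite leNgt; apply/negP => h; apply: hk; exists (m, (p, (q, y))).
pose m k := (w k).1; pose p k := (w k).2.1; pose q k := (w k).2.2.1; pose y k := (w k).2.2.2.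
have km k : (k <= m k)%N by case: (hw k).
have pq k : isotropic (p k) (q k) by case: (hw k).
have Sy k : unit_sphere (y k) by case: (hw k).
have bq k j := bmeas_quad0 (p k) (q k) j mB (@ball_enorm_le1 R n).
have bN k := bmeas_quad (p k) (q k) N (y k) mB (@ball_enorm_le1 R n).
have q0 k x j : 0 <= quad (p k) (q k) x ^+ j by rewrite exprn_ge0// quad_ge0.
have qN k (x : V) : B x -> quad (p k) (q k) (x + y k) ^+ N <= 4 ^+ N.
  move=> Bx; apply: lerXn2r; rewrite ?nnegrE ?quad_ge0//.
  by apply: quad_le4 => //; [exact: ball_enorm_le1|rewrite (Sy k)].
have bF : bmeas B F by have [b1 b2] := bmeas_re_im mf bf; case: hF => ->.
have [_ [C FC]] := bF.
have I0 k : 0 <= I (m k) (p k) (q k) by apply: Rintegral_ge0.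
(* If [I] vanished, so would the bad integral, which is at most [C 4^N I]; this contradicts the
   strict inequality in [bad]. *)
have Igt k : 0 < I (m k) (p k) (q k).
  rewrite lt_neqAle I0 andbT; apply/eqP => I00.
  have [_ _ _] := hw k; rewrite -/(m k) -/(p k) -/(q k) -I00 mulr0 => h; move: h.
  apply/negP; rewrite -leNgt.
  apply: (le_trans (Rint_norm nu mB (bmeasM bF (bmeasM (bq k (m k)) (bN k))))).
  apply: (@le_trans _ _ (\int[nu]_(x in B) (C * 4 ^+ N * quad (p k) (q k) (x : V) ^+ m k))).
    apply: (Rint_le nu mB (bmeas_norm (bmeasM bF (bmeasM (bq k (m k)) (bN k)))) (bmeasZ _ (bq k (m k)))) => x Bx.
    rewrite normrM -mulrA; apply: ler_pM => //; first exact: FC.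
    by rewrite ger0_norm ?mulr_ge0// mulrC ler_wpM2r// qN.
  by rewrite (RintZ nu _ mB (bq k (m k))) -/(I (m k) (p k) (q k)) -I00 mulr0.
have c4 : 0 < 4 ^+ N :> R by rewrite exprn_gt0.
(* The factor with exponent [N] is at most [4^N] on the ball, so this constant brings the norms
   below 1. *)
pose c k := Num.sqrt (4 ^+ N * I (m k) (p k) (q k))^-1.
have cc k : c k ^+ 2 = (4 ^+ N * I (m k) (p k) (q k))^-1.
  by rewrite sqr_sqrtr// invr_ge0 mulr_ge0// ltW.
pose u k := test_fun (c k) (p k) (q k) (y k) (m k) N.
have bu k : harmonic_bergman nu (u k) by exact: bergman_test_fun.
have uM k : sqr_L2norm nu (u k) <= 1.
  rewrite sqr_L2norm_test_fun// cc mulrC ler_pdivrMr ?mulr_gt0// mul1r /I.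
  rewrite -(RintZ nu _ mB (bq k (m k))).
  apply: (Rint_le nu mB (bmeasM (bq k (m k)) (bN k)) (bmeasZ _ (bq k (m k)))) => x Bx.
  by rewrite mulrC ler_wpM2r// qN.
have cu : cvg_locally_uniformly_complex u (fun=> 0).
  move=> t d t1 d0; have [t0|t0] := leP 0 t; last first.
    exists 0%N => k x _ xt; have := enorm_ge0 x; have := le_lt_trans xt t0; lra.
  (* [(3 + t) / 4] has square above [t], as [(1 - t) (9 - t) > 0]. For [|x| <= t] the factor with
     exponent [m] is at most [(t |p|)^(2m)], whereas [I >= K1 K2 (s^2 |p|)^(2m)]: the power of [|p|]
     is common to both, and the remaining ratio tends to 0. *)
  have [s s01 ts] : exists2 s, 0 < s < 1 & t < s * s.
    by exists ((3 + t) / 4); [lra|nra].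
  have [s0 s1] := andP s01; have s2 : 0 < s * s by rewrite mulr_gt0.
  have [K1 K10 hK1] := radial_moment_ge hnu_bdry s01.
  have [K2 K20 hK2] := sphere_moment_ge hsigma s01.
  have dK : 0 < d * (K1 * K2) by rewrite !mulr_gt0.
  have [K hK] : exists K : nat, forall j, (K <= j)%N -> t ^+ j <= d * (K1 * K2) * (s * s) ^+ j.
    by apply: expr_negligible => //; rewrite t0.
  exists K => k x Kk xt; rewrite subr0 normc_test_fun cc.
  have Bx : B x by rewrite /unit_ball/= (le_lt_trans xt).
  have mk : (K <= (m k).*2)%N.
    by rewrite -addnn (leq_trans Kk)// (leq_trans (km k))// leq_addr.
  have hr := hK _ mk.
  have Ik : K1 * K2 * (s * s * enorm (p k)) ^+ (m k).*2 <= I (m k) (p k) (q k).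
    rewrite /I (polar_quad hsigma hnu).
    apply: (le_trans _ (ler_pM _ _ (hK1 (m k)) (hK2 (m k) _ _ (pq k)))).
    - rewrite !exprMn; move: (s ^+ _) (enorm _ ^+ _) => a b; lra.
    - by rewrite mulr_ge0 ?exprn_ge0// ltW.
    - by rewrite mulr_ge0 ?exprn_ge0 ?mulr_ge0 ?enorm_ge0// ltW.
  rewrite mulrC ler_pdivrMr ?mulr_gt0//.
  have qm : quad (p k) (q k) x ^+ m k <= d * I (m k) (p k) (q k).
    have [pq0 pp _] := pq k.
    apply: (@le_trans _ _ ((t * enorm (p k)) ^+ (m k).*2)).
      rewrite -muln2 mulnC exprM; apply: lerXn2r; rewrite ?nnegrE ?quad_ge0 ?sqr_ge0//.
      apply: (le_trans (quad_le pq0 pp x)); rewrite exprMn mulrC.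
      by rewrite ler_wpM2r ?sqr_ge0//; apply: lerXn2r; rewrite ?nnegrE ?enorm_ge0.
    apply: (le_trans _ (ler_wpM2l (ltW d0) Ik)); rewrite (exprMn _ t) (exprMn _ (s * s)).
    have := ler_wpM2r (exprn_ge0 (m k).*2 (enorm_ge0 (p k))) hr.
    by rewrite !mulrA.
  rewrite (mulrC (4 ^+ N)) mulrA; apply: ler_pM => //; exact: qN.
have e4 : 0 < e / 4 ^+ N by rewrite divr_gt0.
have [k [h1 h2]] := compact_small hsigma hnu hnu_bdry n0 mf bf hT bu uM cu e4.
have [_ _ _] := hw k; rewrite -/(m k) -/(p k) -/(q k) -/(y k); apply/negP; rewrite -leNgt.
have h : `|\int[nu]_(x in B) (F x * Normc.normc (u k x) ^+ 2)| <= e / 4 ^+ N.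
  by case: hF => ->.
move: h; under eq_Rintegral => x _ do rewrite normc_test_fun mulrCA.
rewrite (RintZ nu _ mB (bmeasM bF (bmeasM (bq k (m k)) (bN k)))) normrM cc.
have cI := mulr_gt0 c4 (Igt k).
rewrite ger0_norm ?invr_ge0 ?(ltW cI)// => h; have := ler_wpM2l (ltW cI) h.
rewrite mulrA mulfV ?gt_eqF// mul1r => h'; apply: (le_trans h').
by rewrite mulrCA mulrAC divff ?gt_eqF// mul1r.
Qed.

End TestFunctions.

(** * From smallness on the ball to smallness on the sphere *)

Section SphereSmall.
Context {R : realType} {n : nat}.
Local Notation E := (borel_space R n).
Variables sigma nu : probability E R.
Hypothesis hsigma : invariant_probability_on sigma unit_sphere.
Hypothesis hnu : invariant_probability_on nu unit_ball.
Hypothesis hnu_bdry : forall r : R, 0 < r -> r < 1 ->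
  (0 < nu [set x | unit_ball x /\ (r <= enorm x)%R])%E.
Local Notation B := (unit_ball : set E).
Local Notation S := (unit_sphere : set E).
Local Notation V := 'rV[R]_n.
Variables F Fs : E -> R.
Hypotheses (bF : bmeas B F) (bFs : bmeas S Fs).
Hypothesis F_lim : forall e : R, 0 < e -> exists2 s : R, 0 < s < 1 &
  forall (r : R) (z : V), s <= r -> r < 1 -> unit_sphere z -> `|F (r *: z) - Fs z| <= e.

Let mB := @measurable_ball R n.
Let mS := @measurable_sphere R n.
Let nu1 : nu B = 1%E. Proof. by case: hnu. Qed.

Lemma pow_lipschitz (a b : R) N : 0 <= a <= 4 -> 0 <= b <= 4 ->
  `|a ^+ N - b ^+ N| <= N%:R * 4 ^+ N * `|a - b|.
Proof.
move=> /andP[a0 a4] /andP[b0 b4]; elim: N => [|N IH]; first by rewrite !expr0 subrr normr0 !mul0r.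
have -> : a ^+ N.+1 - b ^+ N.+1 = a * (a ^+ N - b ^+ N) + (a - b) * b ^+ N by rewrite !exprS; ring.
rewrite (le_trans (ler_normD _ _))// !normrM (ger0_norm a0) (ger0_norm (exprn_ge0 N b0)).
have h1 : a * `|a ^+ N - b ^+ N| <= 4 * (N%:R * 4 ^+ N * `|a - b|) by exact: ler_pM.
have h2 : `|a - b| * b ^+ N <= `|a - b| * 4 ^+ N by rewrite ler_wpM2l//; apply: lerXn2r; rewrite ?nnegrE.
have h3 : 0 <= `|a - b| * 4 ^+ N by rewrite mulr_ge0// exprn_ge0.
have -> : N.+1%:R * 4 ^+ N.+1 * `|a - b| = 4 * (N%:R * 4 ^+ N * `|a - b|) + 4 * (`|a - b| * 4 ^+ N).
  by rewrite exprS -natr1; ring.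
lra.
Qed.

Hypothesis small : forall (N : nat) (e : R), 0 < e -> exists m0 : nat,
  forall m (p q y : V), (m0 <= m)%N -> isotropic p q -> unit_sphere y ->
    `|\int[nu]_(x in B) (F x * (quad p q (x : V) ^+ m * quad p q ((x : V) + y) ^+ N))| <=
    e * \int[nu]_(x in B) (quad p q (x : V) ^+ m).

Lemma radial_moment_negligible (s c : R) : 0 < s < 1 -> 0 < c -> exists m0 : nat,
  forall m, (m0 <= m)%N -> s ^+ m.*2 <= c * radial_moment nu m.
Proof.
move=> /andP[s0 s1] c0.
have [t t01 st] : exists2 t, 0 < t < 1 & s < t by exists ((1 + s) / 2); lra.
have [t0 t1] := andP t01.
have [K K0 hK] := radial_moment_ge hnu_bdry t01.
have s0t : 0 <= s < t by rewrite ltW.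
have [k hk] := expr_negligible s0t (mulr_gt0 c0 K0).
exists k => m km; have mk : (k <= m.*2)%N by rewrite -addnn (leq_trans km)// leq_addr.
by rewrite (le_trans (hk _ mk))// -mulrA ler_wpM2l// ltW.
Qed.

Let perturbation (C e1 s r : R) N (p q y z : V) : isotropic p q ->
  unit_sphere y -> unit_sphere z -> 0 <= r -> r < 1 ->
  (forall x, B x -> `|F x| <= C) -> s <= r -> `|F (r *: z) - Fs z| <= e1 / 4 ^+ N ->
  C * (N%:R * 4 ^+ N * 8) * (1 - s) <= e1 ->
  `|Fs z * quad p q (z + y) ^+ N - F (r *: z) * quad p q (r *: z + y) ^+ N| <= 2 * e1.
Proof.
move=> pq Sy Sz r0 r1 FC sr h1 Ls; have [_ pp p1] := pq.
have Brz : B (r *: z) by rewrite /unit_ball/= enormZ Sz mulr1 ger0_norm.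
have y1 : enorm y <= 1 by rewrite Sy.
have z1 : enorm z <= 1 by rewrite Sz.
have rz1 : enorm (r *: z) <= 1 by exact: ball_enorm_le1.
have a4 := quad_le4 pq z1 y1; have b4 := quad_le4 pq rz1 y1.
have c4 : 0 < 4 ^+ N :> R by rewrite exprn_gt0.
have C0 : 0 <= C by rewrite (le_trans _ (FC _ Brz)).
have D : C * (N%:R * 4 ^+ N * (8 * (1 - r))) <= e1.
  apply: (le_trans _ Ls); rewrite -!mulrA ler_wpM2l// ler_wpM2l// ler_wpM2l ?(ltW c4)//.
  by rewrite ler_wpM2l// lerB.
have h2 : `|quad p q (z + y) ^+ N - quad p q (r *: z + y) ^+ N| <= N%:R * 4 ^+ N * (8 * (1 - r)).
  apply: (le_trans (pow_lipschitz N _ _)); rewrite ?quad_ge0//.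
  apply: ler_wpM2l; first by rewrite mulr_ge0// ltW.
  have le2 (w : V) : enorm w <= 1 -> enorm (w + y) <= 2.
    by move=> w1; rewrite (le_trans (enormD _ _))// -[leRHS]/(1 + 1) lerD.
  apply: (le_trans (quad_lipschitz pp p1 (le2 _ z1) (le2 _ rz1))).
  have -> : z + y - (r *: z + y) = (1 - r) *: z.
    by rewrite scalerBl scale1r opprD addrACA subrr addr0.
  by rewrite enormZ Sz mulr1 ger0_norm// subr_ge0 ltW.
rewrite (_ : _ - _ = (Fs z - F (r *: z)) * quad p q (z + y) ^+ N +
  F (r *: z) * (quad p q (z + y) ^+ N - quad p q (r *: z + y) ^+ N)); last by ring.
rewrite (le_trans (ler_normD _ _))// !normrM mulr_natl mulr2n lerD//.
  rewrite -[leRHS](divfK (lt0r_neq0 c4)) distrC; apply: ler_pM => //.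
  by rewrite ger0_norm ?exprn_ge0 ?quad_ge0//; apply: lerXn2r; rewrite ?nnegrE ?quad_ge0.
by apply: (le_trans _ D); apply: ler_pM => //; exact: FC.
Qed.

(** After multiplication by the radial moment [D], the claim compares [|x|^(2m) X], integrated over
    the ball, with the spherical means of [G]. For [|x| >= s] they differ little, by the radial
    limit and the Lipschitz bound on [quad]; the ball [|x| < s] weighs at most [s^(2m)], negligible
    against [D]. The factor [J] is carried along and never estimated, which gives uniformity in [p]
    and [q]. *)
Lemma sphere_small (N : nat) (e : R) : 0 < e -> exists m0 : nat,
  forall m (p q y : V), (m0 <= m)%N -> isotropic p q -> unit_sphere y ->
    `|\int[sigma]_(z in S) (Fs z * (quad p q (z : V) ^+ m * quad p q ((z : V) + y) ^+ N))| <=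
    e * \int[sigma]_(z in S) (quad p q (z : V) ^+ m).
Proof.
move=> e0; have [_ [C1 hC1]] := bF; have [_ [C2 hC2]] := bFs.
pose C := `|C1| + `|C2| + 1; have C0 : 0 < C by rewrite ltr_wpDl// addr_ge0.
have FC x : B x -> `|F x| <= C.
  move=> Bx; rewrite (le_trans (hC1 x Bx))// (le_trans (ler_norm _))// /C.
  by have := normr_ge0 C2; lra.
have FsC x : S x -> `|Fs x| <= C.
  move=> Sx; rewrite (le_trans (hC2 x Sx))// (le_trans (ler_norm _))// /C.
  by have := normr_ge0 C1; lra.
have c4 : 0 < 4 ^+ N :> R by rewrite exprn_gt0.
(* The budget: [2 e1] for the passage from radius [|x|] to 1, [e1] for the inner ball, [e1] for the
   hypothesis on the ball. *)
have [e1 e10 ee] : exists2 e1, 0 < e1 & e = 4 * e1 by exists (e / 4); [rewrite divr_gt0|lra].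
have [s1 /andP[s10 s11] hs1] := F_lim (divr_gt0 e10 c4).
pose L := C * (N%:R * 4 ^+ N * 8); have L0 : 0 <= L.
  by rewrite mulr_ge0 ?(ltW C0)// mulr_ge0// mulr_ge0// ltW.
have L1 : 0 < L + 1 by rewrite ltr_wpDl.
have [s s01 [s1s Ls]] : exists2 s, 0 < s < 1 & s1 <= s /\ L * (1 - s) <= e1.
  have [d d0 [d1 d2]] : exists2 d, 0 < d & d <= 1 - s1 /\ d * (L + 1) <= e1.
    exists (Num.min (1 - s1) (e1 / (L + 1))).
      by rewrite lt_min subr_gt0 s11 divr_gt0.
    by rewrite -ler_pdivlMr// !ge_min !lexx orbT.
  exists (1 - d); first by apply/andP; split; lra.
  split; first lra.
  nra.
have [s0 ss1] := andP s01.
have K0 : 0 < e1 / (2 * C * 4 ^+ N) by rewrite divr_gt0// !mulr_gt0.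
have [m1 hm1] := radial_moment_negligible s01 K0.
have [m2 hm2] := small N e10.
exists (maxn m1 m2) => m p q y; rewrite geq_max => /andP[mm1 mm2] pq Sy.
have [pq0 pp p1] := pq.
set J := \int[sigma]_(z in S) (quad p q (z : V) ^+ m).
set D := radial_moment nu m.
have b1 := bmeas_quad0 p q m mS (@sphere_enorm_le1 R n).
have b2 := bmeas_quad p q N y mS (@sphere_enorm_le1 R n).
have J0 : 0 <= J by apply: Rintegral_ge0 => z _; rewrite exprn_ge0// quad_ge0.
have D0 : 0 < D.
  by have := lt_le_trans (exprn_gt0 m.*2 s0) (hm1 m mm1); rewrite pmulr_rgt0.
set X := \int[sigma]_(z in S) _.
have bX := bmeasM bFs (bmeasM b1 b2).
pose G (x : E) := F x * (quad p q (x : V) ^+ m * quad p q ((x : V) + y) ^+ N).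
have bG : bmeas B G.
  apply: (bmeasM bF (bmeasM _ _)); first exact: (bmeas_quad0 p q m mB (@ball_enorm_le1 R n)).
  exact: (bmeas_quad p q N y mB (@ball_enorm_le1 R n)).
have bGp : bmeas (B `*` S) (G \o polar) by exact: bmeas_polar.
have hG := hm2 m p q y mm2 pq Sy.
rewrite (polar_quad hsigma hnu) -/J -/D -/G (polar_Rint hsigma hnu bG) in hG.
have bR := @bmeas_radial R n m.
have key x : B x -> `|enorm (x : V) ^+ m.*2 * X - \int[sigma]_(z in S) G (polar (x, z))| <=
    (2 * e1) * J * enorm (x : V) ^+ m.*2 + 2 * C * 4 ^+ N * J * s ^+ m.*2.
  move=> Bx; set r := enorm (x : V); have r0 : 0 <= r by exact: enorm_ge0.
  have r1 : r < 1 by [].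
  have rm0 : 0 <= r ^+ m.*2 by rewrite exprn_ge0.
  have bGx : bmeas S (fun z => G (polar (x, z))) := bmeas_section1 mB mS Bx bGp.
  rewrite -(RintZ sigma _ mS bX) -(RintB sigma mS (bmeasZ _ bX) bGx).
  rewrite (le_trans (Rint_norm sigma mS (bmeasB (bmeasZ _ bX) bGx)))//.
  pose c := 2 * e1 * r ^+ m.*2 + 2 * C * 4 ^+ N * s ^+ m.*2.
  have -> : 2 * e1 * J * r ^+ m.*2 + 2 * C * 4 ^+ N * J * s ^+ m.*2 = c * J.
    by rewrite /c; move: (4 ^+ N) (s ^+ m.*2) (r ^+ m.*2) => a b d; ring.
  rewrite -(RintZ sigma _ mS b1).
  apply: (Rint_le sigma mS (bmeas_norm (bmeasB (bmeasZ _ bX) bGx)) (bmeasZ _ b1)) => z Sz.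
  rewrite /G /polar /= -/r quadZ exprMn -exprM mul2n.
  have B' : B (r *: (z : V)) by rewrite /unit_ball/= enormZ Sz mulr1 ger0_norm.
  set Q := quad p q (z + y) ^+ N; set Q' := quad p q (r *: _ + y) ^+ N.
  set q0 := quad p q z ^+ m.
  have q00 : 0 <= q0 by rewrite exprn_ge0// quad_ge0.
  rewrite (_ : _ - _ = r ^+ m.*2 * (Fs z * Q - F (r *: (z : V)) * Q') * q0); last by ring.
  rewrite normrM (ger0_norm q00) ler_wpM2r// normrM (ger0_norm rm0).
  have z1 : enorm (z : V) <= 1 by rewrite Sz.
  have y1 : enorm y <= 1 by rewrite Sy.
  have rz1 : enorm (r *: (z : V)) <= 1 by exact: ball_enorm_le1.
  have a4 := quad_le4 pq z1 y1; have b4 := quad_le4 pq rz1 y1.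
  have Q0 : 0 <= Q by rewrite exprn_ge0// quad_ge0.
  have Q'0 : 0 <= Q' by rewrite exprn_ge0// quad_ge0.
  have Q4 : Q <= 4 ^+ N by apply: lerXn2r; rewrite ?nnegrE ?quad_ge0.
  have Q'4 : Q' <= 4 ^+ N by apply: lerXn2r; rewrite ?nnegrE ?quad_ge0.
  have u0 : 0 <= 2 * C * 4 ^+ N * s ^+ m.*2.
    by rewrite mulr_ge0 ?exprn_ge0 ?(ltW s0)// mulr_ge0 ?(ltW c4)// mulr_ge0// ltW.
  have v0 : 0 <= 2 * e1 * r ^+ m.*2 by rewrite mulr_ge0// mulr_ge0// ltW.
  have [sr|rs] := leP s r; last first.
    have h1 : `|Fs z * Q - F (r *: (z : V)) * Q'| <= 2 * C * 4 ^+ N.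
      rewrite (le_trans (ler_normB _ _))// !normrM (ger0_norm Q0) (ger0_norm Q'0).
      have k1 : `|Fs z| * Q <= C * 4 ^+ N by apply: ler_pM => //; exact: FsC.
      have k2 : `|F (r *: (z : V))| * Q' <= C * 4 ^+ N by apply: ler_pM => //; exact: FC.
      by rewrite -mulrA mulr_natl mulr2n lerD.
    have h2 : r ^+ m.*2 <= s ^+ m.*2 by apply: lerXn2r; rewrite ?nnegrE ?(ltW s0) ?(ltW rs).
    by rewrite (le_trans (ler_pM _ _ h2 h1))// mulrC lerDr.
  have h1 : `|F (r *: (z : V)) - Fs z| <= e1 / 4 ^+ N by rewrite hs1// (le_trans s1s).
  have h3 := perturbation pq Sy Sz r0 r1 FC sr h1 Ls.
  by rewrite (le_trans (ler_wpM2l rm0 h3))// mulrC lerDl.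
have bI : bmeas B (fun x : E => \int[sigma]_(z in S) G (polar (x, z))).
  exact: (bmeas_Rint1 nu sigma mB mS bGp).
have DX : D * X = \int[nu]_(x in B) (enorm (x : V) ^+ m.*2 * X).
  rewrite mulrC -(RintZ nu _ mB bR); apply: Rint_eq => x _; exact: mulrC.
have bRX : bmeas B (fun x : E => enorm (x : V) ^+ m.*2 * X) by apply: bmeasM => //; exact: bmeas_cst.
have hD : `|D * X - \int[nu]_(x in B) \int[sigma]_(z in S) G (polar (x, z))| <= 3 * e1 * J * D.
  rewrite DX -(RintB nu mB bRX bI) (le_trans (Rint_norm nu mB (bmeasB bRX bI)))//.
  have bK := bmeasZ (2 * e1 * J) bR.
  have bc := bmeas_cst B (2 * C * 4 ^+ N * J * s ^+ m.*2).
  apply: (le_trans (Rint_le nu mB (bmeas_norm (bmeasB bRX bI)) (bmeasD bK bc) key)).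
  rewrite (RintD nu mB bK bc) (RintZ nu _ mB bR) (Rint_cst _ mB nu1) -/(radial_moment nu m) -/D.
  have cJ : 0 <= 2 * C * 4 ^+ N * J by rewrite mulr_ge0// mulr_ge0 ?(ltW c4)// mulr_ge0// ltW.
  have := ler_wpM2l cJ (hm1 m mm1).
  have -> : 2 * C * 4 ^+ N * J * (e1 / (2 * C * 4 ^+ N) * radial_moment nu m) = e1 * J * D.
    by rewrite -/D; field; rewrite !gt_eqF.
  lra.
have hh : `|D * X| <= e * J * D.
  have := ler_normD (D * X - \int[nu]_(x in B) \int[sigma]_(z in S) G (polar (x, z)))
    (\int[nu]_(x in B) \int[sigma]_(z in S) G (polar (x, z))).
  rewrite subrK ee; move: hD hG; lra.
by move: hh; rewrite normrM (ger0_norm (ltW D0)) (mulrC D) ler_pM2r.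
Qed.

End SphereSmall.

(** * Necessity: averaging over isotropic vectors *)

Section ProductIntegrals.
Context d1 d2 (T1 : measurableType d1) (T2 : measurableType d2) (R : realType).
Variables (P1 : probability T1 R) (P2 : probability T2 R).
Variables (D1 : set T1) (D2 : set T2).
Hypotheses (mD1 : measurable D1) (mD2 : measurable D2).

Lemma product_probability_full : P1 D1 = 1%E -> P2 D2 = 1%E ->
  (P1 \x P2)%E (D1 `*` D2) = 1%E.
Proof.
move=> h1 h2; transitivity (P1 D1 * P2 D2)%E; first exact: product_measure1E.
by rewrite h1 h2 mule1.
Qed.

Lemma Rint_prodM (g : T1 -> R) (h : T2 -> R) : bmeas D1 g -> bmeas D2 h ->
  \int[(P1 \x P2)%E]_(z in D1 `*` D2) (g z.1 * h z.2) =
  (\int[P1]_(x in D1) g x) * \int[P2]_(y in D2) h y.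
Proof.
move=> bg bh.
rewrite (Rint_prod P1 P2 mD1 mD2 (bmeasM (bmeas_fst D2 mD1 bg) (bmeas_snd D1 mD2 bh))).
rewrite mulrC -(RintZ P1 _ mD1 bg); apply: Rint_eq => x D1x /=.
by rewrite mulrC -(RintZ P2 _ mD2 bh).
Qed.

End ProductIntegrals.

Section Preserves.
Context {R : realType}.

(** Invariance is phrased through integrals of bounded functions so that it passes to product
    measures by Fubini's theorem. *)
Definition preserves d (T : measurableType d) (P : probability T R) (D : set T)
    (phi : T -> T) :=
  [/\ measurable_fun setT phi, forall x, D (phi x) <-> D x &
    forall g, bmeas D g -> \int[P]_(x in D) g (phi x) = \int[P]_(x in D) g x].

Lemma preserves_prod d1 d2 (T1 : measurableType d1) (T2 : measurableType d2)
    (P1 : probability T1 R) (P2 : probability T2 R) (D1 : set T1) (D2 : set T2)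
    (phi1 : T1 -> T1) (phi2 : T2 -> T2) : measurable D1 -> measurable D2 ->
  preserves P1 D1 phi1 -> preserves P2 D2 phi2 ->
  preserves (P1 \x P2)%E (D1 `*` D2) (fun z => (phi1 z.1, phi2 z.2)).
Proof.
move=> mD1 mD2 h1 h2; have [mp1 hD1 i1] := h1; have [mp2 hD2 i2] := h2.
have mphi : measurable_fun setT (fun z : T1 * T2 => (phi1 z.1, phi2 z.2)).
  apply/measurable_fun_pair => /=.
    exact: measurableT_comp mp1 measurable_fst.
  exact: measurableT_comp mp2 measurable_snd.
have hD z : (D1 `*` D2) (phi1 z.1, phi2 z.2) <-> (D1 `*` D2) z.
  by split=> -[/= /hD1 ? /hD2 ?].
split => // g bg.
have bg' : bmeas (D1 `*` D2) (fun z => g (phi1 z.1, phi2 z.2)).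
  have [mg [M gM]] := bg; split; last by exists M => x /hD; exact: gM.
  apply: (@measurable_comp _ _ _ _ _ _ (D1 `*` D2) g (D1 `*` D2)
    (fun z => (phi1 z.1, phi2 z.2))) => //; last exact: measurable_funTS.
    exact: measurableX.
  by move=> _ [x Dx <-]; exact/hD.
rewrite (Rint_prod P1 P2 mD1 mD2 bg') (Rint_prod P1 P2 mD1 mD2 bg) /=.
rewrite -(i1 _ (bmeas_Rint1 P1 P2 mD1 mD2 bg)); apply: Rint_eq => x D1x.
have D1x' : D1 (phi1 x) by exact/hD1.
exact: (i2 _ (bmeas_section1 mD1 mD2 D1x' bg)).
Qed.

Lemma preserves_orth n (mu : probability (borel_space R n) R) (D : set (borel_space R n))
    (A : 'M[R]_n) : orthogonal_invariant mu -> A *m A^T = 1%:M -> measurable D ->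
  (forall x : 'rV[R]_n, D (x *m A) <-> D x) ->
  preserves mu D (fun x => (x : 'rV[R]_n) *m A).
Proof.
move=> hmu hA mD DA; split => //; last by move=> g bg; exact: (invariant_Rint hmu hA mD DA bg).
exact: measurable_mulmx.
Qed.

Lemma measurable_dotp d (T : measurableType d) n (g h : T -> borel_space R n) :
  measurable_fun setT g -> measurable_fun setT h ->
  measurable_fun setT (fun t => dotp (g t : 'rV[R]_n) (h t : 'rV[R]_n)).
Proof.
move=> mg mh; rewrite /dotp; apply: measurable_sum => i.
by apply: measurable_funM; [exact: measurableT_comp (coord_measurable i) mg|
  exact: measurableT_comp (coord_measurable i) mh].
Qed.

Lemma measurable_rowD d (T : measurableType d) n (g h : T -> borel_space R n) :
  measurable_fun setT g -> measurable_fun setT h ->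
  measurable_fun setT (fun t => (g t : 'rV[R]_n) + (h t : 'rV[R]_n) : borel_space R n).
Proof.
move=> mg mh; apply: measurable_to_borel => i.
rewrite (_ : (fun t => _) = fun t => (g t : 'rV[R]_n) 0 i + (h t : 'rV[R]_n) 0 i).
  by apply: measurable_funD; [exact: measurableT_comp (coord_measurable i) mg|
    exact: measurableT_comp (coord_measurable i) mh].
by apply/funext => t; rewrite mxE.
Qed.

End Preserves.

Section BilinearForm.
Context {R : realType} {n : nat}.
Local Notation V := 'rV[R]_n.
Implicit Types a b x y : V.

(** For unit [a] and [b] this is [quad] of their Gram-Schmidt pair with the square root expanded
    away. Being a polynomial in inner products, it is visibly measurable and invariant under
    simultaneous rotation. *)
Definition pair_quad a b x : R :=
  dotp x a ^+ 2 + dotp x b ^+ 2 - 2 * (dotp a b * (dotp x a * dotp x b)).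

(* Gram-Schmidt turns two unit vectors into an orthogonal pair of vectors of
   the same norm. *)
Definition pair_fst a b : V := Num.sqrt (1 - dotp a b ^+ 2) *: a.
Definition pair_snd a b : V := b - dotp a b *: a.

Lemma pair_quad_orth (A : 'M[R]_n) a b x : A *m A^T = 1%:M ->
  pair_quad (a *m A) (b *m A) (x *m A) = pair_quad a b x.
Proof. by move=> hA; rewrite /pair_quad !dotp_orth. Qed.

Section UnitVectors.
Variables a b : V.
Hypotheses (Sa : unit_sphere a) (Sb : unit_sphere b).

Let aa : dotp a a = 1. Proof. by rewrite -sqr_enorm Sa expr1n. Qed.
Let bb : dotp b b = 1. Proof. by rewrite -sqr_enorm Sb expr1n. Qed.

Let c1 : dotp a b ^+ 2 <= 1.
Proof. by have := sqr_dotp_le a b; rewrite aa bb mulr1. Qed.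

Let sqr_rho : Num.sqrt (1 - dotp a b ^+ 2) ^+ 2 = 1 - dotp a b ^+ 2.
Proof. by rewrite sqr_sqrtr// subr_ge0. Qed.

Lemma isotropic_pair : isotropic (pair_fst a b) (pair_snd a b).
Proof.
split.
- by rewrite dotpZl dotpBr dotpZr aa mulr1 subrr mulr0.
- rewrite /pair_fst /pair_snd dotpZl dotpZr mulrA -expr2 sqr_rho aa.
  by rewrite dotpBl !dotpBr !dotpZl !dotpZr (dotpC b a) aa bb; ring.
- rewrite enormE dotpZl dotpZr mulrA -expr2 sqr_rho aa mulr1 -[leRHS]sqrtr1.
  by rewrite ler_wsqrtr// gerBl sqr_ge0.
Qed.

Lemma pair_quadE x : pair_quad a b x = quad (pair_fst a b) (pair_snd a b) x.
Proof.
rewrite /quad /pair_fst /pair_snd dotpZr exprMn sqr_rho dotpBr dotpZr /pair_quad.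
ring.
Qed.

Lemma pair_quad_ge0 x : 0 <= pair_quad a b x.
Proof. by rewrite pair_quadE quad_ge0. Qed.

Lemma pair_quad_le x : pair_quad a b x <= enorm x ^+ 2.
Proof.
have [pq pp p1] := isotropic_pair; rewrite pair_quadE (le_trans (quad_le pq pp x))//.
by rewrite ler_piMl ?sqr_ge0// expr_le1// enorm_ge0.
Qed.

Lemma pair_quad_lipschitz x y : enorm x <= 2 -> enorm y <= 2 ->
  `|pair_quad a b x - pair_quad a b y| <= 8 * enorm (x - y).
Proof.
by move=> x2 y2; have [pq pp p1] := isotropic_pair; rewrite !pair_quadE quad_lipschitz.
Qed.

Lemma pair_quad_ge x : (1 - dotp a b ^+ 2) * dotp x a ^+ 2 <= pair_quad a b x.
Proof.
by rewrite pair_quadE /quad /pair_fst dotpZr exprMn sqr_rho lerDl sqr_ge0.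
Qed.

End UnitVectors.

(** The image of a second coordinate vector under an orthogonal map that sends the first to [a]. In
    dimension one [pair_quad] is 0 for all unit [a] and [b], so the averages below would have no
    mass. *)
Lemma orthogonal_unit_vector a : (1 < n)%N -> unit_sphere a ->
  exists2 b : V, unit_sphere b & dotp a b = 0.
Proof.
move=> n1 Sa; pose i0 : 'I_n := Ordinal (ltnW n1); pose i1 : 'I_n := Ordinal n1.
have [|A hA eA] := @orthogonal_transitive R n (delta_mx 0 i0) a.
  by rewrite enorm_delta Sa.
exists (delta_mx 0 i1 *m A); first by rewrite /unit_sphere/= enorm_orth// enorm_delta.
by rewrite -eA dotp_orth// dotp_delta mxE andbF.
Qed.

End BilinearForm.

Section Averaging.
Context {R : realType} {n : nat}.
Local Notation E := (borel_space R n).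
Variable sigma : probability E R.
Hypothesis hsigma : invariant_probability_on sigma unit_sphere.
Hypothesis n1 : (1 < n)%N.
Local Notation S := (unit_sphere : set E).
Local Notation V := 'rV[R]_n.

Let mS := @measurable_sphere R n.
Let S1 : sigma S = 1%E. Proof. by case: hsigma. Qed.

Let P2 : probability (E * E)%type R := (sigma \x sigma)%E.
Let P : probability (E * (E * E))%type R := (sigma \x P2)%E.
Local Notation SS := (S `*` S).
Local Notation O := (S `*` SS).

Let mSS : measurable SS. Proof. exact: measurableX. Qed.
Let mO : measurable O. Proof. exact: measurableX. Qed.
Let SS1 : P2 SS = 1%E. Proof. exact: product_probability_full. Qed.
Let mass (z : E) (w : E * E) : R := pair_quad (w.1 : V) (w.2 : V) (z : V).
(** [z] is the variable integrated against [Fs]; [w] consists of the centre [y] and the two unit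
    vectors. Averaged over these vectors, and up to a constant, this is the approximate identity
    that [mean_kernel] applies to [phi]. *)
Let kernel m N (z : E) (w : E * (E * E)) : R :=
  mass z w.2 ^+ m * mass ((z : V) + (w.1 : V)) w.2 ^+ N.

Let measurable_pair_quad d (T : measurableType d) (g h k : T -> E) :
  measurable_fun setT g -> measurable_fun setT h -> measurable_fun setT k ->
  measurable_fun setT (fun t => pair_quad (g t : V) (h t : V) (k t : V)).
Proof.
move=> mg mh mk.
have m1 := measurable_dotp mk mg; have m2 := measurable_dotp mk mh.
have m3 := measurable_dotp mg mh.
apply: measurable_funB.
  by apply: measurable_funD; apply: measurable_funX.
apply: measurable_funM => //; apply: measurable_funM => //; exact: measurable_funM.
Qed.

Let sphere_sum_le (z y : E) : S z -> S y -> enorm ((z : V) + (y : V)) <= 2.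
Proof. by move=> Sz Sy; have := enormD (z : V) (y : V); rewrite Sz Sy; lra. Qed.

Let mass_le1 z w : S z -> SS w -> 0 <= mass z w <= 1.
Proof.
move=> Sz [Sa Sb]; rewrite /mass pair_quad_ge0//=.
by rewrite (le_trans (pair_quad_le Sa Sb _))// Sz expr1n.
Qed.

Let mass_le4 (z y : E) w : S z -> S y -> SS w -> 0 <= mass ((z : V) + (y : V)) w <= 4.
Proof.
move=> Sz Sy [Sa Sb]; rewrite /mass pair_quad_ge0//=.
rewrite (le_trans (pair_quad_le Sa Sb _))// (_ : 4 = 2 ^+ 2); last by ring.
by apply: lerXn2r; rewrite ?nnegrE ?enorm_ge0// sphere_sum_le.
Qed.

Let bmeas_mass2 m : bmeas (S `*` O) (fun t : E * (E * (E * E)) => mass t.1 t.2.2 ^+ m).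
Proof.
apply: bmeasX; split.
  apply: measurable_funTS; apply: measurable_pair_quad; last exact: measurable_fst.
    exact: (measurableT_comp measurable_fst (measurableT_comp measurable_snd measurable_snd)).
  exact: (measurableT_comp measurable_snd (measurableT_comp measurable_snd measurable_snd)).
exists 1 => -[z [y w]] [/= Sz [Sy Sw]]; have /andP[h0 h1] := mass_le1 Sz Sw.
by rewrite ger0_norm.
Qed.

Let bmeas_kernel2 m N : bmeas (S `*` O) (fun t : E * (E * (E * E)) => kernel m N t.1 t.2).
Proof.
apply: (bmeasM (bmeas_mass2 m)); apply: bmeasX; split.
  apply: measurable_funTS; apply: measurable_pair_quad.
  - exact: (measurableT_comp measurable_fst (measurableT_comp measurable_snd measurable_snd)).
  - exact: (measurableT_comp measurable_snd (measurableT_comp measurable_snd measurable_snd)).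
  - apply: measurable_rowD; first exact: measurable_fst.
    exact: measurableT_comp measurable_fst measurable_snd.
exists 4 => -[z [y w]] [/= Sz [Sy Sw]]; have /andP[h0 h1] := mass_le4 Sz Sy Sw.
by rewrite ger0_norm.
Qed.

Let bmeas_kernel m N z : S z -> bmeas O (kernel m N z).
Proof. by move=> Sz; exact: (bmeas_section1 mS mO Sz (bmeas_kernel2 m N)). Qed.

Let bmeas_massO m z : S z -> bmeas O (fun w => mass z w.2 ^+ m).
Proof. by move=> Sz; exact: (bmeas_section1 mS mO Sz (bmeas_mass2 m)). Qed.

Let bmeas_mass m z : S z -> bmeas SS (fun w => mass z w ^+ m).
Proof.
by move=> Sz; have [e Se] := sphere_neq0 hsigma; exact: (bmeas_section1 mS mSS Se (bmeas_massO m Sz)).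
Qed.

Let kernel_ge0 m N z w : S z -> O w -> 0 <= kernel m N z w.
Proof.
case: w => y w Sz [/= Sy Sw]; have /andP[h0 _] := mass_le1 Sz Sw.
by have /andP[k0 _] := mass_le4 Sz Sy Sw; rewrite mulr_ge0// exprn_ge0.
Qed.

Let total m N z := \int[P]_(w in O) kernel m N z w.
Let moment m z := \int[P]_(w in O) (mass z w.2 ^+ m).

Let orth_preserves (A : 'M[R]_n) : A *m A^T = 1%:M ->
  preserves P O (fun w => ((w.1 : V) *m A, ((w.2.1 : V) *m A, (w.2.2 : V) *m A))).
Proof.
move=> hA; have [_ _ hinv] := hsigma.
have h1 : preserves sigma S (fun x => (x : V) *m A).
  apply: preserves_orth => // x.
  by rewrite /unit_sphere/= enorm_orth.
exact: (preserves_prod mS mSS h1 (preserves_prod mS mS h1 h1)).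
Qed.

(** [P] is invariant under rotating the three vectors of [w] together, and some rotation takes [z]
    to [z']. So [total] and [moment] are constant on the sphere and leave the integrals over [z]. *)
Let zonal (g : E -> E * (E * E) -> R) : (forall z, S z -> bmeas O (g z)) ->
  (forall (A : 'M[R]_n) z y a b, A *m A^T = 1%:M ->
    g ((z : V) *m A) ((y : V) *m A, ((a : V) *m A, (b : V) *m A)) = g z (y, (a, b))) ->
  forall z z', S z -> S z' -> \int[P]_(w in O) g z w = \int[P]_(w in O) g z' w.
Proof.
move=> bg hg z z' Sz Sz'.
have [A hA eA] := @orthogonal_transitive R n z z' (etrans Sz (esym Sz')).
have [_ _ hp] := orth_preserves hA.
rewrite -(hp _ (bg _ Sz')); apply: Rint_eq => -[y [a b]] _ /=.
by rewrite -eA hg.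
Qed.

Let total_zonal m N z z' : S z -> S z' -> total m N z = total m N z'.
Proof.
apply: (@zonal (kernel m N)); first exact: bmeas_kernel.
move=> A x y a b hA; rewrite /kernel /mass /= -mulmxDl !pair_quad_orth//.
Qed.

Let moment_zonal m z z' : S z -> S z' -> moment m z = moment m z'.
Proof.
apply: (@zonal (fun z w => mass z w.2 ^+ m)); first by move=> x; exact: bmeas_massO.
by move=> A x y a b hA; rewrite /mass /= pair_quad_orth.
Qed.

Let momentE m z : S z -> moment m z = \int[P2]_(w in SS) (mass z w ^+ m).
Proof.
move=> Sz; transitivity (\int[P]_(w in O) (1 * mass z w.2 ^+ m)).
  by apply: Rint_eq => w _; rewrite mul1r.
rewrite (Rint_prodM sigma P2 mS mSS (bmeas_cst S 1) (bmeas_mass m Sz)).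
by rewrite (Rint_cst 1 mS S1) mul1r.
Qed.

Let Rint_cap (z : E) t : \int[sigma]_(y in S) \1_(cap (z : V) t) y = fine (sigma (cap (z : V) t)).
Proof.
rewrite Rint_indic//; last exact: measurable_cap.
by congr fine; apply: measureI_full => //; exact: measurable_cap.
Qed.

Let fine_cap_gt0 (z : E) t : S z -> 0 < t -> 0 < fine (sigma (cap (z : V) t)).
Proof.
move=> Sz t0; rewrite fine_gt0// (cap_gt0 hsigma Sz t0)/= ltey_eq fin_num_measure//.
exact: measurable_cap.
Qed.

Let cap_dotp (z y : E) t : S z -> S y -> cap (z : V) t y -> 0 <= t ->
  1 - t ^+ 2 / 2 <= dotp (z : V) (y : V).
Proof.
move=> Sz Sy zy t0; have h : enorm ((z : V) - (y : V)) ^+ 2 <= t ^+ 2.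
  by apply: lerXn2r; rewrite ?nnegrE ?enorm_ge0//; exact: ltW.
move: h; rewrite sqr_enormB Sz Sy; lra.
Qed.

(** If [a] is close to [z] and [b] is close to a unit vector orthogonal to [z], then [a.b] is small
    and [z.a] is close to 1, so [pair_quad] is close to its maximum 1. *)
Let moment_ge (s : R) z : 0 < s < 1 -> S z -> exists2 K : R, 0 < K &
  forall m, K * s ^+ m <= moment m z.
Proof.
move=> /andP[s0 s1] Sz; have [b0 Sb0 zb0] := orthogonal_unit_vector n1 Sz.
(* On these caps [(a.b)^2 <= 4 t^2] and [(z.a)^2 >= 1 - t^2], so the mass is at least
   [1 - 5 t^2 >= 1 - 5 t >= s]. *)
have [t t0 [t1 ts]] : exists2 t : R, 0 < t & t <= 1 /\ 5 * t <= 1 - s.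
  by exists ((1 - s) / 5); lra.
exists (fine (sigma (cap (z : V) t)) * fine (sigma (cap b0 t))).
  by rewrite mulr_gt0// fine_cap_gt0.
move=> m; rewrite (momentE m Sz) -!Rint_cap.
have ba : bmeas S (\1_(cap (z : V) t) : E -> R) by apply: bmeas_indic; exact: measurable_cap.
have bb : bmeas S (\1_(cap b0 t) : E -> R) by apply: bmeas_indic; exact: measurable_cap.
rewrite -(Rint_prodM sigma sigma mS mS ba bb) mulrC.
have bab := bmeasM (bmeas_fst S mS ba) (bmeas_snd S mS bb).
rewrite -(RintZ P2 _ mSS bab).
apply: (Rint_le P2 mSS (bmeasZ _ bab) (bmeas_mass m Sz)) => -[a b] Sab; have [/= Sa Sb] := Sab.
have /andP[h0 _] := mass_le1 Sz Sab.
rewrite !indicE; have [/set_mem za|_] := boolP (a \in _); last by rewrite mul0r mulr0 exprn_ge0.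
have [/set_mem bb0|_] := boolP (b \in _); last by rewrite !mulr0 exprn_ge0.
rewrite !mulr1; apply: lerXn2r; rewrite ?nnegrE ?(ltW s0)//.
apply: (le_trans _ (pair_quad_ge Sa Sb (z : V))).
have h1 := cap_dotp Sz Sa za (ltW t0).
have h2 : `|dotp (a : V) (b : V)| <= 2 * t.
  have -> : dotp (a : V) (b : V) = dotp ((a : V) - (z : V)) (b : V) + dotp (z : V) ((b : V) - b0).
    by rewrite dotpBl dotpBr zb0 subr0 subrK.
  have k1 := dotp_le ((a : V) - (z : V)) (b : V); have k2 := dotp_le (z : V) ((b : V) - b0).
  rewrite Sb mulr1 enormB in k1; rewrite Sz mul1r enormB in k2.
  have k3 : enorm ((z : V) - (a : V)) < t by exact: za.
  have k4 : enorm (b0 - (b : V)) < t by exact: bb0.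
  by rewrite (le_trans (ler_normD _ _))//; lra.
have h3 : dotp (a : V) (b : V) ^+ 2 <= 4 * t ^+ 2.
  move: h2; rewrite ler_norml => /andP[]; nra.
have tt : t ^+ 2 <= t by rewrite expr2 ler_piMl// ltW.
have h4 : (1 - t ^+ 2 / 2) ^+ 2 <= dotp (z : V) (a : V) ^+ 2.
  by apply: lerXn2r; rewrite ?nnegrE //; nra.
have h5 : 0 <= dotp (z : V) (a : V) ^+ 2 by rewrite sqr_ge0.
have h6 : dotp (z : V) (a : V) ^+ 2 <= 1.
  by have := sqr_dotp_le (z : V) (a : V); rewrite -!sqr_enorm Sz Sa expr1n mulr1.
have h7 : 1 - t ^+ 2 <= dotp (z : V) (a : V) ^+ 2.
  apply: le_trans h4; have := sqr_ge0 (t ^+ 2); rewrite -exprM; nra.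
move: h3 h5 h6 h7; move: (dotp _ _ ^+ 2) (dotp _ _ ^+ 2) => A B; nra.
Qed.

Let moment_gt0 m z : S z -> 0 < moment m z.
Proof.
move=> Sz; have s01 : 0 < (1 / 2 : R) < 1 by lra.
have [K K0 hK] := moment_ge s01 Sz.
by apply: lt_le_trans (hK m); rewrite mulr_gt0// exprn_gt0//; lra.
Qed.

(** Pairs with mass below [s] contribute at most [s^m], that is at most half of the moment for large
    [m]; the other half comes from pairs with mass at least [s]. *)
Let moment_concentrates (s : R) z : 0 < s < 1 -> S z -> exists m0 : nat,
  forall m, (m0 <= m)%N -> 2 * s ^+ m <= moment m z.
Proof.
move=> /andP[s0 s1] Sz.
have [t t01 st] : exists2 t, 0 < t < 1 & s < t by exists ((1 + s) / 2); lra.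
have [t0 t1] := andP t01.
have [K K0 hK] := moment_ge t01 Sz.
have s0t : 0 <= s < t by rewrite ltW.
have [k hk] := expr_negligible s0t (divr_gt0 K0 (ltr0n _ 2)).
by exists k => m /hk; have := hK m; lra.
Qed.

(* For [y] close to [z] the kernel is at least [(4 - 12 eta)^N mass^m] where
   [mass >= 1 - eta]; elsewhere [mass^m - (1 - eta)^m] is negative. *)
Let total_ge (eta : R) m N z : 0 < eta < 1 / 3 -> S z -> 2 * (1 - eta) ^+ m <= moment m z ->
  fine (sigma (cap (z : V) eta)) * (4 - 12 * eta) ^+ N * (moment m z / 2) <= total m N z.
Proof.
move=> /andP[eta0 eta1] Sz hm.
have bc : bmeas S (\1_(cap (z : V) eta) : E -> R) by apply: bmeas_indic; exact: measurable_cap.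
have bm := bmeasB (bmeas_mass m Sz) (bmeas_cst SS ((1 - eta) ^+ m)).
pose c := (4 - 12 * eta) ^+ N; have c0 : 0 <= c by rewrite exprn_ge0//; lra.
have bcm := bmeasM (bmeas_fst SS mS bc) (bmeas_snd S mSS (bmeasZ c bm)).
apply: (@le_trans _ _ (\int[P]_(w in O) (\1_(cap (z : V) eta) w.1 *
    (c * (mass z w.2 ^+ m - (1 - eta) ^+ m))))).
  rewrite (Rint_prodM sigma P2 mS mSS bc (bmeasZ c bm)) Rint_cap (RintZ P2 _ mSS bm).
  rewrite (RintB P2 mSS (bmeas_mass m Sz) (bmeas_cst _ _)) (Rint_cst _ mSS SS1) -(momentE m Sz).
  rewrite -mulrA; apply: ler_wpM2l; first exact: fine_ge0.
  by apply: ler_wpM2l => //; lra.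
apply: (Rint_le P mO bcm (bmeas_kernel m N Sz)) => -[y w] Oyw; have [/= Sy Sw] := Oyw.
rewrite indicE; have [/set_mem zy|_] := boolP (y \in _); last first.
  by rewrite mul0r; exact: kernel_ge0.
rewrite mul1r; have [h|h] := leP (1 - eta) (mass z w); last first.
  apply: (@le_trans _ _ 0); last exact: (kernel_ge0 m N Sz Oyw).
  rewrite mulr_ge0_le0// subr_le0; apply: lerXn2r; rewrite ?nnegrE ?(ltW h)//; last by lra.
  by have /andP[] := mass_le1 Sz Sw.
have /andP[q0 q1] := mass_le1 Sz Sw.
rewrite /kernel /= mulrC; apply: ler_pM => //.
- by rewrite subr_ge0; apply: lerXn2r; rewrite ?nnegrE//; lra.
- by rewrite gerBl exprn_ge0//; lra.
apply: lerXn2r; rewrite ?nnegrE; [lra| |].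
  by have /andP[] := mass_le4 Sz Sy Sw.
have [Sa Sb] := Sw.
(* The source of [4 - 12 eta]: the mass at [z + z] is at least [4 - 4 eta], and moving from [z + z]
   to [z + y] costs at most [8 eta]. *)
have e2 : mass ((z : V) + (z : V)) w = 4 * mass z w.
  by rewrite /mass /pair_quad !dotpDl; ring.
have := pair_quad_lipschitz Sa Sb (sphere_sum_le Sz Sy) (sphere_sum_le Sz Sz).
rewrite -/(mass _ w) -/(mass ((z : V) + (z : V)) w) e2 ler_norml => /andP[k1 _].
have : enorm ((z : V) + (y : V) - ((z : V) + (z : V))) <= eta.
  rewrite opprD addrACA subrr add0r enormB ltW//; exact: zy.
lra.
Qed.

Variables Fs phi : E -> R.
Hypotheses (bFs : bmeas S Fs) (bphi : bmeas S phi).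
Hypothesis phi_le1 : forall y, S y -> `|phi y| <= 1.
Variable L : R.
Hypothesis phi_lipschitz : forall y z, S y -> S z ->
  `|phi y - phi z| <= L * enorm ((y : V) - (z : V)).
Hypothesis small : forall (N : nat) (e : R), 0 < e -> exists m0 : nat,
  forall m (p q y : V), (m0 <= m)%N -> isotropic p q -> unit_sphere y ->
    `|\int[sigma]_(z in S) (Fs z * (quad p q (z : V) ^+ m * quad p q ((z : V) + y) ^+ N))| <=
    e * \int[sigma]_(z in S) (quad p q (z : V) ^+ m).

Let mean_kernel m N z := \int[P]_(w in O) (phi w.1 * kernel m N z w).

Let bmeas_phikernel m N z : S z -> bmeas O (fun w => phi w.1 * kernel m N z w).
Proof. by move=> Sz; exact: (bmeasM (bmeas_fst SS mS bphi) (bmeas_kernel m N Sz)). Qed.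

(** For [|y - z| <= d] the function [phi] varies by at most [L d]. Otherwise
    [|z + y|^2 = 4 - |y - z|^2 <= 4 - d^2], which bounds the kernel, while [phi] varies by at most
    2. *)
Let mean_kernel_near m N z (d e : R) : S z -> 0 <= d <= 1 -> L * d <= e -> 0 <= e ->
  `|mean_kernel m N z - phi z * total m N z| <=
  e * total m N z + 2 * (4 - d ^+ 2) ^+ N * moment m z.
Proof.
move=> Sz /andP[d0 d1] Ld e0.
have bk := bmeas_kernel m N Sz.
rewrite /mean_kernel /total -(RintZ P (phi z) mO bk) -(RintB P mO (bmeas_phikernel m N Sz) (bmeasZ _ bk)).
rewrite (le_trans (Rint_norm P mO (bmeasB (bmeas_phikernel m N Sz) (bmeasZ _ bk))))//.
have bm := bmeas_massO m Sz.
rewrite -(RintZ P e mO bk) /moment -(RintZ P _ mO bm) -(RintD P mO (bmeasZ _ bk) (bmeasZ _ bm)).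
apply: (Rint_le P mO (bmeas_norm (bmeasB (bmeas_phikernel m N Sz) (bmeasZ _ bk)))
  (bmeasD (bmeasZ _ bk) (bmeasZ _ bm))) => -[y w] Oyw; have [/= Sy Sw] := Oyw.
have k0 := kernel_ge0 m N Sz Oyw.
have /andP[q0 q1] := mass_le1 Sz Sw.
have /andP[p0 p4] := mass_le4 Sz Sy Sw.
rewrite -mulrBl normrM (ger0_norm k0).
have dd : 0 <= 4 - d ^+ 2 by nra.
have far0 : 0 <= 2 * (4 - d ^+ 2) ^+ N * mass z w ^+ m by rewrite !mulr_ge0 ?exprn_ge0.
have [yz|yz] := leP (enorm ((y : V) - (z : V))) d.
  have h : `|phi y - phi z| <= e.
    apply: (le_trans (phi_lipschitz Sy Sz)).
    have [L0|L0] := leP 0 L; first by apply: le_trans Ld; rewrite ler_wpM2l.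
    by have := enorm_ge0 ((y : V) - (z : V)); nra.
  by have := ler_wpM2r k0 h; lra.
have h1 : `|phi y - phi z| <= 2.
  by rewrite (le_trans (ler_normB _ _))//; have := phi_le1 Sy; have := phi_le1 Sz; lra.
have h2 : kernel m N z (y, w) <= (4 - d ^+ 2) ^+ N * mass z w ^+ m.
  rewrite /kernel /= mulrC; apply: ler_wpM2r; first exact: exprn_ge0.
  apply: lerXn2r; rewrite ?nnegrE//.
  have [Sa Sb] := Sw; apply: (le_trans (pair_quad_le Sa Sb _)).
  have : d ^+ 2 <= enorm ((y : V) - (z : V)) ^+ 2.
    by apply: lerXn2r; rewrite ?nnegrE ?enorm_ge0// ltW.
  rewrite sqr_enormB Sz Sy sqr_enorm dotpDl !dotpDr -!sqr_enorm Sz Sy (dotpC z y); lra.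
have h3 : `|phi y - phi z| * kernel m N z (y, w) <= 2 * ((4 - d ^+ 2) ^+ N * mass z w ^+ m).
  by apply: ler_pM.
have h4 : 0 <= e * kernel m N z (y, w) by rewrite mulr_ge0.
lra.
Qed.

(** After exchanging the integrals, the inner one over the sphere has [y], [a] and [b] fixed and is
    an instance of the hypothesis for the Gram-Schmidt pair of [a] and [b]. Averaging its right side
    gives the moment, which is the same at every point. *)
Let mean_kernel_small m N (e : R) z : 0 <= e -> S z ->
  (forall (p q y : V), isotropic p q -> unit_sphere y ->
    `|\int[sigma]_(z in S) (Fs z * (quad p q (z : V) ^+ m * quad p q ((z : V) + y) ^+ N))| <=
    e * \int[sigma]_(z in S) (quad p q (z : V) ^+ m)) ->
  `|\int[sigma]_(x in S) (Fs x * mean_kernel m N x)| <= e * moment m z.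
Proof.
move=> e0 Sz hsm.
have bG : bmeas (S `*` O) (fun t : E * (E * (E * E)) => Fs t.1 * (phi t.2.1 * kernel m N t.1 t.2)).
  apply: (bmeasM (bmeas_fst O mS bFs)); apply: (bmeasM _ (bmeas_kernel2 m N)).
  exact: (bmeas_snd S mO (bmeas_fst SS mS bphi)).
have -> : \int[sigma]_(x in S) (Fs x * mean_kernel m N x) =
    \int[P]_(w in O) \int[sigma]_(x in S) (Fs x * (phi w.1 * kernel m N x w)).
  rewrite -(Rint_swap sigma P mS mO bG); apply: Rint_eq => x Sx /=.
  by rewrite -(RintZ P _ mO (bmeas_phikernel m N Sx)).
have bI := bmeas_Rint2 sigma P mS mO bG.
rewrite (le_trans (Rint_norm P mO bI))//.
have bJ := bmeas_Rint2 sigma P mS mO (bmeas_mass2 m).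
apply: (@le_trans _ _ (\int[P]_(w in O) (e * \int[sigma]_(x in S) (mass x w.2 ^+ m)))).
  apply: (Rint_le P mO (bmeas_norm bI) (bmeasZ e bJ)) => -[y [a b]] [/= Sy [/= Sa Sb]].
  have Ow : O (y, (a, b)) by [].
  have bk : bmeas S (fun x => Fs x * kernel m N x (y, (a, b))).
    exact: (bmeasM bFs (bmeas_section2 mS mO Ow (bmeas_kernel2 m N))).
  rewrite (@Rint_eq _ _ _ sigma S _ (fun x => phi y * (Fs x * kernel m N x (y, (a, b))))); last first.
    by move=> x _; rewrite mulrCA.
  rewrite (RintZ sigma _ mS bk) normrM.
  have := hsm _ _ y (isotropic_pair Sa Sb) Sy.
  rewrite (@Rint_eq _ _ _ sigma S _ (fun x => Fs x * kernel m N x (y, (a, b)))); last first.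
    by move=> x _; rewrite /kernel /mass /= !pair_quadE.
  rewrite [in X in _ <= X -> _](@Rint_eq _ _ _ sigma S _ (fun x => mass x (a, b) ^+ m)); last first.
    by move=> x _; rewrite /mass /= pair_quadE.
  by move=> h; rewrite (le_trans _ h)// ler_piMl//; exact: phi_le1.
rewrite (RintZ P e mO bJ) -(Rint_swap sigma P mS mO (bmeas_mass2 m)).
apply: ler_wpM2l => //; rewrite -(Rint_cst (moment m z) mS S1).
by rewrite le_eqVlt; apply/orP; left; apply/eqP; apply: Rint_eq => x Sx; exact: moment_zonal.
Qed.

(** [mean_kernel] differs from [K phi] by at most [3 e K] on the sphere, and its integral against
    [Fs] is at most [e K]. Division by the constant [K] leaves [e (1 + 3 C)]. *)
Lemma lipschitz_orthogonal : \int[sigma]_(z in S) (Fs z * phi z) = 0.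
Proof.
have [z0 Sz0] := sphere_neq0 hsigma.
have [_ [C hC]] := bFs.
have C0 : 0 <= C by rewrite (le_trans _ (hC _ Sz0)).
set I := \int[sigma]_(z in S) _.
suff h : forall e : R, 0 < e -> `|I| <= e * (1 + 3 * C).
  apply/eqP; rewrite -normr_le0; apply/ler_addgt0Pl => e e0; rewrite addr0.
  have C1 : 0 < 1 + 3 * C by lra.
  by have := h (e / (1 + 3 * C)) (divr_gt0 e0 C1); rewrite divfK// gt_eqF.
move=> e e0.
have [d d01 Ld] : exists2 d : R, 0 < d <= 1 & L * d <= e.
  have L1 : 0 < `|L| + 1 by rewrite ltr_wpDl.
  exists (Num.min 1 (e / (`|L| + 1))).
    by rewrite lt_min ltr01 divr_gt0//= ge_min lexx.
  have : Num.min 1 (e / (`|L| + 1)) * (`|L| + 1) <= e.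
    by rewrite -ler_pdivlMr// ge_min lexx orbT.
  have m0 : 0 <= Num.min 1 (e / (`|L| + 1)) by rewrite le_min ler01 divr_ge0// ltW.
  have := ler_norm L; move: (Num.min _ _) m0 => d; nra.
have [d0 d1] := andP d01.
(* Then [4 - 12 eta = 4 - d^2 / 2] exceeds [4 - d^2], so for large [N] the lower bound in [total_ge]
   dominates the far part in [mean_kernel_near]. *)
pose eta := d ^+ 2 / 24.
have d2 : 0 < d ^+ 2 <= 1 by rewrite exprn_gt0//= expr_le1// ltW.
have [d20 d21] := andP d2.
have eta01 : 0 < eta < 1 / 3 by rewrite /eta; lra.
have eta1 : 0 < 1 - eta < 1 by rewrite /eta; lra.
pose s0 := fine (sigma (cap (z0 : V) eta)).
have s00 : 0 < s0 by apply: fine_cap_gt0 => //; case/andP: eta01.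
have [N hN] : exists N : nat, (4 - d ^+ 2) ^+ N <= e * s0 / 2 * (4 - 12 * eta) ^+ N.
  have q0 : 0 <= 4 - d ^+ 2 < 4 - 12 * eta by rewrite /eta; lra.
  have es : 0 < e * s0 / 2 by rewrite divr_gt0// mulr_gt0.
  by have [N hN] := expr_negligible q0 es; exists N; exact: hN.
(* By [total_ge], [e1] times the moment is at most [e K]. The same number bounds the far part and
   sets the accuracy asked of [small]; it depends on [N], hence so does the threshold [m2]. *)
pose e1 := e * s0 / 2 * (4 - 12 * eta) ^+ N.
have e10 : 0 < e1 by rewrite mulr_gt0 ?exprn_gt0 ?divr_gt0 ?mulr_gt0//; rewrite /eta; lra.
have [m1 hm1] := moment_concentrates eta1 Sz0.
have [m2 hm2] := small N e10.
pose m := maxn m1 m2.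
have hK := total_ge N eta01 Sz0 (hm1 m (leq_maxl _ _)).
have hS := mean_kernel_small (ltW e10) Sz0 (fun p q y => hm2 m p q y (leq_maxr _ _)).
set K := total m N z0 in hK.
have M0 := moment_gt0 m Sz0; set c := moment m z0 in hK hS M0.
have K0 : 0 < K.
  apply: lt_le_trans hK; rewrite mulr_gt0 ?divr_gt0// mulr_gt0// exprn_gt0//; rewrite /eta; lra.
have eK : e1 * c <= e * K.
  have := ler_wpM2l (ltW e0) hK; rewrite /e1 -/s0; lra.
have far : (4 - d ^+ 2) ^+ N * c <= e * K by apply: le_trans eK; rewrite ler_wpM2r// ltW.
have near z : S z -> `|mean_kernel m N z - phi z * K| <= 3 * e * K.
  move=> Sz; have d01' : 0 <= d <= 1 by rewrite ltW.
  have := mean_kernel_near m N Sz d01' Ld (ltW e0).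
  rewrite (total_zonal m N Sz Sz0) (moment_zonal m Sz Sz0) -/K -/c; lra.
have bmk : bmeas S (mean_kernel m N).
  have bG : bmeas (S `*` O) (fun t : E * (E * (E * E)) => phi t.2.1 * kernel m N t.1 t.2).
    apply: (bmeasM _ (bmeas_kernel2 m N)); exact: (bmeas_snd S mO (bmeas_fst SS mS bphi)).
  exact: (bmeas_Rint1 sigma P mS mO bG).
have bpK : bmeas S (fun z => K * phi z) by exact: bmeasZ.
have b1 := bmeasM bFs bmk; have b2 := bmeasZ K (bmeasM bFs bphi).
have bd := bmeasB b1 b2.
have hd : `|\int[sigma]_(z in S) (Fs z * mean_kernel m N z - K * (Fs z * phi z))| <= C * (3 * e * K).
  apply: (Rint_norm_le mS S1 bd) => z Sz.
  rewrite (_ : _ - _ = Fs z * (mean_kernel m N z - phi z * K)); last by ring.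
  by rewrite normrM; apply: ler_pM => //; [exact: hC|exact: near].
have kd : `|K * I| <= K * (e * (1 + 3 * C)).
  have eI : K * I = \int[sigma]_(z in S) (Fs z * mean_kernel m N z) -
      \int[sigma]_(z in S) (Fs z * mean_kernel m N z - K * (Fs z * phi z)).
    by rewrite (RintB sigma mS b1 b2) (RintZ sigma K mS (bmeasM bFs bphi)) -/I; ring.
  rewrite eI (le_trans (ler_normB _ _))//; lra.
by move: kd; rewrite normrM (ger0_norm (ltW K0)) ler_pM2l.
Qed.

End Averaging.

(** * Vanishing almost everywhere *)

Section Distance.
Context {R : realType} {n : nat}.
Local Notation V := 'rV[R]_n.
Variable C : set V.
Hypothesis C0 : C !=set0.

Definition dist (y : V) : R := inf [set enorm (y - c) | c in C].

Let has_inf_dist y : has_inf [set enorm (y - c) | c in C].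
Proof.
have [c Cc] := C0; split; first by exists (enorm (y - c)), c.
by exists 0 => _ [x _ <-]; exact: enorm_ge0.
Qed.

Lemma dist_ge0 y : 0 <= dist y.
Proof.
by apply: lb_le_inf => [|_ [x _ <-]]; [case: (has_inf_dist y)|exact: enorm_ge0].
Qed.

Lemma dist_le y c : C c -> dist y <= enorm (y - c).
Proof. by move=> Cc; apply: ge_inf; [case: (has_inf_dist y)|exists c]. Qed.

Lemma dist_lipschitz y z : `|dist y - dist z| <= enorm (y - z).
Proof.
have h a b : dist a <= dist b + enorm (a - b).
  rewrite -lerBlDr; apply: lb_le_inf => [|_ [c Cc <-]]; first by case: (has_inf_dist b).
  rewrite lerBlDr (le_trans (dist_le a Cc))//.
  by have := enormD (a - b) (b - c); rewrite addrA subrK; lra.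
have := h y z; have := h z y; rewrite (enormB z y) ler_norml; lra.
Qed.

Lemma dist_in y : C y -> dist y = 0.
Proof.
by move=> Cy; apply/le_anti; rewrite dist_ge0 andbT (le_trans (dist_le y Cy))// subrr enorm0.
Qed.

Lemma dist_out y : closed C -> ~ C y -> 0 < dist y.
Proof.
move=> cC nCy; have : nbhs y (~` C) by apply: open_nbhs_nbhs; split => //; exact: closed_openC.
move=> /nbhs_enorm[e e0 he]; apply: (lt_le_trans e0); apply: lb_le_inf => [|_ [c Cc <-]].
  by case: (has_inf_dist y).
by rewrite leNgt enormB; apply/negP => /he; exact.
Qed.

(** Lipschitz cut-offs that equal 1 on [C] and tend to the indicator of a closed [C]; they link
    Lipschitz test functions to sets. *)
Definition bump (j : nat) (y : V) : R := Num.max 0 (1 - j%:R * dist y).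

Lemma bump_bounds j y : 0 <= bump j y <= 1.
Proof.
rewrite /bump le_max lexx/= ge_max ler01/= gerBl mulr_ge0 ?dist_ge0//.
Qed.

Lemma bump_lipschitz j y z : `|bump j y - bump j z| <= j%:R * enorm (y - z).
Proof.
have h (a b : R) : `|Num.max 0 a - Num.max 0 b| <= `|a - b|.
  have := ler_norm (a - b); have := ler_norm (b - a); rewrite (distrC b a) ler_norml.
  by rewrite !maxEle; case: ifP => ha; case: ifP => hb; lra.
rewrite /bump (le_trans (h _ _))//.
rewrite (_ : _ - _ = j%:R * (dist z - dist y)); last by ring.
by rewrite normrM ger0_norm// ler_wpM2l// enormB dist_lipschitz.
Qed.

Lemma bump_continuous j : continuous (bump j).
Proof.
move=> x; apply/(@cvgrPdist_le _ _ _ (nbhs x)) => e e0.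
have j0 : 0 < j%:R + 1 :> R by rewrite ltr_wpDl.
have := @nbhs_enorm_lt R n x (e / (j%:R + 1)) (divr_gt0 e0 j0).
apply: filterS => y hy; rewrite distrC (le_trans (bump_lipschitz j y x))//.
move: hy; rewrite ltr_pdivlMr// => hy; have := enorm_ge0 (y - x); nra.
Qed.

Lemma bump_cvg y : closed C -> bump j y @[j --> \oo] --> (\1_C y : R).
Proof.
move=> cC; rewrite indicE; have [/set_mem Cy|/negP nCy] := boolP (y \in C).
  rewrite (_ : (fun j => _) = fun=> 1); first exact: cvg_cst.
  by apply/funext => j; rewrite /bump dist_in// mulr0 subr0 max_r.
have d0 : 0 < dist y by apply: dist_out => // Cy; apply: nCy; exact: mem_set.
apply: cvg_near_cst; have d1 : 0 < (dist y)^-1 by rewrite invr_gt0.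
have := nbhs_infty_ger (dist y)^-1; apply: filterS => j hj.
rewrite /bump max_l// subr_le0 -ler_pdivrMr// mul1r; exact: hj.
Qed.

End Distance.

Section AlmostEverywhere.
Context {R : realType} {n : nat}.
Local Notation E := (borel_space R n).
Variable sigma : probability E R.
Hypothesis hsigma : invariant_probability_on sigma unit_sphere.
Local Notation S := (unit_sphere : set E).
Local Notation V := 'rV[R]_n.

Let mS := @measurable_sphere R n.
Let S1 : sigma S = 1%E. Proof. by case: hsigma. Qed.

Definition lipschitz_annihilated (g : E -> R) := forall (phi : E -> R) (L : R),
  bmeas S phi -> (forall y, S y -> `|phi y| <= 1) ->
  (forall y z, S y -> S z -> `|phi y - phi z| <= L * enorm ((y : V) - (z : V))) ->
  \int[sigma]_(z in S) (g z * phi z) = 0.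

(** The bumps are admissible test functions, and dominated convergence, with [|g|] as majorant,
    passes to the indicator. *)
Let compact_annihilated (g : E -> R) (C : set V) : bmeas S g ->
  lipschitz_annihilated g -> C !=set0 -> closed C ->
  \int[sigma]_(z in S) (g z * \1_C z) = 0.
Proof.
move=> bg hg C0 cC.
have bb j : bmeas S (bump C j : E -> R).
  by apply: (bmeas_continuous mS (@sphere_enorm_le1 R n)); exact: bump_continuous.
have bj j := bmeasM bg (bb j).
have mj j : measurable_fun S (fun z : E => (g z * bump C j z)%:E).
  by apply/measurable_EFinP; case: (bj j).
have ig := bmeas_integrable sigma mS (bmeas_norm bg).
have h1 : forall z, S z -> (fun j => (g z * bump C j z)%:E) @ \oo --> (g z * \1_C z)%:E.
  move=> z Sz; apply: cvg_EFin; first exact: nearW.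
  by apply: cvgM; [exact: cvg_cst|exact: bump_cvg].
have h2 : forall j (z : E), S z -> (`|(g z * bump C j z)%:E| <= `|g z|%:E)%E.
  move=> j z Sz; have /andP[p0 p1] := bump_bounds C0 j (z : V).
  by rewrite /= lee_fin normrM (ger0_norm p0) ler_piMr.
have := @dominated_cvg _ _ _ sigma S mS (fun j z => (g z * bump C j z)%:E)
  (fun z => (g z * \1_C z)%:E) (fun z => `|g z|%:E) mj h1 (fun _ _ => isT) ig h2.
have z0 j : (\int[sigma]_(z in S) (g z * bump C j z)%:E = 0)%E.
  rewrite -(EFin_Rint sigma mS (bj j)) (hg _ j%:R)//.
    by move=> y Sy; have /andP[p0 p1] := bump_bounds C0 j (y : V); rewrite ger0_norm.
  by move=> y z _ _; exact: bump_lipschitz.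
rewrite (_ : (fun j => _) = fun=> 0%E); last by apply/funext => j; exact: z0.
move=> h; have e := cvg_unique _ h (cvg_cst _).
by rewrite /Rintegral e.
Qed.

(** By inner regularity it suffices to consider compact [C] inside the level set, and there
    [e sigma(C)] is at most the integral of [g] over [C], which is 0. *)
Let level_null (g : E -> R) (e : R) : bmeas S g -> lipschitz_annihilated g -> 0 < e ->
  sigma.-negligible [set z | S z /\ e <= g z].
Proof.
move=> bg hg e0; have [mg _] := bg.
have mA : measurable [set z | S z /\ e <= g z].
  have := mg mS _ (measurable_itv `[e, +oo[); congr measurable.
  by apply/seteqP; split=> z; rewrite /= in_itv/= andbT.
exists [set z | S z /\ e <= g z]; split=> //; apply/eqP; rewrite eq_le measure_ge0 andbT.
have [_ hreg _] := hsigma; have [_ ->] := hreg _ mA.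
apply: ge_ereal_sup => _ [C [cC CA] <-].
have clC : closed C by apply: compact_closed.
have mC : measurable (C : set E) by exact: closed_measurable.
have [->|C0] := eqVneq C set0; first by rewrite measure0.
have {}C0 : C !=set0 by exact/set0P.
have bC : bmeas S (\1_C : E -> R) by exact: bmeas_indic.
have i0 := compact_annihilated bg hg C0 clC.
have : e * fine (sigma C) <= 0.
  rewrite -i0 (_ : fine (sigma C) = \int[sigma]_(z in S) (\1_C z)); last first.
    by rewrite Rint_indic//; congr fine; apply/esym; exact: measureI_full.
  rewrite -(RintZ sigma e mS bC).
  apply: (Rint_le sigma mS (bmeasZ e bC) (bmeasM bg bC)) => z Sz.
  rewrite indicE; have [/set_mem Cz|_] := boolP (z \in _); last by rewrite !mulr0.
  by rewrite !mulr1; case: (CA _ Cz).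
rewrite pmulr_rle0// => h.
by rewrite -[X in (X <= _)%E]fineK ?fin_num_measure.
Qed.

Lemma lipschitz_annihilated_ae0 (g : E -> R) : bmeas S g -> lipschitz_annihilated g ->
  {ae sigma, forall z, S z -> g z = 0}.
Proof.
move=> bg hg.
have hNg : lipschitz_annihilated (fun z => - g z).
  move=> phi L bphi phi1 phiL; rewrite -[RHS](mulr0 (-1)) -(hg phi L bphi phi1 phiL).
  rewrite -(RintZ sigma (-1) mS (bmeasM bg bphi)); apply: Rint_eq => z _.
  by rewrite mulN1r mulNr.
pose A (k : nat) := [set z | S z /\ k.+1%:R^-1 <= g z] `|` [set z | S z /\ k.+1%:R^-1 <= - g z].
have nA : sigma.-negligible (\bigcup_k A k).
  apply: negligible_bigcup => k; apply: negligibleU.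
    by apply: level_null => //; rewrite invr_gt0.
  by apply: (level_null (bmeasN bg) hNg); rewrite invr_gt0.
apply: negligibleS nA => z /= h.
have [Sz gz] : S z /\ g z <> 0.
  by split; [apply: contrapT => nS|move=> gz]; apply: h.
have g0 : 0 < `|g z| by rewrite normr_gt0; apply/eqP.
have [k _ hk] := near_infty_natSinv_lt (PosNum g0).
have := hk k (leqnn k) => /= kz; exists k => //.
move: kz; rewrite /A/=; have [g1|g1] := leP 0 (g z).
  by rewrite ger0_norm// => kz; left; split => //; exact: ltW.
by rewrite ltr0_norm// => kz; right; split => //; exact: ltW.
Qed.

End AlmostEverywhere.

(** * Compactness forces the boundary function to vanish *)

Section ZeroIfCompact.
Context {R : realType} {n : nat}.
Local Notation E := (borel_space R n).
Variables sigma nu : probability E R.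
Hypothesis hsigma : invariant_probability_on sigma unit_sphere.
Hypothesis hnu : invariant_probability_on nu unit_ball.
Hypothesis hnu_bdry : forall r : R, 0 < r -> r < 1 ->
  (0 < nu [set x | unit_ball x /\ (r <= enorm x)%R])%E.
Hypothesis n1 : (1 < n)%N.
Variables f fs : 'rV[R]_n -> R[i].
Hypothesis mf : cmeasurable unit_ball f.
Hypothesis bf : bounded_on unit_ball f.
Hypothesis hfs : uniform_radial_limit f fs.
Hypothesis hT : compact_operator nu (toeplitz nu f).
Local Notation B := (unit_ball : set E).
Local Notation S := (unit_sphere : set E).
Local Notation V := 'rV[R]_n.

Let mB := @measurable_ball R n.
Let mS := @measurable_sphere R n.

(** Measurability of the boundary function is inherited from the dilates [F (r_k z)], which converge
    to it pointwise on the sphere; its bound comes from one fixed radius. *)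
Lemma bmeas_radial_limit (F Fs : E -> R) : bmeas B F ->
  (forall e : R, 0 < e -> exists2 s : R, 0 < s < 1 &
    forall (r : R) (z : V), s <= r -> r < 1 -> unit_sphere z -> `|F (r *: z) - Fs z| <= e) ->
  bmeas S Fs.
Proof.
move=> [mF [M hM]] hlim.
(* The offset in [k.+2] makes the first radius [1 / 2] and keeps all of them strictly between 0 and
   1. *)
pose r (k : nat) : R := 1 - k.+2%:R^-1.
have r01 k : 0 < r k < 1.
  by rewrite subr_gt0 invf_lt1// ltr1n/= ltrBlDr ltrDl invr_gt0.
have rB k z : S z -> B (r k *: (z : V)).
  move=> Sz; have /andP[h0 h1] := r01 k.
  by rewrite /unit_ball/= enormZ Sz mulr1 ger0_norm// ltW.
split; last first.
  have [s /andP[s0 s1] hs] := hlim 1 ltr01; exists (M + 1) => z Sz.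
  have h := hs s z (lexx s) s1 Sz.
  have Bz : B (s *: (z : V)) by rewrite /unit_ball/= enormZ Sz mulr1 ger0_norm// ltW.
  have := hM _ Bz; have := ler_normB (F (s *: (z : V))) (F (s *: (z : V)) - Fs z).
  by rewrite (_ : _ - (_ - _) = Fs z); [lra|ring].
apply: (@measurable_fun_cvg _ _ _ S (fun k (z : E) => F (r k *: (z : V)))).
  move=> k; apply: (@measurable_comp _ _ _ _ _ _ B F S (fun z => (r k *: (z : V) : E))) => //.
    by move=> _ [z Sz <-]; exact: rB.
  apply: measurable_funTS; apply: row_continuous_comp_measurable.
  exact: scaler_continuous.
move=> z Sz; apply/cvgrPdist_le => e e0; have [s /andP[s0 s1] hs] := hlim e e0.
have d0 : 0 < 1 - s by rewrite subr_gt0.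
have := near_infty_natSinv_lt (PosNum d0); apply: filterS => k /= hk.
rewrite distrC; apply: hs => //; last by case/andP: (r01 k).
have : k.+2%:R^-1 <= k.+1%:R^-1 :> R by rewrite lef_pV2 ?posrE// ler_nat.
have : k.+1%:R^-1 < 1 - s by exact: hk.
by rewrite /r; move: (k.+2%:R^-1) (k.+1%:R^-1) => a b; lra.
Qed.

Let annihilated (F Fs : E -> R) : F = re f \/ F = im f -> bmeas B F ->
  (forall e : R, 0 < e -> exists2 s : R, 0 < s < 1 &
    forall (r : R) (z : V), s <= r -> r < 1 -> unit_sphere z -> `|F (r *: z) - Fs z| <= e) ->
  {ae sigma, forall z, S z -> Fs z = 0}.
Proof.
move=> hF bF hlim; have bFs := bmeas_radial_limit bF hlim.
have n0 : (0 < n)%N by exact: ltnW.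
have small := test_small hsigma hnu hnu_bdry n0 mf bf hT hF.
have ssmall := sphere_small hsigma hnu hnu_bdry bF bFs hlim small.
apply: (lipschitz_annihilated_ae0 hsigma bFs) => phi L bphi phi1 phiL.
exact: (lipschitz_orthogonal hsigma n1 bFs bphi phi1 phiL ssmall).
Qed.

Theorem radial_limit_ae0 : {ae sigma, forall z, S z -> fs z = 0}.
Proof.
have [b1 b2] := bmeas_re_im mf bf.
have [|N1 [mN1 N10 h1]] := @annihilated (re f) (re fs) (or_introl erefl) b1.
  move=> e e0; have [s s01 hs] := uniform_radial_limit_near hfs e0; exists s => // r z sr r1 Sz.
  by rewrite /re -ReB (le_trans (Re_le_normc _))// hs.
have [|N2 [mN2 N20 h2]] := @annihilated (im f) (im fs) (or_intror erefl) b2.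
  move=> e e0; have [s s01 hs] := uniform_radial_limit_near hfs e0; exists s => // r z sr r1 Sz.
  by rewrite /im -ImB (le_trans (Im_le_normc _))// hs.
have nN : sigma.-negligible (N1 `|` N2) by apply: negligibleU; [exists N1; split|exists N2; split].
apply: negligibleS nN => z /= h; apply: contrapT => /not_orP[nz1 nz2]; apply: h => Sz.
have r0 : re fs z = 0 by apply: contrapT => r0; apply: nz1; apply: h1 => /(_ Sz).
have i0 : im fs z = 0 by apply: contrapT => i0; apply: nz2; apply: h2 => /(_ Sz).
by move: r0 i0; rewrite /re /im; case: (fs z) => a b /= -> ->.
Qed.

End ZeroIfCompact.

Theorem corollary5p5 (R : realType) (n : nat) (hn : (2 <= n)%N)
    (sigma : probability (borel_space R n) R)
    (hsigma : invariant_probability_on sigma unit_sphere)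
    (nu : probability (borel_space R n) R)
    (hnu : invariant_probability_on nu unit_ball)
    (hnu_bdry : forall r : R, 0 < r -> r < 1 ->
       (0 < nu [set x | unit_ball x /\ (r <= enorm x)%R])%E)
    (f : 'rV[R]_n -> R[i])
    (hf_meas : cmeasurable unit_ball f)
    (hf_bdd : bounded_on unit_ball f)
    (fs : 'rV[R]_n -> R[i])
    (hfs : uniform_radial_limit f fs) :
  compact_operator nu (toeplitz nu f) <->
  {ae sigma, forall z, unit_sphere z -> fs z = 0}.
Proof.
split=> [hT|fs0].
  exact: (radial_limit_ae0 hsigma hnu hnu_bdry hn hf_meas hf_bdd hfs hT).
exact: (compact_toeplitz hsigma hnu hnu_bdry (ltnW hn) hf_meas hf_bdd hfs fs0).
Qed.
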